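(* Let the correlation kernel $K$ be a Rational Quadratic kernel (any parameter $\nu>0$), the Squared Exponential kernel, or a Matérn kernel with smoothness $\nu\ge 1$. Then there exists a hyperplane $\mathcal H_n$ of $\mathbb R^n$ such that for every observation vector $\boldsymbol y\in\mathbb R^n\setminus\mathcal H_n$ the reference posterior distribution $\pi(\theta\mid\boldsymbol y)\propto L_{\boldsymbol y}(\theta)\,\pi(\theta)$ is proper, i.e. $\int_0^{+\infty}L_{\boldsymbol y}(\theta)\,\pi(\theta)\,d\theta<+\infty$.
   Context: Let $r\ge1$, $n\ge1$, $0\le p<n$ be integers and let $\boldsymbol x^{(1)},\dots,\boldsymbol x^{(n)}\in\mathbb R^r$ be distinct fixed points (the design set). For $\theta>0$ put $K_\theta(t)=K(t/\theta)$ and let $\boldsymbol\Sigma_\theta$ be the $n\times n$ matrix with $(i,i')$-th element $K_\theta(\|\boldsymbol x^{(i)}-\boldsymbol x^{(i')}\|)$ ($\|\cdot\|$ the Euclidean norm). Kernels ($K(0)=1$ and, for $t>0$): Rational Quadratic with parameter $\nu>0$: $K(t)=(1+t^2)^{-\nu}$; Squared Exponential: $K(t)=e^{-t^2}$; Matérn with smoothness $\nu>0$: $K(t)=\Gamma(\nu)^{-1}2^{1-\nu}(2\sqrt\nu\,t)^\nu\mathcal K_\nu(2\sqrt\nu\,t)$, with $\mathcal K_\nu$ the modified Bessel function of the second kind. For these kernels $\boldsymbol\Sigma_\theta$ is symmetric positive definite. If $p\ge1$, $\boldsymbol H$ is a fixed $n\times p$ matrix of rank $p$ and $\boldsymbol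 W$ is a fixed $n\times(n-p)$ matrix with $\boldsymbol W^\top\boldsymbol W=\boldsymbol I_{n-p}$ and $\boldsymbol H^\top\boldsymbol W=\boldsymbol 0$. If $p=0$, terms involving $\boldsymbol H$ (and $\boldsymbol\beta$) are ignored and $\boldsymbol W$ is a fixed orthogonal $n\times n$ matrix, e.g. $\boldsymbol I_n$. Put $\boldsymbol\Sigma^{\boldsymbol W}_\theta=\boldsymbol W^\top\boldsymbol\Sigma_\theta\boldsymbol W$. The (marginal) reference prior on $\theta$ is, up to a positive multiplicative constant, $$\pi(\theta)=\sqrt{\operatorname{Tr}\Big[\Big\{\big(\tfrac{d}{d\theta}\boldsymbol\Sigma^{\boldsymbol W}_\theta\big)(\boldsymbol\Sigma^{\boldsymbol W}_\theta)^{-1}\Big\}^2\Big]-\frac1{n-p}\Big[\operatorname{Tr}\Big\{\big(\tfrac{d}{d\theta}\boldsymbol\Sigma^{\boldsymbol W}_\theta\big)(\boldsymbol\Sigma^{\boldsymbol W}_\theta)^{-1}\Big\}\Big]^2}.$$ The likelihood is $L_{\boldsymbol y}(\boldsymbol\beta,\sigma^2,\theta)=(2\pi\sigma^2)^{-n/2}|\boldsymbol\Sigma_\theta|^{-1/2}\exp\{-\frac1{2\sigma^2}(\boldsymbol y-\boldsymbol H\boldsymbol\beta)^\top\boldsymbol\Sigma_\theta^{-1}(\boldsymbol y-\boldsymbol H\boldsymbol\beta)\}$ and the integrated likelihood is $L_{\boldsymbol y}(\theta)=\int_0^\infty\int_{\mathbb R^p}L_{\boldsymbol y}(\boldsymbol\beta,\sigma^2,\theta)\,d\boldsymbol\beta\,\frac{d\sigma^2}{\sigma^2}$,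 which equals, up to a positive constant not depending on $\theta$, $|\boldsymbol W^\top\boldsymbol\Sigma_\theta\boldsymbol W|^{-1/2}\big(\boldsymbol y^\top\boldsymbol W(\boldsymbol W^\top\boldsymbol\Sigma_\theta\boldsymbol W)^{-1}\boldsymbol W^\top\boldsymbol y\big)^{-(n-p)/2}$. A hyperplane of $\mathbb R^n$ is a vector subspace of dimension $n-1$. *)

(* Defs.v *)
From HB Require Import structures.
From mathcomp Require Import all_boot all_order all_algebra.
From mathcomp Require Import all_classical all_reals all_analysis.

Set Implicit Arguments.
Unset Strict Implicit.
Unset Printing Implicit Defensive.

Import Order.TTheory GRing.Theory Num.Theory.
Import numFieldNormedType.Exports.

Local Open Scope classical_set_scope.
Local Open Scope ring_scope.

Section special_functions.
Context {R : realType}.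
Implicit Types (nu t z : R).

Definition cosh t : R := (expR t + expR (- t)) / 2.

Definition Gamma nu : R :=
  \int[@lebesgue_measure R]_(t in `]0, +oo[) (t `^ (nu - 1) * expR (- t)).

(* The modified Bessel function of the second kind of order nu, at z > 0,
   by its classical integral representation. *)
Definition besselK nu z : R :=
  \int[@lebesgue_measure R]_(t in `]0, +oo[)
    (expR (- (z * cosh t)) * cosh (nu * t)).

End special_functions.

Section kernels.
Context {R : realType}.
Implicit Types (nu t : R).

Definition rational_quadratic nu t : R := (1 + t ^+ 2) `^ (- nu).

Definition squared_exponential t : R := expR (- t ^+ 2).

Definition matern nu t : R :=
  if t == 0 then 1 else
  (Gamma nu)^-1 * 2 `^ (1 - nu) * (2 * Num.sqrt nu * t) `^ nu
    * besselK nu (2 * Num.sqrt nu * t).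

End kernels.

Section gaussian_process.
Context {R : realType}.

(* The canonical norm on matrices in the library is the sup norm. *)
Definition euclid_norm r (u : 'rV[R]_r) : R :=
  Num.sqrt (\sum_(k < r) u 0 k ^+ 2).

Definition corr_mx (K : R -> R) r n (x : 'I_n -> 'rV[R]_r) (theta : R) :
    'M[R]_n :=
  \matrix_(i, j) K (euclid_norm (x i - x j) / theta).

Definition proj_mx_fun n m (W : 'M[R]_(n, m)) (S : R -> 'M[R]_n) (theta : R) :
    'M[R]_m :=
  W^T *m S theta *m W.

Definition deriv_mx m (S : R -> 'M[R]_m) (theta : R) : 'M[R]_m :=
  \matrix_(i, j) derive1 (fun t => S t i j) theta.

(* SW is the matrix W^T Sigma_theta W, of size m = n - p, as a function of
   theta. *)
Definition reference_prior m (SW : R -> 'M[R]_m) (theta : R) : R :=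
  let A := deriv_mx SW theta *m invmx (SW theta) in
  Num.sqrt (\tr (A *m A) - m%:R^-1 * (\tr A) ^+ 2).

Definition likelihood n p (H : 'M[R]_(n, p)) (S : R -> 'M[R]_n) (y : 'cV[R]_n)
    (beta : 'cV[R]_p) (sigma2 theta : R) : R :=
  let e := y - H *m beta in
  (2 * pi * sigma2) `^ (- (n%:R / 2)) * (\det (S theta)) `^ (- 2^-1)
    * expR (- ((2 * sigma2)^-1 * (e^T *m invmx (S theta) *m e) 0 0)).

(* Lebesgue integral over R^p of a nonnegative function, as an iterated
   integral (Tonelli); for p = 0 it is evaluation at the only point. *)
Fixpoint integral_cV (p : nat) : ('cV[R]_p -> \bar R) -> \bar R :=
  match p with
  | 0 => fun f => f 0
  | p'.+1 => fun f =>
      (\int[@lebesgue_measure R]_(b in [set: R])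
         integral_cV (fun v : 'cV[R]_p' => f (col_mx (b%:M : 'cV[R]_1) v)))%E
  end.

Definition integrated_likelihood n p (H : 'M[R]_(n, p)) (S : R -> 'M[R]_n)
    (y : 'cV[R]_n) (theta : R) : \bar R :=
  (\int[@lebesgue_measure R]_(sigma2 in `]0%R, +oo[)
     (integral_cV (fun beta => (likelihood H S y beta sigma2 theta)%:E)
      * (sigma2^-1)%:E))%E.

End gaussian_process.

(* Main.v *)
(* Each kernel is a scale mixture of Gaussians, K(tau) = E exp(- tau^2 T), where
   T is a power of a Gamma variable (constant for the Squared Exponential).  Put
   rho = theta^-2 and h_k(rho) = E min(1, rho T)^k.

   Choosing monomials greedily by degree gives a basis U of R^(n-p) whose i-th
   vector, pushed to R^n by W, annihilates all polynomials of degree < d_i on the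
   design.  The Gaussian quadratic form at scale a then dominates
   min(1, a)^(d_i) v_i^2 for every i, and its (i, j) entry is
   O(min(1, a)^((d_i + d_j) / 2)).  Averaging over T, the matrix
   S = U^T W^T Sigma_theta W U dominates the diagonal matrix of the h_(d_i)(rho),
   and its entries are O(sqrt(h_(d_i) h_(d_j))).  Hence
   - if the entries of S' - lam S are at most eta sqrt(h_(d_i) h_(d_j)) for some
     lam, then the prior is O(eta), since it is unchanged when S' is shifted by a
     multiple of S;
   - with d_(i0) maximal and y off the hyperplane (U e_(i0))^T W^T y = 0, the
     integrated likelihood is O(prod_i sqrt(h_(d_(i0)) / h_(d_i))).

   Near 0 the product of the two bounds is O(theta^(2 e - 1)) for some e > 0.  At
   infinity it is O(theta^-1 (1 + 2 ln theta)^(-3/2)); the power of the logarithm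
   is needed only for Matern kernels of integer smoothness nu equal to the least
   degree, where an integration by parts against the Gamma weight writes
   S' + 2 (nu / theta) S as a moment of lower order. *)

Require Import Defs.
From mathcomp Require Import all_boot all_order all_algebra.
From mathcomp Require Import all_classical all_reals all_analysis.
From mathcomp Require Import measurable_realfun lebesgue_integral_under.
From mathcomp Require Import ring lra.

Set Implicit Arguments.
Unset Strict Implicit.
Unset Printing Implicit Defensive.

Import Order.TTheory GRing.Theory Num.Theory.
Import numFieldNormedType.Exports.

Local Open Scope classical_set_scope.
Local Open Scope ring_scope.

(** Truncating at 1 in h_k is what lets one argument serve every kernel. For Matern kernels T is a
    multiple of an inverse Gamma variable, E T^k is infinite once k >= nu, and S has no Taylor
    expansion in rho to the order required; yet the same h_k bound S from both sides, and only their
    ratios enter.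

    At infinity the naive bound S' = O(S / theta) leaves a prior of order 1 / theta, which is not
    integrable. If the degrees differ, the gain comes from the likelihood: its product contains the
    ratio of the h_k of largest and least degree, which tends to 0. If they all equal k, that
    product is 1, but S is to leading order a scalar function of theta times a fixed matrix; taking
    for lam the logarithmic derivative of that scalar cancels the leading term of S'.

    In the critical Matern case h_nu is of order rho^nu ln(1 / rho) and h_(nu + 1) of order rho^nu,
    so each gain is only a power of the logarithm. With distinct degrees the likelihood gives the
    power -1/2, which is not enough, nor is the -1 given by the prior, as 1 / (theta ln theta) still
    diverges; together they reach -3/2. *)

Lemma eqW d (T : porderType d) (x y : T) : x = y -> (x <= y)%O.
Proof. by move->. Qed.

(** * Positive definite forms, Schur complements, diagonal lower bounds *)

Section quadratic_forms.
Context {R : realFieldType}.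

Definition qform n (A : 'M[R]_n) (v : 'cV[R]_n) : R := (v^T *m A *m v) 0 0.

Definition posdef n (A : 'M[R]_n) : Prop :=
  A^T = A /\ forall v : 'cV[R]_n, v != 0 -> 0 < qform A v.

Lemma qform_sum n (A : 'M[R]_n) v :
  qform A v = \sum_i \sum_j v i 0 * v j 0 * A i j.
Proof.
rewrite /qform mxE exchange_big /=; apply: eq_bigr => j _.
rewrite mxE mulr_suml; apply: eq_bigr => i _; rewrite !mxE; ring.
Qed.

Lemma qform_congr n m (A : 'M[R]_n) (P : 'M[R]_(n, m)) v :
  qform (P^T *m A *m P) v = qform A (P *m v).
Proof. by rewrite /qform trmx_mul !mulmxA. Qed.

Lemma qformZ n (A : 'M[R]_n) c v : qform A (c *: v) = c ^+ 2 * qform A v.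
Proof.
rewrite !qform_sum mulr_sumr; apply: eq_bigr => i _.
by rewrite mulr_sumr; apply: eq_bigr => j _; rewrite !mxE; ring.
Qed.

Lemma scalar_mx11 (M : 'M[R]_1) : M = (M 0 0)%:M.
Proof. by rewrite [LHS]mx11_scalar. Qed.

Lemma tr_mx11 (M : 'M[R]_1) : M^T = M.
Proof. by apply/matrixP => i j; rewrite mxE !ord1. Qed.

Lemma posdef_unit n (A : 'M[R]_n) : posdef A -> A \in unitmx.
Proof.
move=> [sA pA]; rewrite unitmxE unitfE; apply/negP => /det0P[v v0 vA].
have := pA v^T; rewrite trmx_eq0 => /(_ v0).
by rewrite /qform trmxK vA mul0mx mxE ltxx.
Qed.

Lemma posdef_congr n m (A : 'M[R]_n) (P : 'M[R]_(n, m)) :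
  posdef A -> (forall v : 'cV[R]_m, P *m v = 0 -> v = 0) ->
  posdef (P^T *m A *m P).
Proof.
move=> [sA pA] inj; split; first by rewrite !trmx_mul trmxK sA !mulmxA.
move=> v v0; rewrite qform_congr; apply: pA.
by apply: contra v0 => /eqP /inj ->.
Qed.

Lemma posdef_inv n (A : 'M[R]_n) : posdef A -> posdef (invmx A).
Proof.
move=> pA; have uA := posdef_unit pA; case: (pA) => sA _.
have -> : invmx A = (invmx A)^T *m A *m invmx A.
  by rewrite -mulmxA mulmxV // mulmx1 trmx_inv sA.
apply: posdef_congr => // v Av.
by rewrite -[v]mul1mx -(mulmxV uA) -mulmxA Av mulmx0.
Qed.

Lemma qform_invmx n (A : 'M[R]_n) (z : 'cV[R]_n) : A^T = A -> A \in unitmx ->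
  qform (invmx A) z = qform A (invmx A *m z).
Proof.
move=> sA uA; rewrite /qform trmx_mul trmx_inv sA -!mulmxA; congr ((_ *m _) 0 0).
by rewrite mulKVmx // !mulmxA.
Qed.

Lemma posdef1 n : posdef (1%:M : 'M[R]_n).
Proof.
split=> [|v v0]; first exact: trmx1.
rewrite /qform mulmx1 mxE lt_def; apply/andP; split; last first.
  by apply: sumr_ge0 => i _; rewrite mxE -expr2 sqr_ge0.
apply: contra v0; rewrite psumr_eq0; last first.
  by move=> i _; rewrite mxE -expr2 sqr_ge0.
move=> /allP v0; apply/eqP/matrixP => i j; rewrite ord1 [RHS]mxE; apply/eqP.
have := v0 i (mem_index_enum _).
by rewrite mxE /= mulf_eq0 orbb.
Qed.

Lemma qform_CS n (A : 'M[R]_n) (u v : 'cV[R]_n) : posdef A ->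
  ((u^T *m A *m v) 0 0) ^+ 2 <= qform A u * qform A v.
Proof.
move=> [sA pA]; have [->|v0] := eqVneq v 0.
  by rewrite /qform !mulmx0 mxE mulr0 expr0n.
have av := pA _ v0.
set b := (u^T *m A *m v) 0 0.
have b' : (v^T *m A *m u) 0 0 = b.
  by rewrite -[LHS]/(_) -(tr_mx11 (v^T *m A *m u)) !trmx_mul trmxK sA mulmxA.
(* This [t] minimises [qform A (u - t *: v)]; non-negativity at the minimum is the inequality. *)
set t := b / qform A v.
have : 0 <= qform A (u - t *: v).
  have [->|w0] := eqVneq (u - t *: v) 0; last exact: ltW (pA _ w0).
  by rewrite /qform mulmx0 mxE.
have -> : qform A (u - t *: v) = qform A u - b ^+ 2 / qform A v.
  have tr : (u - t *: v)^T = u^T - t *: v^T by rewrite linearB linearZ.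
  rewrite {1}/qform tr !mulmxBl !mulmxBr -!scalemxAl -!scalemxAr.
  move: b' av; rewrite /t /b /qform.
  move: (u^T *m A *m v) (v^T *m A *m v) (u^T *m A *m u) (v^T *m A *m u).
  move=> M1 M2 M3 M4 b' av; rewrite !mxE b'.
  by field; rewrite gt_eqF.
by rewrite subr_ge0 ler_pdivrMr.
Qed.

Lemma sqr_sum_mul_le n (f g : 'I_n -> R) :
  (\sum_i f i * g i) ^+ 2 <= (\sum_i f i ^+ 2) * (\sum_i g i ^+ 2).
Proof.
have := qform_CS (\col_i f i) (\col_i g i) (posdef1 n).
rewrite /qform !mulmx1; congr (_ ^+ 2 <= _ * _); rewrite mxE;
  by apply: eq_bigr => i _; rewrite !mxE ?expr2.
Qed.

Lemma sqr_sum_le n (f : 'I_n -> R) : (\sum_i f i) ^+ 2 <= n%:R * \sum_i f i ^+ 2.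
Proof.
have := sqr_sum_mul_le (fun _ => 1) f; rewrite expr1n sumr_const card_ord.
by congr (_ ^+ 2 <= _); apply: eq_bigr => i _; rewrite mul1r.
Qed.

(** Completing the square in [v] leaves the Schur complement of [D] as the coefficient of [x]. This
    identity drives the inductions on the size, for determinants as well as for Gaussian
    integrals. *)
Lemma block_qform p (a : 'M[R]_1) (b : 'cV[R]_p) (D : 'M[R]_p)
    (x : 'M[R]_1) (v : 'cV[R]_p) : D^T = D -> D \in unitmx ->
  qform (block_mx a b^T b D) (col_mx x v) =
  (x 0 0) ^+ 2 * (a - b^T *m invmx D *m b) 0 0
  + qform D (v + invmx D *m b *m x).
Proof.
move=> sD uD.
have e1 : (v + invmx D *m b *m x)^T *m D =
    v^T *m D + x^T *m b^T.
  rewrite linearD /= mulmxDl !trmx_mul trmx_inv sD; congr (_ + _).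
  by rewrite -!mulmxA mulVmx // mulmx1.
rewrite /qform e1 tr_col_mx mul_row_block mul_row_col.
rewrite !mulmxDl !mulmxDr !mulmxA mulmxK //.
rewrite (scalar_mx11 x) !tr_scalar_mx !mul_scalar_mx -!scalemxAl !mul_mx_scalar.
move: (b^T *m v) (v^T *m b) (v^T *m D *m v) (b^T *m invmx D *m b).
by move=> M1 M2 M3 M4; rewrite !mxE !eqxx !mulr1n; ring.
Qed.

Lemma qform_block0 p (a : 'M[R]_1) (b : 'cV[R]_p) (D : 'M[R]_p)
    (v : 'cV[R]_p) : qform (block_mx a b^T b D) (col_mx 0 v) = qform D v.
Proof.
rewrite /qform tr_col_mx trmx0 mul_row_block mul_row_col.
by rewrite !mul0mx mulmx0 !add0r.
Qed.

Lemma det_block_sym p (a : 'M[R]_1) (b : 'cV[R]_p) (D : 'M[R]_p) :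
  D \in unitmx ->
  \det (block_mx a b^T b D) = (a - b^T *m invmx D *m b) 0 0 * \det D.
Proof.
move=> uD.
have -> : block_mx a b^T b D =
    block_mx 1%:M (b^T *m invmx D) 0 1%:M
    *m block_mx (a - b^T *m invmx D *m b) 0 b D.
  by rewrite mulmx_block !mul1mx !mul0mx !add0r mulmxKV // subrK.
rewrite det_mulmx det_ublock det_lblock !det1 !mul1r.
by rewrite {1}[a - _]scalar_mx11 det_scalar1.
Qed.

(** The last clause exhibits the Schur complement as the value of the form at a vector with first
    coordinate 1, so that any lower bound on the form passes to the complement. *)
Lemma posdef_block p (A : 'M[R]_(1 + p)) : posdef A ->
  exists (a : 'M[R]_1) (b : 'cV[R]_p) (D : 'M[R]_p),
  [/\ A = block_mx a b^T b D, posdef D,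
      0 < (a - b^T *m invmx D *m b) 0 0 &
      a - b^T *m invmx D *m b =
      (qform A (col_mx 1%:M (- (invmx D *m b))))%:M].
Proof.
move=> [sA pA]; exists (ulsubmx A), (dlsubmx A), (drsubmx A).
have eA : A = block_mx (ulsubmx A) (dlsubmx A)^T (dlsubmx A) (drsubmx A).
  by rewrite trmx_dlsub sA submxK.
set a := ulsubmx A in eA *; set b := dlsubmx A in eA *.
set D := drsubmx A in eA *.
have pD : posdef D.
  split; first by rewrite /D trmx_drsub sA.
  move=> v v0; have := pA (col_mx 0 v); rewrite col_mx_eq0 negb_and v0 orbT.
  by move=> /(_ isT); rewrite eA qform_block0.
have sD : D^T = D by case: pD.
have uD := posdef_unit pD.
have q1 : qform A (col_mx 1%:M (- (invmx D *m b))) =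
    (a - b^T *m invmx D *m b) 0 0.
  rewrite {1}eA block_qform // mulmx1 addNr /qform mulmx0.
  by rewrite [X in _ + X]mxE addr0 [X in X ^+ 2]mxE expr1n mul1r.
split => //; last by rewrite q1 -scalar_mx11.
rewrite -q1; apply: pA; rewrite col_mx_eq0 negb_and.
by apply/orP; left; apply/eqP => /matrixP/(_ 0 0); rewrite !mxE; apply/eqP/oner_neq0.
Qed.

Lemma posdef_det_gt0 n (A : 'M[R]_n) : posdef A -> 0 < \det A.
Proof.
elim: n A => [|n IH] A pA; first by rewrite det_mx00.
have [a [b [D [eA pD s0 _]]]] := @posdef_block n A pA.
rewrite eA det_block_sym; last exact: posdef_unit.
by rewrite mulr_gt0 // IH.
Qed.

Lemma diag_lower_posdef n (A : 'M[R]_n) (d : 'I_n -> R) : A^T = A ->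
  (forall i, 0 < d i) ->
  (forall v : 'cV_n, \sum_i d i * v i 0 ^+ 2 <= qform A v) -> posdef A.
Proof.
move=> sA d0 dA; split => // v v0; apply: lt_le_trans (dA v).
rewrite lt_def; apply/andP; split; last first.
  by apply: sumr_ge0 => i _; rewrite mulr_ge0 ?sqr_ge0 // ltW.
apply: contra v0; rewrite psumr_eq0; last first.
  by move=> i _; rewrite mulr_ge0 ?sqr_ge0 // ltW.
move=> /allP v0; apply/eqP/matrixP => i j; rewrite ord1 [RHS]mxE; apply/eqP.
have := v0 i (mem_index_enum _).
by rewrite mulf_eq0 gt_eqF ?d0 //= sqrf_eq0.
Qed.

(** Induction through the Schur complement: it is a value of the form at a vector with first
    coordinate 1, hence at least the first [d i], while the block [D] inherits the bound from
    vectors with first coordinate 0. *)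
Lemma diag_lower_det n (A : 'M[R]_n) (d : 'I_n -> R) : A^T = A ->
  (forall i, 0 < d i) ->
  (forall v : 'cV_n, \sum_i d i * v i 0 ^+ 2 <= qform A v) ->
  \prod_i d i <= \det A.
Proof.
elim: n A d => [|n IH] A d sA d0 dA; first by rewrite big_ord0 det_mx00.
have pA := diag_lower_posdef sA d0 dA.
have [a [b [D [eA pD _ s1]]]] := @posdef_block n A pA.
rewrite eA det_block_sym; last exact: posdef_unit.
rewrite big_ord_recl; apply: ler_pM.
- exact: ltW.
- by apply: prodr_ge0 => i _; exact: ltW.
- rewrite s1 !mxE mulr1n; apply: le_trans (dA _).
  rewrite big_ord_recl /= -[X in X <= _]addr0; apply: lerD.
    set w := - _; have -> : (col_mx 1%:M w : 'cV_n.+1) ord0 0 = 1; last first.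
      by rewrite expr1n mulr1.
    transitivity ((1%:M : 'M[R]_1) 0 0); last by rewrite mxE.
    have -> : ord0 = lshift n 0 :> 'I_(1 + n) by exact: val_inj.
    exact: col_mxEu.
  by apply: sumr_ge0 => i _; rewrite mulr_ge0 ?sqr_ge0 // ltW.
- apply: IH; [by case: pD|by move=> i; exact: d0|].
  move=> v; have := dA (@col_mx _ 1 n 1 0 v); rewrite eA => h.
  rewrite -(qform_block0 a b D v); apply: le_trans h.
  rewrite big_ord_recl /= -[X in X <= _]add0r; apply: lerD.
    by rewrite mulr_ge0 ?sqr_ge0 // ltW.
  apply: ler_sum => i _.
  have -> : lift ord0 i = rshift 1 i :> 'I_(1 + n) by exact: val_inj.
  apply: eqW; congr (_ * _ ^+ 2).
  exact/esym/(@col_mxEd _ 1 n 1 0 v i 0).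
Qed.

(** At the [j]-th column of the inverse the form takes the value [invmx A j j], so the lower bound
    gives [s k ^+ 2 * invmx A k j ^+ 2 <= invmx A j j]. The case [k = j] bounds the diagonal, which
    then bounds the other entries. *)
Lemma diag_lower_inv n (A : 'M[R]_n) (s : 'I_n -> R) : A^T = A ->
  (forall i, 0 < s i) ->
  (forall v : 'cV_n, \sum_i s i ^+ 2 * v i 0 ^+ 2 <= qform A v) ->
  forall i j, `|invmx A i j| <= (s i * s j)^-1.
Proof.
move=> sA s0 dA i j.
have pA : posdef A.
  by apply: diag_lower_posdef dA => // k; rewrite exprn_gt0.
have uA := posdef_unit pA.
have qv : qform A (col j (invmx A)) = invmx A j j.
  rewrite colE /qform -mulmxA mulKVmx // trmx_mul trmx_inv sA.
  by rewrite trmx_delta -rowE -colE !mxE.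
have dk k : s k ^+ 2 * invmx A k j ^+ 2 <= invmx A j j.
  rewrite -qv; apply: le_trans (dA _).
  rewrite (bigD1 k) //= mxE ler_wpDr //.
  by apply: sumr_ge0 => l _; rewrite mulr_ge0 ?sqr_ge0.
have ps : 0 < s i * s j by rewrite mulr_gt0.
have jj : invmx A j j <= (s j ^+ 2)^-1.
  rewrite -[leRHS]mul1r ler_pdivlMr ?exprn_gt0 // mulrC.
  have [->|B0] := eqVneq (invmx A j j) 0; first by rewrite mulr0 ler01.
  have Bp : 0 < invmx A j j.
    rewrite lt_def B0 (le_trans _ (dk j)) // mulr_ge0 ?sqr_ge0 //.
  rewrite -(ler_pM2r Bp) mul1r; apply: le_trans (dk j).
  by rewrite -mulrA -expr2.
rewrite -(ler_pXn2r (ltn0Sn 1)) ?nnegrE ?invr_ge0 ?(ltW ps) //.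
rewrite real_normK ?num_real // exprVn -[leRHS]mul1r ler_pdivlMr ?exprn_gt0 //.
rewrite exprMn mulrA [_ * s i ^+ 2]mulrC.
apply: le_trans (_ : invmx A j j * s j ^+ 2 <= _).
  by rewrite ler_pM2r ?exprn_gt0 // dk.
by rewrite -ler_pdivlMr ?exprn_gt0 // mul1r.
Qed.

End quadratic_forms.

(** * The radicand of the reference prior *)

Section trace_bound.
Context {R : rcfType}.

(* [m] times the variance of the eigenvalues of [X]: the radicand of the
   reference prior. *)
Definition trace_variance m (X : 'M[R]_m) : R :=
  \tr (X *m X) - m%:R^-1 * (\tr X) ^+ 2.

Lemma trace_variance_shift m (X : 'M[R]_m) (c : R) :
  trace_variance (X - c%:M) = trace_variance X.
Proof.
(* Size 0 is set apart because the computation below cancels [m%:R] against its inverse. *)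
case: m X => [|m] X; first by rewrite /trace_variance /mxtrace !big_ord0.
have e : (X - c%:M) *m (X - c%:M) = X *m X + (- (2 * c)) *: X + (c * c)%:M.
  rewrite mulmxBl !mulmxBr mul_scalar_mx mul_mx_scalar -scalar_mxM scaleNr.
  rewrite mulrDl mul1r scalerDl opprB addrA opprD.
  by rewrite addrAC !addrA.
rewrite /trace_variance e !mxtraceD mxtraceZ mxtrace_scalar.
have -> : \tr (- (c%:M : 'M[R]_m.+1)) = - (c * m.+1%:R).
  by rewrite -scaleN1r mxtraceZ mxtrace_scalar mulN1r mulr_natr.
rewrite -(mulr_natr (c * c)).
by field; rewrite nat1r pnatr_eq0.
Qed.

Lemma trace_variance_conj m (X : 'M[R]_m) (P : 'M[R]_m) : P \in unitmx ->
  trace_variance (P *m X *m invmx P) = trace_variance X.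
Proof.
move=> uP.
have trP (Y : 'M[R]_m) : \tr (P *m Y *m invmx P) = \tr Y.
  by rewrite mxtrace_mulC mulmxA mulVmx // mul1mx.
have e : P *m X *m invmx P *m (P *m X *m invmx P) = P *m (X *m X) *m invmx P.
  by rewrite -!mulmxA (mulmxA (invmx P)) mulVmx // mul1mx.
by rewrite /trace_variance e (trP X) (trP (X *m X)).
Qed.

(** After the shift, [X = (A' - c A) A^-1] has entries of order [eta * (s i / s j)]. The weights
    cancel in every product [X i j * X j i], so the trace of [X *m X] is controlled however
    disparate the [s i] are. *)
Lemma trace_variance_ratio m (A A' : 'M[R]_m) (s : 'I_m -> R) (c eta : R) :
  A^T = A -> (forall i, 0 < s i) ->
  (forall v : 'cV_m, \sum_i s i ^+ 2 * v i 0 ^+ 2 <= qform A v) ->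
  (forall i j, `|A' i j - c * A i j| <= eta * (s i * s j)) ->
  trace_variance (A' *m invmx A) <= (m%:R ^+ 2 * eta) ^+ 2.
Proof.
move=> sA s0 dA hA'.
have uA : A \in unitmx.
  apply/posdef_unit/(diag_lower_posdef sA _ dA) => i.
  by rewrite exprn_gt0.
rewrite -(trace_variance_shift _ c).
have -> : A' *m invmx A - c%:M = (A' - c *: A) *m invmx A.
  by rewrite mulmxBl -scalemxAl mulmxV // scalemx1.
set X := _ *m _.
have hX i j : `|X i j| <= m%:R * eta * (s i / s j).
  rewrite mxE; apply: le_trans (ler_norm_sum _ _ _) _.
  apply: le_trans (_ : \sum_(k < m) eta * (s i / s j) <= _); last first.
    by rewrite sumr_const card_ord -[X in X <= _]mulr_natl mulrA.
  apply: ler_sum => k _; rewrite normrM !mxE.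
  apply: le_trans (_ : eta * (s i * s k) * (s k * s j)^-1 <= _).
    by apply: ler_pM => //; apply: diag_lower_inv.
  by apply: eqW; field; rewrite !gt_eqF.
apply: le_trans (_ : \tr (X *m X) <= _).
  by rewrite /trace_variance gerBl mulr_ge0 ?sqr_ge0 // invr_ge0 ler0n.
rewrite /mxtrace; apply: le_trans (_ : \sum_(i < m) \sum_(j < m) (m%:R * eta) ^+ 2 <= _).
  apply: ler_sum => i _; rewrite mxE; apply: ler_sum => j _.
  apply: le_trans (ler_norm _) _; rewrite normrM.
  apply: le_trans (ler_pM _ _ (hX i j) (hX j i)) _ => //.
  apply: eqW.
  by field; rewrite !gt_eqF.
rewrite sumr_const card_ord sumr_const card_ord -mulrnA -[X in X <= _]mulr_natr.
rewrite natrM.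
apply: eqW; ring.
Qed.

End trace_bound.

Section prior_bound.
Context {R : realType}.

(** Passing from [S] to [U^T S U] conjugates [S' S^-1] by [U^T], which the trace variance does not
    see; the estimates may therefore be checked in a basis adapted to the design. *)
Lemma reference_prior_le m (S : R -> 'M[R]_m) (U : 'M[R]_m) (theta c eta : R)
    (s : 'I_m -> R) :
  (S theta)^T = S theta -> U \in unitmx -> (forall i, 0 < s i) -> 0 <= eta ->
  (forall v : 'cV_m, \sum_i s i ^+ 2 * v i 0 ^+ 2
     <= qform (U^T *m S theta *m U) v) ->
  (forall i j, `|(U^T *m (deriv_mx S theta - c *: S theta) *m U) i j|
     <= eta * (s i * s j)) ->
  reference_prior S theta <= m%:R ^+ 2 * eta.
Proof.
move=> sS uU s0 eta0 lS hS.
rewrite /reference_prior -/(trace_variance _).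
set A := U^T *m S theta *m U in lS.
set A' := U^T *m deriv_mx S theta *m U.
have uA : A \in unitmx.
  apply/posdef_unit/(diag_lower_posdef _ _ lS) => [|i].
    by rewrite /A !trmx_mul trmxK sS !mulmxA.
  by rewrite exprn_gt0.
have uUt : U^T \in unitmx by rewrite unitmx_tr.
have uS : S theta \in unitmx.
  by move: uA; rewrite /A !unitmx_mul uU uUt andbT.
have -> : trace_variance (deriv_mx S theta *m invmx (S theta)) =
    trace_variance (A' *m invmx A).
  rewrite -[LHS](trace_variance_conj _ uUt); congr trace_variance.
  apply: (can_inj (mulmxK uA)); rewrite mulmxKV // /A !mulmxA mulmxKV //.
  by rewrite mulmxKV.
have e0 : 0 <= m%:R ^+ 2 * eta by rewrite mulr_ge0 ?sqr_ge0.
rewrite -[leRHS]ger0_norm // -sqrtr_sqr ler_wsqrtr //.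
apply: (trace_variance_ratio (s := s) (c := c)) => // [|i j].
  by rewrite /A !trmx_mul trmxK sS !mulmxA.
have -> : A' i j - c * A i j =
    (U^T *m (deriv_mx S theta - c *: S theta) *m U) i j.
  by rewrite mulmxBr mulmxBl -scalemxAr -scalemxAl !mxE.
exact: hS.
Qed.

End prior_bound.

(** * Upper bounds on integrals through bounded primitives *)

Section integral_estimates.
Context {R : realType}.
Let mu := @lebesgue_measure R.
Import HBNNSimple.

(* Unlike [ge0_le_integral], no measurability is required: the integral of a
   nonnegative function is a supremum over simple functions below it. *)
Lemma le_integral_nonneg d (T : measurableType d) (nu : {measure set T -> \bar R})
    (D : set T) (f g : T -> \bar R) :
  (forall x, D x -> (0 <= f x)%E) -> (forall x, D x -> (f x <= g x)%E) ->
  (\int[nu]_(x in D) f x <= \int[nu]_(x in D) g x)%E.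
Proof.
move=> f0 fg; have g0 x : D x -> (0 <= g x)%E.
  by move=> Dx; exact: le_trans (f0 _ Dx) (fg _ Dx).
rewrite !ge0_integralE //; apply: ge_ereal_sup => _ [h /= hf <-].
apply: le_ereal_sup_tmp; exists (sintegral nu h) => //; exists h => // x.
apply: le_trans (hf x) _; rewrite /patch; case: ifPn => // /set_mem.
exact: fg.
Qed.

Lemma is_derive_continuous (f : R -> R) (x df : R) : is_derive x 1 f df ->
  {for x, continuous f}.
Proof.
by move=> [h _]; apply/differentiable_continuous/derivable1_diffP.
Qed.

Lemma is_derive_powR_comp (g : R -> R) (x dg a : R) :
  is_derive x 1 g dg -> 0 < g x ->
  is_derive x 1 (fun t => g t `^ a) (a * g x `^ (a - 1) * dg).
Proof.
by move=> h g0; exact: (is_derive1_comp (is_derive1_powR a g0) h).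
Qed.

Lemma powRD_gt0 (x a b : R) : 0 < x -> x `^ (a + b) = x `^ a * x `^ b.
Proof. by move=> x0; rewrite powRD // (gt_eqF x0) implybT. Qed.

Lemma is_derive_affine (a b x : R) : is_derive x 1 (fun t => b + a * t) a.
Proof.
have h1 : is_derive x 1 (cst b) (0 : R) := is_derive_cst _ _ _.
have h2 : is_derive x 1 (a *: (id : R -> R)) (a *: 1) :=
  is_deriveZ _ (is_derive_id _ _).
by apply: (is_derive_eq (is_deriveD h1 h2)); rewrite add0r [_ *: _]mulr1.
Qed.

Lemma continuous_FTC2_le (f F : R -> R) (a b c : R) : a < b ->
  (forall x, a <= x <= b -> {for x, continuous f}) ->
  (forall x : R, a <= x <= b -> is_derive x 1 F (f x)) ->
  (forall x, a <= x <= b -> `|F x| <= c) ->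
  (\int[mu]_(x in `[a, b]) (f x)%:E <= (2 * c)%:E)%E.
Proof.
move=> ab cf dF bF; rewrite (continuous_FTC2 (F := F)) //.
- rewrite -EFinB lee_fin.
  have := bF a; have := bF b; rewrite !lexx ltW //= => /(_ isT) hb /(_ isT) ha.
  by move: hb ha; rewrite !ler_norml; lra.
- apply: continuous_in_subspaceT => x; rewrite inE /= in_itv /=; exact: cf.
- have cF x : a <= x <= b -> {for x, continuous F}.
    by move=> /dF; exact: is_derive_continuous.
  split.
  + move=> x; rewrite in_itv /= => /andP[ax xb].
    by have [] := dF x; rewrite ?(ltW ax) ?(ltW xb).
  + by apply/cvg_at_right_filter/cF; rewrite lexx ltW.
  + by apply/cvg_at_left_filter/cF; rewrite lexx ltW.
- move=> x; rewrite in_itv /= => /andP[ax xb].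
  have h : a <= x <= b by rewrite (ltW ax) (ltW xb).
  by rewrite derive1E; have [_ ->] := dF x h.
Qed.

Lemma cvg_integral_exhaustion (D : set R) (a b : nat -> R) (f : R -> R) :
  D = \bigcup_n `[a n, b n]%classic ->
  (forall n, a n.+1 <= a n) -> (forall n, b n <= b n.+1) ->
  (forall x, D x -> 0 <= f x) -> (forall x, D x -> {for x, continuous f}) ->
  (\int[mu]_(x in `[a n, b n]) (f x)%:E @[n --> \oo] --> \int[mu]_(x in D) (f x)%:E)%E.
Proof.
move=> eD ha hb f0 cf; have inD n x : a n <= x <= b n -> D x.
  by move=> h; rewrite eD; exists n.
rewrite [in X in _ --> X]eD; apply: ge0_nondecreasing_set_cvg_integral.
- apply/nondecreasing_seqP => n; rewrite subsetEset => x /=.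
  rewrite !in_itv /= => /andP[h1 h2].
  by rewrite (le_trans _ h1) ?(le_trans h2).
- by move=> n; exact: measurable_itv.
- move=> n; apply/measurable_EFinP.
  apply: subspace_continuous_measurable_fun; first exact: measurable_itv.
  apply: continuous_in_subspaceT => x; rewrite inE /= in_itv /= => h.
  by apply: cf; exact: inD h.
- move=> n x; rewrite /= in_itv /= => h; rewrite lee_fin.
  by apply: f0; exact: inD h.
Qed.

(** On each compact piece the integral is a difference of two values of [F], which accounts for the
    factor 2; a bounded primitive then suffices, without limits at the ends. *)
Lemma integral_exhaustion_le (D : set R) (a b : nat -> R) (f F : R -> R) (c : R) :
  D = \bigcup_n `[a n, b n]%classic -> (forall n, a n < b n) ->
  (forall n, a n.+1 <= a n) -> (forall n, b n <= b n.+1) ->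
  (forall x, D x -> 0 <= f x) -> (forall x, D x -> {for x, continuous f}) ->
  (forall x : R, D x -> is_derive x 1 F (f x)) -> (forall x, D x -> `|F x| <= c) ->
  (\int[mu]_(x in D) (f x)%:E <= (2 * c)%:E)%E.
Proof.
move=> eD ab ha hb f0 cf dF bF.
have inD n x : a n <= x <= b n -> D x by move=> h; rewrite eD; exists n.
apply: cvge_to_le (cvg_integral_exhaustion eD ha hb f0 cf) _; apply: nearW => n.
apply: (continuous_FTC2_le (F := F)) => // x /inD; [exact: cf|exact: dF|exact: bF].
Qed.

Lemma setT_bigcup_itv :
  [set: R] = \bigcup_n `[- (n.+1%:R : R), n.+1%:R]%classic.
Proof.
apply/seteqP; split=> // x _; exists (Num.trunc `|x|) => //=.
rewrite in_itv /= -ler_norml.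
exact/ltW/truncnS_gt.
Qed.

(** Starting at 2 keeps the inverse strictly below the number, so that each interval has distinct
    ends. *)
Lemma itv0y_bigcup_itv :
  `]0, +oo[%classic = \bigcup_n `[(n.+2%:R : R)^-1, n.+2%:R]%classic.
Proof.
apply/seteqP; split=> x /=; rewrite in_itv /= ?andbT; last first.
  move=> [n _ /=]; rewrite in_itv /= => /andP[h _].
  by apply: lt_le_trans h; rewrite invr_gt0 ltr0n.
move=> x0; exists (maxn (Num.trunc x) (Num.trunc x^-1)) => //=.
rewrite in_itv /=.
have h y : 0 < y -> y < (Num.trunc y).+1%:R :> R.
  by move=> _; exact: truncnS_gt.
apply/andP; split; last first.
  apply: ltW (lt_le_trans (h _ x0) _); rewrite ler_nat.
  by rewrite ltnS leqW // leq_maxl.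
rewrite -[leRHS]invrK lef_pV2 ?posrE ?ltr0n ?invr_gt0 //.
apply: ltW (lt_le_trans (h x^-1 _) _); rewrite ?invr_gt0 // ler_nat.
by rewrite ltnS leqW // leq_maxr.
Qed.

Lemma integralT_le (f F : R -> R) (c : R) :
  (forall x, 0 <= f x) -> continuous f ->
  (forall x : R, is_derive x 1 F (f x)) -> (forall x, `|F x| <= c) ->
  (\int[mu]_x (f x)%:E <= (2 * c)%:E)%E.
Proof.
move=> f0 cf dF bF.
apply: (integral_exhaustion_le setT_bigcup_itv (F := F)) => //.
- by move=> n; rewrite (lt_trans (y := 0)) // ?oppr_lt0 ltr0n.
- by move=> n; rewrite lerN2 ler_nat.
- by move=> n; rewrite ler_nat.
- by move=> x _; exact: cf.
Qed.

Lemma integral0y_le (f F : R -> R) (c : R) :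
  (forall x, 0 < x -> 0 <= f x) -> (forall x, 0 < x -> {for x, continuous f}) ->
  (forall x : R, 0 < x -> is_derive x 1 F (f x)) ->
  (forall x, 0 < x -> `|F x| <= c) ->
  (\int[mu]_(x in `]0%R, +oo[) (f x)%:E <= (2 * c)%:E)%E.
Proof.
move=> f0 cf dF bF.
have i0 x : `]0, +oo[%classic x -> 0 < x :> R by rewrite /= in_itv /= andbT.
apply: (integral_exhaustion_le itv0y_bigcup_itv (F := F)).
- move=> n; rewrite (lt_le_trans (y := 1)) ?invf_lt1 ?ltr1n ?ltr0n ?ler1n //.
- by move=> n; rewrite lef_pV2 ?posrE ?ltr0n // ler_nat.
- by move=> n; rewrite ler_nat.
- by move=> x /i0; exact: f0.
- by move=> x /i0; exact: cf.
- by move=> x /i0; exact: dF.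
- by move=> x /i0; exact: bF.
Qed.

Lemma gauss_integral1 (c k a : R) : 0 < k -> 0 <= c ->
  (\int[mu]_(b in [set: R]) (c * expR (- (k * (b - a) ^+ 2)))%:E
   = (c * Num.sqrt (pi / k))%:E)%E.
Proof.
(* The standard deviation for which the normal density has exponent [- k (b - a)^2]. *)
move=> k0 c0; pose s : R := Num.sqrt (2 * k)^-1.
have k2 : 0 < (2 * k)^-1 by rewrite invr_gt0 mulr_gt0.
have s0 : s != 0 by rewrite gt_eqF // sqrtr_gt0.
have ss : s ^+ 2 = (2 * k)^-1 by rewrite sqr_sqrtr // ltW.
have pk : normal_peak s = (Num.sqrt (pi / k))^-1.
  rewrite /normal_peak; congr (Num.sqrt _)^-1.
  by rewrite ss -mulr_natr; field; rewrite gt_eqF.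
have q0 : Num.sqrt (pi / k) != 0 :> R.
  by rewrite gt_eqF // sqrtr_gt0 divr_gt0 // pi_gt0.
transitivity (\int[mu]_(b in [set: R])
    ((c * Num.sqrt (pi / k))%:E * (normal_pdf a s b)%:E))%E.
  apply: eq_integral => b _; rewrite -EFinM; congr EFin.
  rewrite normal_pdfE // pk -!mulrA; congr (c * _); rewrite mulVKf // /normal_fun.
  congr expR.
  by rewrite ss -mulr_natr; field; rewrite gt_eqF.
rewrite integralZl // ?integral_normal_pdf ?mule1 //.
exact: integrable_normal_pdf.
Qed.

End integral_estimates.

(** * Integrating out the regression coefficients and the variance *)

Section integrated_likelihood_bound.
Context {R : realType}.
Let mu := @lebesgue_measure R.

(** Completing the square moves the centre of the inner Gaussian with the outermost variable but
    does not alter its determinant. The inner integral is thus a constant times a one-dimensional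
    Gaussian whose precision is [tau] times the Schur complement. *)
Lemma integral_cV_gauss p (B : 'M[R]_p) (a : 'cV[R]_p) (c tau : R) :
  posdef B -> 0 <= c -> 0 < tau ->
  integral_cV (fun v => (c * expR (- (tau * qform B (v - a))))%:E) =
  (c * (Num.sqrt (pi / tau)) ^+ p / Num.sqrt (\det B))%:E.
Proof.
elim: p B a c => [|p IH] B a c pB c0 tau0 /=.
  rewrite det_mx00 sqrtr1 divr1 expr0 mulr1 /qform.
  by rewrite (flatmx0 B) mulmx0 mul0mx mxE mulr0 oppr0 expR0 mulr1.
have [b11 [b [D [eB pD s0 _]]]] := @posdef_block _ p B pB.
set s := _ 0 0 in s0.
have sD : D^T = D by case: pD.
have uD := posdef_unit pD.
pose a0 : R := (usubmx (a : 'cV_(1 + p))) 0 0.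
pose a' : 'cV[R]_p := dsubmx (a : 'cV_(1 + p)).
have ea : a = col_mx (a0%:M : 'cV_1) a' :> 'cV_(1 + p).
  by rewrite /a0 -scalar_mx11 vsubmxK.
transitivity (\int[mu]_(x in [set: R])
   ((c * (Num.sqrt (pi / tau)) ^+ p / Num.sqrt (\det D))
     * expR (- ((tau * s) * (x - a0) ^+ 2)))%:E)%E.
  apply: eq_integral => x _.
  transitivity (integral_cV (fun v : 'cV[R]_p =>
     (c * expR (- (tau * s * (x - a0) ^+ 2))
      * expR (- (tau * qform D (v - (a' - invmx D *m b *m (x - a0)%:M)))))%:E)).
    congr integral_cV; apply: funext => v; congr EFin.
    rewrite -mulrA -expRD; congr (c * expR _).
    rewrite -opprD -mulrA -mulrDr; congr (- (tau * _)).
    have -> : col_mx x%:M v - a = col_mx (x - a0)%:M (v - a') :> 'cV_(1 + p).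
      have e : (col_mx x%:M v : 'cV_(1 + p)) - col_mx a0%:M a'
        = col_mx (x - a0)%:M (v - a').
        by rewrite opp_col_mx add_col_mx -raddfB.
      by rewrite ea; exact: e.
    rewrite eB block_qform // mxE eqxx mulr1n mulrC; congr (_ + qform _ _).
    by rewrite opprB addrA addrAC.
  rewrite IH ?mulr_ge0 ?expR_ge0 //; congr EFin.
  ring.
rewrite gauss_integral1 ?mulr_gt0 //; last first.
  by rewrite divr_ge0 ?sqrtr_ge0 // mulr_ge0 ?exprn_ge0 ?sqrtr_ge0.
congr EFin; rewrite eB det_block_sym // -/s.
have d0 := posdef_det_gt0 pD.
have -> : pi / (tau * s) = (pi / tau) * s^-1 by field; rewrite !gt_eqF.
have q0 : 0 <= pi / tau :> R by rewrite divr_ge0 ?pi_ge0 ?(ltW tau0).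
rewrite (sqrtrM (\det D) (ltW s0)) (sqrtrM s^-1 q0) (sqrtrV (ltW s0)) exprSr.
by field; rewrite !gt_eqF ?sqrtr_gt0.
Qed.

Section gaussian_algebra.
Variables (n p m : nat).
Hypothesis npm : n = (p + m)%N.
Variables (H : 'M[R]_(n, p)) (W : 'M[R]_(n, m)) (Sig : 'M[R]_n).
Hypotheses (hH : \rank H = p) (hW : W^T *m W = 1%:M) (hHW : H^T *m W = 0).
Hypothesis pS : posdef Sig.

Let B := H^T *m invmx Sig *m H.
Let SW := W^T *m Sig *m W.

Lemma full_rank_inj (v : 'cV[R]_p) : H *m v = 0 -> v = 0.
Proof.
move=> Hv; have fH : row_free H^T by rewrite /row_free mxrank_tr hH.
apply: trmx_inj; apply: (row_free_inj fH).
by rewrite -trmx_mul Hv !trmx0 mul0mx.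
Qed.

Lemma orthonormal_inj (v : 'cV[R]_m) : W *m v = 0 -> v = 0.
Proof. by move=> Wv; rewrite -[v]mul1mx -hW -mulmxA Wv mulmx0. Qed.

Lemma posdef_gram : posdef (H^T *m H).
Proof.
rewrite -[H^T]mulmx1; apply: posdef_congr; first exact: posdef1.
exact: full_rank_inj.
Qed.

Lemma posdef_precision : posdef B.
Proof. by apply: posdef_congr; [exact: posdef_inv|exact: full_rank_inj]. Qed.

Lemma posdef_proj : posdef SW.
Proof. by apply: posdef_congr => //; exact: orthonormal_inj. Qed.

Let hWH : W^T *m H = 0.
Proof. by apply: trmx_inj; rewrite trmx_mul trmxK hHW trmx0. Qed.

(** With [X = [H | W]] and [Y = [Sig^-1 H | W]], the products [X^T Y], [X^T X] and [Y^T Sig Y] are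
    block triangular; comparing their determinants eliminates those of [X] and [Y]. *)
Lemma det_precision_proj : \det B * \det Sig = \det (H^T *m H) * \det SW.
Proof.
have pB := posdef_precision; have pSW := posdef_proj; have pG := posdef_gram.
have uS := posdef_unit pS.
have [sS _] := pS.
(* Everything typed by [n] is generalised so that [n] can become [p + m], which makes [row_mx]
   square. *)
move: H W Sig (hH) hW hHW hWH pS @B @SW pB pSW pG uS sS.
rewrite npm => H' W' Sig' hH' hW' hHW' hWH' pS' B' SW' pB pSW pG uS sS.
pose X := row_mx H' W'; pose Y := row_mx (invmx Sig' *m H') W'.
have XY : \det (X^T *m Y) = \det B'.
  rewrite /X /Y tr_row_mx mul_col_row !mulmxA hHW' hW' det_lblock det1 mulr1.
  by [].
have XX : \det (X^T *m X) = \det (H'^T *m H').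
  by rewrite /X tr_row_mx mul_col_row hHW' hW' det_lblock det1 mulr1.
have YSY : \det (Y^T *m Sig' *m Y) = \det B' * \det SW'.
  rewrite /Y tr_row_mx mul_col_mx mul_col_row trmx_mul trmx_inv sS.
  rewrite mulmxKV // hHW' -/SW' mulmxA det_lblock.
  by [].
have B0 := posdef_det_gt0 pB; have G0 := posdef_det_gt0 pG.
move: XY XX YSY; rewrite !det_mulmx !det_tr => XY XX YSY.
have X0 : \det X != 0.
  by apply: contraTneq G0 => X0; rewrite -XX X0 mulr0 ltxx.
have B0' : \det B' != 0 by rewrite gt_eqF.
apply: (mulfI B0'); rewrite [RHS]mulrCA -YSY -XX -XY; ring.
Qed.

(** Generalised least squares: [bhat] is the best fit and [Sig W SW^-1 W^T y] its residual. The
    cross terms vanish because [H^T W = 0]. *)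
Lemma qform_residual (y : 'cV[R]_n) : exists bhat : 'cV[R]_p,
  forall b : 'cV[R]_p, qform (invmx Sig) (y - H *m b) =
    qform B (b - bhat) + qform (invmx SW) (W^T *m y).
Proof.
have pG := posdef_gram; have pSW := posdef_proj.
have uS := posdef_unit pS; have uSW := posdef_unit pSW; have uG := posdef_unit pG.
have [sS _] := pS; have [sSW _] := pSW.
pose del := invmx SW *m (W^T *m y).
pose v := y - Sig *m W *m del.
have Wv : W^T *m v = 0.
  by rewrite mulmxBr !mulmxA -/SW mulmxV // mul1mx subrr.
(* Since [[H | W]] is invertible, [v] is a sum of a vector in the range of [H] and one in the range
   of [W]; [W^T v = 0] kills the second. *)
have [a va] : exists a, v = H *m a.
  have [X' XX'] : exists X', row_mx H W *m X' = v.
    have eX : (row_mx H W)^T *m row_mx H W = block_mx (H^T *m H) 0 0 1%:M.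
      by rewrite tr_row_mx mul_col_row hHW hWH hW.
    have uX : (row_mx H W)^T *m row_mx H W \in unitmx.
      by rewrite eX unitmxE det_lblock det1 mulr1 -unitmxE.
    clear - npm uX.
    move: H W v uX; rewrite npm => H' W' v uX.
    move: uX; rewrite unitmx_mul => /andP[_ uX].
    by exists (invmx (row_mx H' W') *m v); rewrite mulKVmx.
  exists (usubmx X'); rewrite -XX' -{1}[X']vsubmxK mul_row_col.
  have -> : dsubmx X' = 0; last by rewrite mulmx0 addr0.
  rewrite -[LHS]mul1mx -hW -mulmxA.
  have : W^T *m (row_mx H W *m X') = 0 by rewrite XX'.
  by rewrite -{1}[X']vsubmxK mul_row_col mulmxDr mulmxA hWH mul0mx add0r.
exists a => b.
have -> : y - H *m b = H *m (a - b) + Sig *m W *m del.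
  by rewrite mulmxBr -va /v [RHS]addrAC subrK.
have -> : qform (invmx SW) (W^T *m y) = qform SW del.
  by rewrite qform_invmx.
have -> : qform B (b - a) = qform B (a - b).
  by rewrite -opprB -scaleN1r qformZ sqrrN expr1n mul1r.
move: (a - b) del @v Wv va => g del _ _ _; rewrite /qform.
have -> : (H *m g + Sig *m W *m del)^T = g^T *m H^T + del^T *m W^T *m Sig.
  by rewrite raddfD /= !trmx_mul sS !mulmxA.
have e1 : (g^T *m H^T + del^T *m W^T *m Sig) *m invmx Sig =
    g^T *m H^T *m invmx Sig + del^T *m W^T.
  by rewrite mulmxDl mulmxK.
rewrite e1 mulmxDl !mulmxDr.
have -> : g^T *m H^T *m invmx Sig *m (H *m g) = g^T *m B *m g.
  by rewrite /B !mulmxA.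
have -> : g^T *m H^T *m invmx Sig *m (Sig *m W *m del) = 0.
  have e0 : g^T *m H^T *m W = 0 by rewrite -mulmxA hHW mulmx0.
  by rewrite !mulmxA mulmxKV // e0 mul0mx.
have -> : del^T *m W^T *m (H *m g) = 0.
  have e0 : del^T *m W^T *m H = 0 by rewrite -mulmxA hWH mulmx0.
  by rewrite mulmxA e0 mul0mx.
have -> : del^T *m W^T *m (Sig *m W *m del) = del^T *m SW *m del.
  by rewrite /SW !mulmxA.
by rewrite add0r addr0 mxE.
Qed.

End gaussian_algebra.

(** With [w = Q / s] this dominates the inverse Gamma integrand by a multiple of [(1 + s / Q)] to
    the power -3/2, a function with an elementary bounded primitive. *)
Lemma inv_powR_expR_bound (m : nat) : (0 < m)%N -> exists2 C : R, 0 < C &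
  forall w : R, 0 < w ->
    w `^ (m%:R / 2 + 1) * expR (- (w / 2)) <= C * (1 + w^-1) `^ (- (3 / 2)).
Proof.
(* The constant comes from the term of degree [m.+2] in the series of [expR ((1 + w) / 2)]; the
   exponent [m / 2 + 1] is at most [m.+2]. *)
move=> m0; exists ((m.+2)`!%:R * 2 ^+ m.+2 * expR 2^-1).
  by rewrite mulr_gt0 ?expR_gt0 // mulr_gt0 ?exprn_gt0 // ltr0n fact_gt0.
move=> w w0; have w1 : 0 < 1 + w by rewrite addr_gt0.
have -> : 1 + w^-1 = (1 + w) / w by field; rewrite gt_eqF.
have n32 : (1 + w) `^ (3 / 2) != 0 by rewrite gt_eqF // powR_gt0.
have e1 : ((1 + w) / w) `^ (- (3 / 2)) = w `^ (3 / 2) / (1 + w) `^ (3 / 2).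
  rewrite powRM ?invr_ge0 ?(ltW w0) ?(ltW w1) // -(powR_inv1 (ltW w0)).
  by rewrite -powRrM mulN1r opprK powRN mulrC.
have e2 : w `^ (m%:R / 2 + 1) = w `^ (3 / 2) * w `^ ((m%:R - 1) / 2).
  by rewrite -powRD; [congr powR; field|rewrite (gt_eqF w0) implybT].
rewrite e1 e2 -mulrA [leRHS]mulrCA ler_pM2l ?powR_gt0 // ler_pdivlMr ?powR_gt0 //.
apply: le_trans (_ : (1 + w) ^+ m.+2 * expR (- (w / 2)) <= _).
  rewrite mulrAC ler_pM2r ?expR_gt0 // -powR_mulrn ?(ltW w1) //.
  apply: le_trans (_ : (1 + w) `^ ((m%:R - 1) / 2) * (1 + w) `^ (3 / 2) <= _).
    rewrite ler_pM2r ?powR_gt0 //; apply: ge0_ler_powR.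
    + by rewrite divr_ge0 // subr_ge0 ler1n.
    + by rewrite nnegrE ltW.
    + by rewrite nnegrE ltW.
    + by rewrite lerDr.
  rewrite -powRD; last by rewrite (gt_eqF w1) implybT.
  apply: ler_powR; first by rewrite lerDl ltW.
  by rewrite -(natr1 m.+1) -(natr1 m); have := ler0n R m; lra.
have h := expR_ge1Dxn m.+1 (ltW (divr_gt0 w1 (ltr0Sn R 1))).
have f0 : 0 < (m.+2)`!%:R :> R by rewrite ltr0n fact_gt0.
have {}h : ((1 + w) / 2) ^+ m.+2 / (m.+2)`!%:R <= expR ((1 + w) / 2).
  by apply: le_trans h; rewrite lerDr.
move: h; rewrite ler_pdivrMr // expr_div_n ler_pdivrMr ?exprn_gt0 //.
rewrite mulrDl expRD div1r => h.
rewrite expRN ler_pdivrMr ?expR_gt0 //; apply: le_trans h _.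
by apply: eqW; ring.
Qed.

(** An upper bound with a constant free of [c] and [Q] is enough, so the inverse Gamma integral is
    dominated instead of being evaluated. *)
Lemma inverse_gamma_integral_le (m : nat) : (0 < m)%N ->
  exists2 C : R, 0 < C & forall (c Q : R), 0 <= c -> 0 < Q ->
  (\int[mu]_(s in `]0%R, +oo[)
     (c * (2 * pi * s) `^ (- (m%:R / 2)) * expR (- ((2 * s)^-1 * Q)) * s^-1)%:E
   <= (C * c * Q `^ (- (m%:R / 2)))%:E)%E.
Proof.
move=> m0; have [C C0 hC] := inv_powR_expR_bound m0.
exists (4 * C * (2 * pi) `^ (- (m%:R / 2))).
  by rewrite mulr_gt0 ?powR_gt0 ?mulr_gt0 ?pi_gt0.
move=> c Q c0 Q0.
pose A := c * (2 * pi) `^ (- (m%:R / 2)) * Q `^ (- (m%:R / 2) - 1) * C.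
have A0 : 0 <= A by rewrite !mulr_ge0 ?powR_ge0 ?(ltW C0).
pose f s := A * (1 + Q^-1 * s) `^ (- (3 / 2)).
pose F s := (- (2 * Q * A)) * (1 + Q^-1 * s) `^ (- (1 / 2)).
have u0 s : 0 < s -> 0 < 1 + Q^-1 * s.
  by move=> s0; rewrite addr_gt0 // mulr_gt0 ?invr_gt0.
have dpow (a s : R) : 0 < s -> is_derive s 1 (fun t => (1 + Q^-1 * t) `^ a)
    (a * (1 + Q^-1 * s) `^ (a - 1) * Q^-1).
  move=> s0.
  exact: (is_derive_powR_comp a (is_derive_affine Q^-1 1 s) (u0 _ s0)).
apply: le_trans (_ : (2 * (2 * Q * A))%:E <= _)%E; last first.
  rewrite lee_fin /A; apply: eqW.
  by rewrite powRD_gt0 // (powR_inv1 (ltW Q0)); field; rewrite gt_eqF.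
apply: le_trans (integral0y_le (f := f) (F := F) _ _ _ _).
- apply: le_integral_nonneg => s; rewrite /= in_itv /= andbT => s0.
    by rewrite lee_fin !mulr_ge0 ?powR_ge0 ?expR_ge0 ?invr_ge0 ?(ltW s0).
  rewrite lee_fin /f.
  have q0 : 0 < Q / s by rewrite divr_gt0.
  have := hC _ q0; rewrite invf_div => h.
  have e1 : (2 * pi * s) `^ (- (m%:R / 2)) * s^-1 =
      (2 * pi) `^ (- (m%:R / 2)) * (Q `^ (- (m%:R / 2) - 1) * (Q / s) `^ (m%:R / 2 + 1)).
    rewrite powRM ?mulr_ge0 ?pi_ge0 ?(ltW s0) // -mulrA; congr (_ * _).
    rewrite powRM ?invr_ge0 ?(ltW Q0) ?(ltW s0) // mulrA -powRD; last first.
      by rewrite (gt_eqF Q0) implybT.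
    rewrite (_ : - _ - 1 + _ = 0); last by ring.
    rewrite powRr0 mul1r -(powR_inv1 (ltW s0)) -powRrM -powRD_gt0 //.
    by congr powR; ring.
  have -> : expR (- ((2 * s)^-1 * Q)) = expR (- (Q / s / 2)).
    by congr expR; field; rewrite gt_eqF.
  rewrite mulrAC -(mulrA c) e1 /A -!mulrA.
  do 3! (apply: ler_wpM2l; rewrite ?powR_ge0 //).
  by move: h; rewrite (mulrC s) -mulrA.
- by move=> s s0; rewrite mulr_ge0 ?powR_ge0.
- move=> s s0; apply: (is_derive_continuous (df := A * (- (3 / 2) *
    (1 + Q^-1 * s) `^ (- (3 / 2) - 1) * Q^-1))).
  have -> : f = A *: (fun t => (1 + Q^-1 * t) `^ (- (3 / 2))) by [].
  by have h := dpow (- (3 / 2)) s s0; apply: is_derive_eq.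
- move=> s s0.
  have -> : F = (- (2 * Q * A)) *: (fun t => (1 + Q^-1 * t) `^ (- (1 / 2))) by [].
  have h := dpow (- (1 / 2)) s s0; apply: is_derive_eq.
  rewrite /GRing.scale /= /f (_ : - (1 / 2) - 1 = - (3 / 2)); last by field.
  by field; rewrite gt_eqF.
- move=> s s0; rewrite normrM normrN (ger0_norm (powR_ge0 _ _)).
  have qa : 0 <= 2 * Q * A by rewrite mulr_ge0 // mulr_ge0 // ltW.
  rewrite (ger0_norm qa) ler_piMr //.
  rewrite powRN invf_le1 ?powR_gt0 ?u0 //.
  rewrite -[leLHS](powRr0 (1 + Q^-1 * s)); apply: ler_powR => //.
  by rewrite lerDl mulr_ge0 ?invr_ge0 ?ltW.
Qed.

(** The Gaussian integral over the coefficients contributes [2 * pi * s] to the power [p / 2],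
    turning the exponent [- n / 2] into [- m / 2]. It also contributes the determinant of the
    precision matrix, which [det_precision_proj] trades together with that of [Sig] for that of
    [W^T Sig W]. *)
Lemma integrated_likelihood_le (n p m : nat) (H : 'M[R]_(n, p)) (W : 'M[R]_(n, m)) :
  n = (p + m)%N -> (0 < m)%N -> \rank H = p -> W^T *m W = 1%:M ->
  H^T *m W = 0 ->
  exists2 C : R, 0 < C & forall (S : R -> 'M[R]_n) (theta : R) (y : 'cV[R]_n),
    posdef (S theta) -> W^T *m y != 0 ->
    (integrated_likelihood H S y theta <=
     (C * (\det (W^T *m S theta *m W)) `^ (- (1 / 2))
        * (qform (invmx (W^T *m S theta *m W)) (W^T *m y)) `^ (- (m%:R / 2)))%:E)%E.
Proof.
move=> npm m0 hH hW hHW; have [C C0 hC] := inverse_gamma_integral_le m0.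
have G0 : 0 < \det (H^T *m H) by exact/posdef_det_gt0/posdef_gram.
exists (C * (\det (H^T *m H)) `^ (- (1 / 2))).
  by rewrite mulr_gt0 ?powR_gt0.
move=> S theta y pS z0.
set Sig := S theta in pS *; set SW := W^T *m Sig *m W.
set Q := qform _ _.
have pSW : posdef SW by apply: posdef_proj pS.
have Q0 : 0 < Q by have [_] := posdef_inv pSW; apply.
have pB : posdef (H^T *m invmx Sig *m H) by apply: posdef_precision pS.
set B := H^T *m _ *m H in pB.
have SW0 := posdef_det_gt0 pSW; have B0 := posdef_det_gt0 pB.
have S0 := posdef_det_gt0 pS.
have dBS := det_precision_proj npm hH hW hHW pS.
have [bh hb] := qform_residual npm hH hW hHW pS y.
pose c := (\det (H^T *m H)) `^ (- (1 / 2)) * (\det SW) `^ (- (1 / 2)).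
have c0 : 0 <= c by rewrite mulr_ge0 ?powR_ge0.
set X := (X in (_ <= X%:E)%E).
have -> : X = C * c * Q `^ (- (m%:R / 2)) by rewrite /X /c; ring.
apply: le_trans (hC c Q c0 Q0).
rewrite /integrated_likelihood; apply: eqW.
apply: eq_integral => s; rewrite inE /= in_itv /= andbT => s0.
rewrite EFinM; congr (_ * _)%E.
have t0 : 0 < (2 * s)^-1 by rewrite invr_gt0 mulr_gt0.
have ps0 : 0 < 2 * pi * s by rewrite mulr_gt0 // mulr_gt0 ?pi_gt0.
transitivity (integral_cV (fun b : 'cV[R]_p =>
   (((2 * pi * s) `^ (- (n%:R / 2)) * (\det Sig) `^ (- 2^-1)
     * expR (- ((2 * s)^-1 * Q)))
     * expR (- ((2 * s)^-1 * qform B (b - bh))))%:E)).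
  congr integral_cV; apply: funext => b; congr EFin.
  rewrite /likelihood -/(qform _ _) -/Sig hb -/B -/Q.
  by rewrite -[RHS]mulrA -expRD -opprD -mulrDr [Q + _]addrC.
rewrite integral_cV_gauss //; last first.
  by rewrite !mulr_ge0 ?powR_ge0 ?expR_ge0.
congr EFin; rewrite invrK (_ : pi * (2 * s) = 2 * pi * s); last by ring.
rewrite [LHS]mulrAC [RHS]mulrAC -[in RHS]mulrA [in RHS]mulrC.
rewrite -(powR12_sqrt (ltW ps0)) -(powR12_sqrt (ltW B0)).
rewrite -powR_mulrn ?powR_ge0 // -powRrM -powRN.
have -> : c = (\det Sig) `^ (- 2^-1) * (\det B) `^ (- 2^-1).
  by rewrite /c -!powRM ?ltW // -dBS mulrC !div1r.
have -> : - (m%:R / 2) = - (n%:R / 2) + 2^-1 * p%:R :> R.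
  by rewrite npm natrD; field.
rewrite powRD; last by rewrite (gt_eqF ps0) implybT.
ring.
Qed.

End integrated_likelihood_bound.

(** * Polynomial functions of bounded degree *)

Section polynomial_functions.
Context {R : realType} {P I : Type} (c : I -> P -> R).

Definition monom (s : seq I) (x : P) : R := \prod_(k <- s) c k x.

(** An inductive predicate on functions rather than formal polynomials: estimates proved on
    monomials then extend by induction through sums and multiples. *)
Inductive poly_le (d : nat) : (P -> R) -> Prop :=
| poly_le_mon s : (size s <= d)%N -> poly_le d (monom s)
| poly_le_add f g : poly_le d f -> poly_le d g -> poly_le d (fun x => f x + g x)
| poly_le_scale a f : poly_le d f -> poly_le d (fun x => a * f x).

Lemma poly_le_eq d f g : f =1 g -> poly_le d f -> poly_le d g.
Proof. by move=> /funext ->. Qed.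

Lemma poly_le_weak d e f : (d <= e)%N -> poly_le d f -> poly_le e f.
Proof.
move=> de; elim=> [s sd|{}f g _ hf _ hg|a {}f _ hf].
- by apply: poly_le_mon; exact: leq_trans de.
- exact: poly_le_add.
- exact: poly_le_scale.
Qed.

Lemma poly_le_cst d a : poly_le d (fun=> a).
Proof.
apply: (@poly_le_eq _ (fun x => a * monom [::] x)).
  by move=> x; rewrite /monom big_nil mulr1.
by apply: poly_le_scale; apply: poly_le_mon.
Qed.

Lemma poly_le_var k : poly_le 1 (c k).
Proof.
apply: (@poly_le_eq _ (monom [:: k])); first by move=> x; rewrite /monom big_seq1.
exact: poly_le_mon.
Qed.

Lemma poly_le_mul d e f g : poly_le d f -> poly_le e g ->
  poly_le (d + e) (fun x => f x * g x).
Proof.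
move=> hf hg; elim: hf => [s sd|f1 f2 _ h1 _ h2|a f1 _ h1].
- elim: hg => [t te|f1 f2 _ h1 _ h2|a f1 _ h1].
  + apply: (@poly_le_eq _ (monom (s ++ t))).
      by move=> x; rewrite /monom big_cat.
    by apply: poly_le_mon; rewrite size_cat leq_add.
  + by apply: poly_le_eq (poly_le_add h1 h2) => x; rewrite mulrDr.
  + by apply: poly_le_eq (poly_le_scale a h1) => x; rewrite mulrCA.
- by apply: poly_le_eq (poly_le_add h1 h2) => x; rewrite mulrDl.
- by apply: poly_le_eq (poly_le_scale a h1) => x; rewrite mulrA.
Qed.

Lemma poly_le_sum d (J : Type) (s : seq J) (Q : pred J) (F : J -> P -> R) :
  (forall j, Q j -> poly_le d (F j)) -> poly_le d (fun x => \sum_(j <- s | Q j) F j x).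
Proof.
move=> hF; elim: s => [|j s IH].
  by apply: poly_le_eq (poly_le_cst d 0) => x; rewrite big_nil.
have [Qj|/negbTE Qj] := boolP (Q j).
  by apply: poly_le_eq (poly_le_add (hF j Qj) IH) => x; rewrite big_cons Qj.
by apply: poly_le_eq IH => x; rewrite big_cons Qj.
Qed.

Lemma poly_le_prod (J : Type) (s : seq J) (Q : pred J) (F : J -> P -> R) :
  (forall j, Q j -> poly_le 1 (F j)) ->
  poly_le (size s) (fun x => \prod_(j <- s | Q j) F j x).
Proof.
move=> hF; elim: s => [|j s IH].
  by apply: poly_le_eq (poly_le_cst 0 1) => x; rewrite big_nil.
have [Qj|/negbTE Qj] := boolP (Q j).
  by apply: poly_le_eq (poly_le_mul (hF j Qj) IH) => x; rewrite big_cons Qj.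
by apply: poly_le_eq (poly_le_weak (leqnSn _) IH) => x; rewrite big_cons Qj.
Qed.

Lemma poly_le_exp d f n : poly_le d f -> poly_le (d * n) (fun x => f x ^+ n).
Proof.
move=> hf; elim: n => [|n IH].
  by rewrite muln0; exact: poly_le_cst.
by rewrite mulnS; apply: poly_le_eq (poly_le_mul hf IH) => x; rewrite exprS.
Qed.

End polynomial_functions.

(** * Polynomials on the design and the adapted basis *)

Section design.
Context {R : realType} (r n : nat) (x : 'I_n -> 'rV[R]_r).
Hypothesis hx : injective x.

Definition dot (u v : 'rV[R]_r) : R := \sum_k u 0 k * v 0 k.
Definition sqdist (u v : 'rV[R]_r) : R := \sum_k (u 0 k - v 0 k) ^+ 2.
Definition coor (k : 'I_r) (u : 'rV[R]_r) : R := u 0 k.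

Lemma sqdist_ge0 u v : 0 <= sqdist u v.
Proof. by apply: sumr_ge0 => k _; exact: sqr_ge0. Qed.

Lemma sqdist_eq0 u v : (sqdist u v == 0) = (u == v).
Proof.
apply/idP/eqP => [|->]; last by rewrite /sqdist big1 // => k _; rewrite subrr expr0n.
rewrite psumr_eq0; last by move=> k _; exact: sqr_ge0.
move=> /allP h; apply/matrixP => i k; rewrite ord1; apply/eqP.
by have := h k (mem_index_enum _); rewrite sqrf_eq0 subr_eq0.
Qed.

Lemma sqdist_gt0 i j : i != j -> 0 < sqdist (x i) (x j).
Proof.
by move=> ij; rewrite lt_def sqdist_ge0 sqdist_eq0 (inj_eq hx) ij.
Qed.

Lemma sqdistC u v : sqdist u v = sqdist v u.
Proof. by apply: eq_bigr => k _; rewrite -sqrrN opprB. Qed.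

Lemma sqdistE u v : sqdist u v = dot u u + dot v v - 2 * dot u v.
Proof.
rewrite /sqdist /dot mulr_sumr -big_split -sumrB /=.
by apply: eq_bigr => k _; ring.
Qed.

Lemma euclid_normE u v : euclid_norm (u - v) ^+ 2 = sqdist u v.
Proof.
rewrite sqr_sqrtr; last by apply: sumr_ge0 => k _; exact: sqr_ge0.
by apply: eq_bigr => k _; rewrite !mxE.
Qed.

(** Lagrange interpolation: the factor of index [j] is affine, equal to 1 at [x i] and to 0 at
    [x j]. *)
Lemma indicator_poly (i : 'I_n) : exists2 f,
  poly_le coor n f & forall j, f (x j) = (j == i)%:R.
Proof.
pose F (j : 'I_n) (u : 'rV[R]_r) := (sqdist (x i) (x j))^-1 * dot (u - x j) (x i - x j).
exists (fun u => \prod_(j <- index_enum 'I_n | j != i) F j u).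
  have en : n = size (index_enum 'I_n).
    by rewrite -sum1_size -[LHS]card_ord -sum1_card; apply: eq_bigl.
  apply: (@poly_le_weak _ _ _ _ (size (index_enum 'I_n))); first by rewrite -en.
  apply: poly_le_prod => j _; apply: poly_le_scale.
  apply: (@poly_le_eq _ _ _ _ _ (fun u =>
     \sum_k ((x i - x j) 0 k * coor k u + (- (x j 0 k * (x i - x j) 0 k))))).
    by move=> u; apply: eq_bigr => k _; rewrite !mxE /coor; ring.
  apply: poly_le_sum => k _; apply: poly_le_add; last exact: poly_le_cst.
  by apply: poly_le_scale; exact: poly_le_var.
move=> j; have [->|ji] := eqVneq j i.
  rewrite big1 // => l li; rewrite /F.
  have -> : dot (x i - x l) (x i - x l) = sqdist (x i) (x l).
    by apply: eq_bigr => k _; rewrite !mxE expr2.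
  by rewrite mulVf // gt_eqF // sqdist_gt0 // eq_sym.
rewrite (bigD1 j) //= /F subrr /dot big1 ?mulr0 ?mul0r //.
by move=> k _; rewrite mxE mul0r.
Qed.

(** The [q]-th power of the squared distance has degree [q.*2] in the pair of points, and each of
    its monomials splits as a product over the two points. Since [q.*2 < d + e], one of the two
    factors has a degree below its threshold. *)
Lemma sqdist_exp_bilinear (v w : 'I_n -> R) (d e q : nat) :
  (forall t, (size t < d)%N -> \sum_i v i * monom coor t (x i) = 0) ->
  (forall t, (size t < e)%N -> \sum_i w i * monom coor t (x i) = 0) ->
  (q.*2 < d + e)%N ->
  \sum_i \sum_j v i * w j * sqdist (x i) (x j) ^+ q = 0.
Proof.
move=> hv hw qde.
pose c2 (k : 'I_r + 'I_r) (p : 'rV[R]_r * 'rV[R]_r) : R :=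
  match k with inl k => coor k p.1 | inr k => coor k p.2 end.
have : poly_le c2 (2 * q) (fun p => sqdist p.1 p.2 ^+ q).
  apply: poly_le_exp; apply: poly_le_sum => k _.
  have h : poly_le c2 1 (fun p => c2 (inl k) p + (-1) * c2 (inr k) p).
    by apply: poly_le_add; [|apply: poly_le_scale]; exact: poly_le_var.
  apply: poly_le_eq (poly_le_mul h h) => p; rewrite /c2 /coor expr2; ring.
rewrite mul2n => hq.
suff key F : poly_le c2 q.*2 F ->
    \sum_i \sum_j v i * w j * F (x i, x j) = 0 by exact: key hq.
elim=> [s sq|f g _ hf _ hg|a f _ hf].
- have {}sq := leq_ltn_trans sq qde.
  pose s1 := pmap (fun k => if k is inl k then Some k else None) s.
  pose s2 := pmap (fun k => if k is inr k then Some k else None) s.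
  have mE p : monom c2 s p = monom coor s1 p.1 * monom coor s2 p.2.
    rewrite /monom /s1 /s2; elim: {sq s1 s2} s => [|[k|k] s IH] /=.
    + by rewrite !big_nil mulr1.
    + by rewrite !big_cons IH /= mulrA.
    + by rewrite !big_cons IH /= mulrCA.
  have sE : size s = (size s1 + size s2)%N.
    by rewrite /s1 /s2; elim: {sq s1 s2 mE} s => [|[k|k] s IH] //=;
      rewrite IH ?addnS.
  transitivity ((\sum_i v i * monom coor s1 (x i)) *
                (\sum_j w j * monom coor s2 (x j))).
    rewrite mulr_suml; apply: eq_bigr => i _; rewrite mulr_sumr.
    by apply: eq_bigr => j _; rewrite mE /=; ring.
  have [h|h] := ltnP (size s1) d; first by rewrite hv // mul0r.
  rewrite hw ?mulr0 // -(ltn_add2l (size s1)) -sE.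
  by apply: leq_trans sq _; rewrite leq_add2r.
- under eq_bigr => i _ do (under eq_bigr => j _ do rewrite mulrDr;
    rewrite big_split /=).
  by rewrite big_split /= hf hg addr0.
- under eq_bigr => i _ do (under eq_bigr => j _ do rewrite mulrCA;
    rewrite -mulr_sumr).
  by rewrite -mulr_sumr hf mulr0.
Qed.

Section adapted_basis.
Variables (m : nat) (W : 'M[R]_(n, m)).
Hypothesis hW : W^T *m W = 1%:M.

Let feature (f : 'rV[R]_r -> R) : 'rV[R]_m := (\row_i f (x i)) *m W.

Let featureE f (v : 'cV[R]_m) :
  (feature f *m v) 0 0 = \sum_i (W *m v) i 0 * f (x i).
Proof.
by rewrite /feature -mulmxA mxE; apply: eq_bigr => i _; rewrite mxE mulrC.
Qed.

(** Interpolation puts every row of [W] in the span of the features of monomials, and the rows of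
    [W] span everything because [W^T W = 1]. *)
Let feature_full (U : {vspace 'rV[R]_m}) :
  (forall s, feature (monom coor s) \in U) -> U = fullv.
Proof.
move=> hs; have hp f : poly_le coor n f -> feature f \in U.
  elim=> // [f1 f2 _ h1 _ h2|a f1 _ h1].
    rewrite (_ : feature _ = feature f1 + feature f2) ?memvD //.
    by rewrite /feature -mulmxDl; congr (_ *m _); apply/rowP => i; rewrite !mxE.
  rewrite (_ : feature _ = a *: feature f1) ?memvZ //.
  by rewrite /feature scalemxAl; congr (_ *m _); apply/rowP => i; rewrite !mxE.
apply/eqP; rewrite eqEsubv subvf /=; apply/subvP => v _.
rewrite -[v]mulmx1 -hW mulmxA.
have -> : v *m W^T *m W = \sum_i (v *m W^T) 0 i *: row i W.
  by rewrite [LHS]mulmx_sum_row.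
apply: memv_suml => i _; apply: memvZ.
have [f pf fi] := indicator_poly i.
have <- : feature f = row i W.
  rewrite rowE; congr (_ *m _); apply/rowP => j; rewrite !mxE fi eqxx.
  by rewrite andTb.
exact: hp.
Qed.

(* Monomials picked from the end of the list to its head, each of least degree
   among those not yet spanned on the range of [W]. *)
Fixpoint greedy (l : seq (seq 'I_r)) : Prop :=
  match l with
  | [::] => True
  | s :: l' => [/\ feature (monom coor s) \notin
       <<[seq feature (monom coor t) | t <- l']>>%VS,
     (forall t, (size t < size s)%N -> feature (monom coor t) \in
       <<[seq feature (monom coor t) | t <- l']>>%VS) & greedy l']
  end.

(** Fewer than [m] features cannot span the space, so some monomial lies outside their span, and one
    of least degree can be picked. *)
Let greedy_exists j : (j <= m)%N -> exists2 l, size l = j & greedy l.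
Proof.
elim: j => [|j IH] jm; first by exists [::].
have [l lj gl] := IH (ltnW jm).
set V := <<[seq feature (monom coor t) | t <- l]>>%VS.
have hex : exists d, `[< exists2 s, size s = d & feature (monom coor s) \notin V >].
  have [s sV] : exists s, feature (monom coor s) \notin V.
    apply: contrapT => /forallNP h.
    have /feature_full Vf : forall s, feature (monom coor s) \in V.
      by move=> s; apply: contrapT => /negP; exact: h.
    have := dim_span [seq feature (monom coor t) | t <- l].
    rewrite -/V Vf dimvf size_map lj /dim /= mul1n.
    by rewrite leqNgt jm.
  by exists (size s); apply/asboolP; exists s.
have [d /asboolP[s sd sV] dmin] := ex_minnP hex.
exists (s :: l); first by rewrite /= lj.
split=> // t; rewrite sd => td; apply: contrapT => /negP tV.
have : (d <= size t)%N by apply: dmin; apply/asboolP; exists t.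
by rewrite leqNgt td.
Qed.

Let greedy_free l : greedy l -> free [seq feature (monom coor t) | t <- l].
Proof.
elim: l => [|s l IH] /=; first by rewrite nil_free.
by move=> [h1 _ /IH h2]; rewrite free_cons h1.
Qed.

Let greedy_nth l i t : greedy l -> (i < size l)%N -> (size t < size (nth [::] l i))%N ->
  feature (monom coor t) \in
    <<[seq feature (monom coor t) | t <- drop i.+1 l]>>%VS.
Proof.
elim: l i => [|s l IH] [|i] //= [_ h gl]; first by rewrite drop0 => _; exact: h.
by rewrite ltnS; exact: IH.
Qed.

(** [U] is the inverse of the matrix of picked features, so its columns are dual to the picked
    monomials. A monomial of degree below that of [w i] lies in the span of those picked before
    [w i], which stand after it in the list, and column [i] annihilates all of them. *)
Lemma adapted_basis : exists (U : 'M[R]_m) (w : 'I_m -> seq 'I_r),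
  [/\ U \in unitmx,
      forall i (v : 'cV[R]_m),
        \sum_s (W *m U *m v) s 0 * monom coor (w i) (x s) = v i 0 &
      forall i t, (size t < size (w i))%N ->
        \sum_s (W *m U) s i * monom coor t (x s) = 0].
Proof.
have [l lm gl] := greedy_exists (leqnn m).
pose w (i : 'I_m) := nth [::] l i.
pose B : 'M[R]_m := \matrix_(i < m) feature (monom coor (w i)).
have fB := greedy_free gl.
have uB : B \in unitmx.
  rewrite -row_free_unit -kermx_eq0; apply/rowV0P => v /sub_kermxP vB.
  have sz : size [seq feature (monom coor t) | t <- l] == m by rewrite size_map lm.
  have /freeP := fB : free (Tuple sz).
  move=> /(_ (fun i => v 0 i)) h; apply/rowP => i; rewrite [RHS]mxE; apply: h.
  transitivity (v *m B); last exact: vB.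
  rewrite mulmx_sum_row; apply: eq_bigr => k _; congr (_ *: _).
  by rewrite rowK /= (nth_map [::]) ?lm.
have sumE f (v : 'cV[R]_m) :
  \sum_s (W *m v) s 0 * f (x s) = (feature f *m v) 0 0 by rewrite featureE.
exists (invmx B), w; split=> [|i v|i t ti]; first by rewrite unitmx_inv.
  rewrite -mulmxA sumE.
  have -> : feature (monom coor (w i)) = row i B by rewrite rowK.
  by rewrite mulmxA -row_mul mulmxV // -row_mul mul1mx mxE.
transitivity ((feature (monom coor t) *m col i (invmx B)) 0 0).
  rewrite -sumE; apply: eq_bigr => s _; congr (_ * _).
  by rewrite colE mulmxA -colE [RHS]mxE.
have il : (i < size l)%N by rewrite lm.
have := greedy_nth gl il ti; set X := [seq _ | _ <- _] => tX.
rewrite (coord_span (X := in_tuple X) tX) mulmx_suml summxE big1 // => j _.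
rewrite -scalemxAl mxE.
have sX : size X = size (drop i.+1 l) by rewrite size_map.
have jl : (j < size (drop i.+1 l))%N by apply: leq_trans (ltn_ord j) _; rewrite sX.
have jX : (i.+1 + j < m)%N by move: jl; rewrite size_drop lm ltn_subRL.
have -> : (in_tuple X)`_j = row (Ordinal jX) B.
  by rewrite rowK /= /X (nth_map [::]) ?nth_drop.
have -> : (row (Ordinal jX) B *m col i (invmx B)) 0 0 =
    (B *m invmx B) (Ordinal jX) i.
  by rewrite colE mulmxA -row_mul -colE 2!mxE.
rewrite mulmxV // mxE -val_eqE /= gtn_eqF ?mulr0 //.
by rewrite addSn ltnS leq_addr.
Qed.

End adapted_basis.
End design.

Arguments coor {R r} k u.

(** * Taylor remainder of the exponential *)

Section exponential_remainder.
Context {R : realType}.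

Lemma expR_remainder_le (N : nat) (y : R) :
  `|expR y - \sum_(q < N) y ^+ q / q`!%:R| <= `|y| ^+ N * expR `|y|.
Proof.
have cy := is_cvg_series_exp_coeff y.
have cy' := is_cvg_series_exp_coeff `|y|.
have sE z M : series (exp_coeff z) M = \sum_(q < M) z ^+ q / q`!%:R :> R.
  by rewrite /series /= big_mkord.
have key M : `|series (exp_coeff y) (N + M)%N - \sum_(q < N) y ^+ q / q`!%:R|
    <= `|y| ^+ N * series (exp_coeff `|y|) M.
  rewrite !sE big_split_ord /= addrAC subrr add0r mulr_sumr.
  apply: le_trans (ler_norm_sum _ _ _) _; apply: ler_sum => q _.
  rewrite normrM normfV normrX (ger0_norm (ler0n _ _)) exprD -mulrA.
  apply: ler_wpM2l; first exact: exprn_ge0.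
  apply: ler_wpM2l; first exact: exprn_ge0.
  by rewrite lef_pV2 ?posrE ?ltr0n ?fact_gt0 // ler_nat leq_fact // leq_addl.
have cL : (fun M => `|series (exp_coeff y) (N + M)%N -
    \sum_(q < N) y ^+ q / q`!%:R|) @ \oo -->
    `|expR y - \sum_(q < N) y ^+ q / q`!%:R|.
  apply: cvg_norm; apply: cvgB; last exact: cvg_cst.
  have c1 : (fun M => series (exp_coeff y) (M + N)%N) @ \oo --> expR y.
    by rewrite cvg_shiftn; exact: cy.
  by under eq_fun do rewrite addnC.
have cR : (fun M => `|y| ^+ N * series (exp_coeff `|y|) M) @ \oo -->
    `|y| ^+ N * expR `|y|.
  by apply: cvgM; [exact: cvg_cst|exact: cy'].
rewrite -(cvg_lim _ cL) // -(cvg_lim _ cR) //.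
apply: ler_lim; [exact: cvgP cL|exact: cvgP cR|].
by apply: nearW => M; exact: key.
Qed.

Lemma cvgn_sum (J : finType) (F : J -> nat -> R) (l : J -> R) :
  (forall j, F j @ \oo --> l j) ->
  (fun N => \sum_j F j N) @ \oo --> \sum_j l j.
Proof.
move=> h; elim: (index_enum J) => [|j s IH].
  by rewrite big_nil; under eq_fun do rewrite big_nil; exact: cvg_cst.
by rewrite big_cons; under eq_fun do rewrite big_cons; exact: cvgD.
Qed.

End exponential_remainder.

(** * Lower bounds on the Gaussian quadratic form *)

Section squared_exponential_form.
Context {R : realType} (r n : nat) (x : 'I_n -> 'rV[R]_r).
Hypothesis hx : injective x.

Definition se_form (a : R) (w : 'I_n -> R) : R :=
  \sum_i \sum_j w i * w j * expR (- (a * sqdist (x i) (x j))).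

(** The Gram form of the [q]-th tensor powers of the design points. Peeling off one scalar product
    at a time proves it non-negative without tensors, and keeping a single coordinate at each step
    bounds it below by a squared monomial moment. *)
Let gram q (c : 'I_n -> R) := \sum_i \sum_j c i * c j * dot (x i) (x j) ^+ q.

Let gramS q c : gram q.+1 c = \sum_k gram q (fun i => c i * x i 0 k).
Proof.
rewrite /gram [RHS]exchange_big /=; apply: eq_bigr => i _.
rewrite [RHS]exchange_big /=; apply: eq_bigr => j _.
rewrite exprS /dot mulrA mulr_sumr mulr_suml; apply: eq_bigr => k _; ring.
Qed.

Let gram0 c : gram 0 c = (\sum_i c i) ^+ 2.
Proof.
rewrite expr2 mulr_suml; apply: eq_bigr => i _.
by rewrite mulr_sumr; apply: eq_bigr => j _; rewrite expr0 mulr1.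
Qed.

Let gram_ge0 q c : 0 <= gram q c.
Proof.
elim: q c => [|q IH] c; first by rewrite gram0 sqr_ge0.
by rewrite gramS; apply: sumr_ge0.
Qed.

Let gram_ge_monom s c :
  (\sum_i c i * monom coor s (x i)) ^+ 2 <= gram (size s) c.
Proof.
elim: s c => [|k s IH] c /=.
  rewrite gram0; apply: eqW; congr (_ ^+ 2).
  by apply: eq_bigr => i _; rewrite /monom big_nil mulr1.
rewrite gramS (bigD1 k) //= -[X in X <= _]addr0; apply: lerD; last first.
  by apply: sumr_ge0 => l _; exact: gram_ge0.
apply: le_trans (IH _); apply: eqW.
congr (_ ^+ 2); apply: eq_bigr => i _.
by rewrite /monom big_cons mulrA.
Qed.

Let damped (a : R) (w : 'I_n -> R) i := w i * expR (- (a * dot (x i) (x i))).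

(** Expanding the squared distance factors the kernel as [exp(- a |u|^2) exp(- a |v|^2) exp(2 a (u .
    v))]. The first two factors are absorbed in [damped]; the series of the third is a sum of
    non-negative Gram forms, of which only the one of degree [size s] is kept. *)
Lemma se_form_ge_monom a w s : 0 <= a ->
  (2 * a) ^+ size s / (size s)`!%:R
    * (\sum_i damped a w i * monom coor s (x i)) ^+ 2 <= se_form a w.
Proof.
move=> a0; set c := damped a w; set l := size s.
pose P N := \sum_i \sum_j c i * c j * series (exp_coeff (2 * a * dot (x i) (x j))) N.
have PE N : P N = \sum_(q < N) (2 * a) ^+ q / q`!%:R * gram q c.
  rewrite /P /gram; under [RHS]eq_bigr => q _ do rewrite mulr_sumr.
  rewrite [RHS]exchange_big /=; apply: eq_bigr => i _.
  under [RHS]eq_bigr => q _ do rewrite mulr_sumr.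
  rewrite [RHS]exchange_big /=; apply: eq_bigr => j _.
  rewrite /series /= big_mkord mulr_sumr; apply: eq_bigr => q _.
  by rewrite /exp_coeff /= exprMn; ring.
have cP : P @ \oo --> se_form a w.
  have -> : se_form a w =
      \sum_i \sum_j c i * c j * expR (2 * a * dot (x i) (x j)).
    apply: eq_bigr => i _; apply: eq_bigr => j _.
    rewrite /c /damped mulrACA -!mulrA; congr (_ * (_ * _)).
    by rewrite -!expRD sqdistE; congr expR; ring.
  apply: cvgn_sum => i; apply: cvgn_sum => j.
  by apply: cvgM; [exact: cvg_cst|exact: is_cvg_series_exp_coeff].
rewrite -(cvg_lim _ cP) //; apply: limr_ge; first exact: cvgP cP.
near=> N; rewrite PE.
have lN : (l < N)%N by near: N; exact: nbhs_infty_gt.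
rewrite (bigD1 (Ordinal lN)) //= -[X in X <= _]addr0; apply: lerD.
  apply: ler_wpM2l; last exact: gram_ge_monom.
  by rewrite divr_ge0 ?exprn_ge0 ?mulr_ge0.
apply: sumr_ge0 => q _; apply: mulr_ge0; last exact: gram_ge0.
by rewrite divr_ge0 ?exprn_ge0 ?mulr_ge0.
Unshelve. all: end_near. Qed.

Lemma se_form_ge0 a w : 0 <= a -> 0 <= se_form a w.
Proof.
move=> a0; apply: le_trans (se_form_ge_monom w [::] a0).
by rewrite mulr_ge0 ?sqr_ge0 // expr0 divr_ge0.
Qed.

Section small_parameter.
Variable A : R.
Hypothesis A1 : 1 <= A.

Let A0 : 0 <= A. Proof. exact: le_trans ler01 A1. Qed.

(** The bound [a <= A] allows a monomial of degree lower than [d] to carry the weight [a ^+ d], at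
    the price of a power of [A]. *)
Let damped_poly d f : poly_le coor d f -> exists2 C : R, 0 <= C &
  forall a w, 0 <= a <= A ->
    a ^+ d * (\sum_i damped a w i * f (x i)) ^+ 2 <= C * se_form a w.
Proof.
elim=> [s sd|f1 f2 _ [C1 C10 h1] _ [C2 C20 h2]|b f1 _ [C1 C10 h1]].
- exists ((size s)`!%:R * A ^+ (d - size s)); first by rewrite mulr_ge0 ?exprn_ge0.
  move=> a w /andP[a0 aA]; set M := (_ ^+ 2).
  have f0 : 0 < (size s)`!%:R :> R by rewrite ltr0n fact_gt0.
  have := se_form_ge_monom w s a0; rewrite -/M => h.
  have M0 : 0 <= M by exact: sqr_ge0.
  clearbody M.
  apply: le_trans (_ : (size s)`!%:R * A ^+ (d - size s) *
     ((2 * a) ^+ size s / (size s)`!%:R * M) <= _); last first.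
    by apply: ler_wpM2l h; rewrite mulr_ge0 ?exprn_ge0.
  rewrite !mulrA; apply: ler_wpM2r => //.
  rewrite -{1}(subnK sd) exprD exprMn.
  have -> : (size s)`!%:R * A ^+ (d - size s) * (2 ^+ size s * a ^+ size s)
     / (size s)`!%:R = A ^+ (d - size s) * (2 ^+ size s * a ^+ size s).
    by field; rewrite gt_eqF.
  apply: ler_pM; rewrite ?exprn_ge0 //; first by rewrite lerXn2r ?nnegrE.
  by rewrite ler_peMl ?exprn_ge0 // exprn_ege1 // ler1n.
- exists (2 * (C1 + C2)); first by rewrite mulr_ge0 ?addr_ge0.
  move=> a w ha; have {}h1 := h1 a w ha; have {}h2 := h2 a w ha.
  have -> : \sum_i damped a w i * (f1 (x i) + f2 (x i)) =
     \sum_i damped a w i * f1 (x i) + \sum_i damped a w i * f2 (x i).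
    by rewrite -big_split; apply: eq_bigr => i _; rewrite mulrDr.
  move: h1 h2; move: (\sum_i _ * f1 _) (\sum_i _ * f2 _) => S1 S2 h1 h2.
  have ad : 0 <= a ^+ d by case/andP: ha => a0 _; rewrite exprn_ge0.
  have := mulr_ge0 ad (sqr_ge0 (S1 - S2)); rewrite !expr2 in h1 h2 *.
  nra.
- exists (b ^+ 2 * C1); first by rewrite mulr_ge0 ?sqr_ge0.
  move=> a w ha; have {}h1 := h1 a w ha.
  have -> : \sum_i damped a w i * (b * f1 (x i)) =
     b * \sum_i damped a w i * f1 (x i).
    by rewrite mulr_sumr; apply: eq_bigr => i _; rewrite mulrCA.
  by rewrite exprMn mulrCA -mulrA ler_wpM2l ?sqr_ge0.
Qed.

Let damped_sqr : exists2 C : R, 0 <= C &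
  forall a w, 0 <= a <= A ->
    a ^+ n * (\sum_i damped a w i ^+ 2) <= C * se_form a w.
Proof.
have h i : exists C : R, 0 <= C /\ forall a w, 0 <= a <= A ->
    a ^+ n * damped a w i ^+ 2 <= C * se_form a w.
  have [f pf fi] := indicator_poly hx i.
  have [C C0 hC] := damped_poly pf; exists C; split=> // a w ha.
  apply: le_trans (hC a w ha); rewrite (bigD1 i) //= fi eqxx mulr1 big1 ?addr0 //.
  by move=> j ji; rewrite fi (negbTE ji) mulr0.
have [C hC] := choice h.
exists (\sum_i C i); first by apply: sumr_ge0 => i _; case: (hC i).
move=> a w ha; rewrite mulr_sumr mulr_suml; apply: ler_sum => i _.
by case: (hC i) => _; apply.
Qed.

(* Writing [f = exp(-a|x|^2) (f exp(a|x|^2))] and expanding the second factor,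
   the terms of the expansion are polynomials times powers of [a], and the
   remainder is handled by interpolation on the design. *)
Lemma poly_moment_le d f : poly_le coor d f -> exists2 C : R, 0 <= C &
  forall a w, 0 <= a <= A ->
    a ^+ d * (\sum_i w i * f (x i)) ^+ 2 <= C * se_form a w.
Proof.
move=> pf.
pose g q (u : 'rV[R]_r) := dot u u ^+ q * f u.
have pg q : poly_le coor (2 * q + d) (g q).
  apply: poly_le_mul => //; apply: poly_le_exp; apply: poly_le_sum => k _.
  by apply: (@poly_le_mul _ _ _ _ 1 1); exact: poly_le_var.
have h q : exists C : R, 0 <= C /\ forall a w, 0 <= a <= A ->
    a ^+ (2 * q + d) * (\sum_i damped a w i * g q (x i)) ^+ 2 <= C * se_form a w.
  by have [C C0 hC] := damped_poly (pg q); exists C.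
have [C hC] := choice h.
have [C' C'0 hC'] := damped_sqr.
pose rem a i := expR (a * dot (x i) (x i))
  - \sum_(q < n) (a * dot (x i) (x i)) ^+ q / q`!%:R.
have dot0 i : 0 <= dot (x i) (x i).
  by apply: sumr_ge0 => k _; rewrite -expr2 sqr_ge0.
pose G := \sum_i dot (x i) (x i) ^+ n * expR (A * dot (x i) (x i)) * `|f (x i)|.
have G0 : 0 <= G.
  by apply: sumr_ge0 => i _; rewrite !mulr_ge0 ?exprn_ge0 ?expR_ge0.
have remG a i : 0 <= a <= A -> `|rem a i * f (x i)| <= a ^+ n * G.
  move=> /andP[a0 aA]; rewrite normrM /G mulr_sumr (bigD1 i) //=.
  apply: ler_wpDr.
    apply: sumr_ge0 => j _.
    by rewrite !mulr_ge0 ?exprn_ge0 ?expR_ge0.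
  rewrite !mulrA; apply: ler_wpM2r => //.
  apply: le_trans (expR_remainder_le _ _) _.
  rewrite ger0_norm ?mulr_ge0 // exprMn.
  by apply: ler_wpM2l; rewrite ?mulr_ge0 ?exprn_ge0 // ler_expR ler_wpM2r.
pose CC := \sum_(q < n) (q`!%:R^-1) ^+ 2 * C q + n%:R * A ^+ (d + n) * G ^+ 2 * C'.
have CC1 : 0 <= \sum_(q < n) (q`!%:R^-1) ^+ 2 * C q.
  by apply: sumr_ge0 => q _; rewrite mulr_ge0 ?sqr_ge0 //; case: (hC q).
have CC2 : 0 <= n%:R * A ^+ (d + n) * G ^+ 2 * C'.
  by rewrite !mulr_ge0 ?exprn_ge0 ?sqr_ge0.
exists ((n.+1)%:R * CC); first by rewrite mulr_ge0 ?addr_ge0.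
move=> a w ha; have /andP[a0 aA] := ha.
pose T q := a ^+ q / q`!%:R * \sum_i damped a w i * g q (x i).
pose T' := \sum_i damped a w i * (rem a i * f (x i)).
have eS : \sum_i w i * f (x i) = \sum_(q < n) T q + T'.
  rewrite /T /T'; under [X in X + _]eq_bigr => q _ do rewrite mulr_sumr.
  rewrite exchange_big -big_split; apply: eq_bigr => i _ /=.
  transitivity (damped a w i * (expR (a * dot (x i) (x i)) * f (x i))).
    rewrite /damped mulrA -(mulrA (w i)) -expRD addNr expR0 mulr1 //.
  rewrite -[in LHS](subrK (\sum_(q < n) (a * dot (x i) (x i)) ^+ q / q`!%:R)
     (expR _)) -/(rem a i) mulrDl mulrDr addrC; congr (_ + _).
  rewrite mulr_suml mulr_sumr; apply: eq_bigr => q _.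
  by rewrite /g exprMn; ring.
rewrite eS.
(* The remainder becomes the last of [n.+1] terms, so that one application of [sqr_sum_le] separates
   them all. *)
have -> : \sum_(q < n) T q + T' = \sum_(q < n.+1) (if (q < n)%N then T q else T').
  rewrite big_ord_recr /= ltnn; congr (_ + _).
  by apply: eq_bigr => q _; rewrite ltn_ord.
apply: le_trans (ler_wpM2l (exprn_ge0 _ a0) (sqr_sum_le _)) _.
rewrite mulrCA -!mulrA ler_wpM2l //.
rewrite big_ord_recr /= ltnn mulrDr mulrDl; apply: lerD.
  rewrite mulr_sumr mulr_suml; apply: ler_sum => q _; rewrite ltn_ord /T.
  rewrite exprMn expr_div_n -mulrA.
  apply: le_trans (_ : (q`!%:R^-1) ^+ 2 * (a ^+ (2 * q + d) *
      (\sum_i damped a w i * g q (x i)) ^+ 2) <= _).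
    apply: eqW.
    by rewrite exprVn exprD mul2n -addnn exprD expr2; ring.
  by rewrite -[leRHS]mulrA ler_wpM2l ?sqr_ge0 //; case: (hC q) => _; apply.
have T'2 : T' ^+ 2 <= n%:R * (a ^+ n * G) ^+ 2 * \sum_i damped a w i ^+ 2.
  apply: le_trans (sqr_sum_le _) _; rewrite -mulrA ler_wpM2l //.
  rewrite mulr_sumr; apply: ler_sum => i _; rewrite exprMn mulrC.
  apply: ler_wpM2r; first exact: sqr_ge0.
  rewrite -[_ ^+ 2]real_normK ?num_real // lerXn2r ?nnegrE //.
    by rewrite mulr_ge0 ?exprn_ge0.
  exact: remG.
have s0 : 0 <= \sum_i damped a w i ^+ 2 by apply: sumr_ge0 => i _; exact: sqr_ge0.
apply: le_trans (ler_wpM2l (exprn_ge0 d a0) T'2) _.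
apply: le_trans (_ : n%:R * A ^+ (d + n) * G ^+ 2 *
   (a ^+ n * (\sum_i damped a w i ^+ 2)) <= _); last first.
  by rewrite -[leRHS]mulrA ler_wpM2l ?hC' // !mulr_ge0 ?exprn_ge0 ?sqr_ge0.
have -> : a ^+ d * (n%:R * (a ^+ n * G) ^+ 2 * (\sum_i damped a w i ^+ 2)) =
   n%:R * a ^+ (d + n) * G ^+ 2 * (a ^+ n * (\sum_i damped a w i ^+ 2)).
  by rewrite exprD; ring.
do 2 (apply: ler_wpM2r; first by rewrite ?mulr_ge0 ?exprn_ge0 ?sqr_ge0).
by apply: ler_wpM2l => //; rewrite lerXn2r ?nnegrE.
Qed.

End small_parameter.

End squared_exponential_form.

(** * Exponential sums with vanishing moments, and their derivatives *)

Section exponential_sums.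
Context {R : realType} (J : finType) (c D : J -> R).
Hypothesis D0 : forall l, 0 <= D l.

Definition expsum (a : R) : R := \sum_l c l * expR (- (a * D l)).
(** This is [- a] times the derivative of [expsum]; the factor [a] makes it a bounded function, and
    matches the derivative in theta up to [2 / theta]. *)
Definition dexpsum (a : R) : R := \sum_l c l * (a * D l * expR (- (a * D l))).
(** Equivalently, the Taylor coefficients of [expsum] at 0 of order less than [k] vanish. *)
Definition vanishing (k : nat) : Prop :=
  forall q, (q < k)%N -> \sum_l c l * D l ^+ q = 0.

Lemma ler_min1_exp (a : R) k l : 0 <= a -> (k <= l)%N ->
  Num.min 1 a ^+ l <= Num.min 1 a ^+ k.
Proof.
move=> a0 kl; apply: ler_wiXn2l => //; last by rewrite ge_min lexx.
by rewrite le_min ler01.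
Qed.

Lemma expsum_lead k : vanishing k -> exists2 C : R, 0 <= C &
  forall a, 0 <= a <= 1 ->
    `|expsum a - (\sum_l c l * D l ^+ k) / k`!%:R * (- a) ^+ k| <= C * a ^+ k.+1.
Proof.
move=> van; exists (\sum_l `|c l| * (D l ^+ k.+1 * expR (D l))).
  by apply: sumr_ge0 => l _; rewrite !mulr_ge0 ?exprn_ge0 ?expR_ge0.
move=> a /andP[a0 a1].
have -> : expsum a - (\sum_l c l * D l ^+ k) / k`!%:R * (- a) ^+ k =
    \sum_l c l * (expR (- (a * D l)) - \sum_(q < k.+1) (- (a * D l)) ^+ q / q`!%:R).
  under [RHS]eq_bigr => l _ do rewrite mulrBr mulr_sumr.
  rewrite sumrB [X in _ = _ - X]exchange_big big_ord_recr /=.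
  set X := \sum_(q < k) _; have -> : X = 0.
    rewrite /X big1 // => q _.
    transitivity ((- a) ^+ q / q`!%:R * \sum_l c l * D l ^+ q).
      by rewrite mulr_sumr; apply: eq_bigr => l _; rewrite -mulNr exprMn; ring.
    by rewrite van ?mulr0 ?ltn_ord.
  rewrite add0r; congr (_ - _); rewrite !mulr_suml.
  by apply: eq_bigr => l _; rewrite -[- (a * _)]mulNr exprMn; ring.
apply: le_trans (ler_norm_sum _ _ _) _; rewrite mulr_suml.
apply: ler_sum => l _; rewrite normrM -mulrA ler_wpM2l //.
apply: le_trans (expR_remainder_le _ _) _.
rewrite normrN ger0_norm ?mulr_ge0 // exprMn [leRHS]mulrC -mulrA.
apply: ler_wpM2l; first exact: exprn_ge0.
apply: ler_wpM2l; first exact: exprn_ge0.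
by rewrite ler_expR ler_piMl.
Qed.

Lemma expsum_bounded a : 0 <= a -> `|expsum a| <= \sum_l `|c l|.
Proof.
move=> a0; apply: le_trans (ler_norm_sum _ _ _) _; apply: ler_sum => l _.
rewrite normrM (ger0_norm (expR_ge0 _)) ler_piMr // -expR0 ler_expR oppr_le0.
by rewrite mulr_ge0.
Qed.

Lemma mulx_expRN_le1 (y : R) : y * expR (- y) <= 1.
Proof.
rewrite expRN ler_pdivrMr ?expR_gt0 // mul1r.
by apply: le_trans (expR_ge1Dx y); rewrite lerDr.
Qed.

Lemma dexpsum_bounded a : 0 <= a -> `|dexpsum a| <= \sum_l `|c l|.
Proof.
move=> a0; apply: le_trans (ler_norm_sum _ _ _) _; apply: ler_sum => l _.
have p0 : 0 <= a * D l * expR (- (a * D l)) by rewrite !mulr_ge0 ?expR_ge0.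
by rewrite normrM (ger0_norm p0) ler_piMr // mulx_expRN_le1.
Qed.

Lemma min1_bound (f : R -> R) k (C1 C2 : R) : 0 <= C1 -> 0 <= C2 ->
  (forall a, 0 <= a <= 1 -> `|f a| <= C1 * a ^+ k) ->
  (forall a, 0 <= a -> `|f a| <= C2) ->
  forall a, 0 <= a -> `|f a| <= (C1 + C2) * Num.min 1 a ^+ k.
Proof.
move=> C10 C20 h1 h2 a a0; rewrite mulrDl; have [a1|/ltW a1] := leP a 1.
  apply: ler_wpDr; last by apply: h1; rewrite a0.
  by rewrite mulr_ge0 ?exprn_ge0.
rewrite expr1n !mulr1; apply: ler_wpDl => //.
exact: h2.
Qed.

Lemma sum_norm_ge0 : 0 <= \sum_l `|c l|.
Proof. by apply: sumr_ge0. Qed.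

Lemma expsum_le k : vanishing k -> exists2 C : R, 0 <= C &
  forall a, 0 <= a -> `|expsum a| <= C * Num.min 1 a ^+ k.
Proof.
move=> van; have [C C0 hC] := expsum_lead van.
set g := _ / _ in hC.
exists (`|g| + C + \sum_l `|c l|); first by rewrite !addr_ge0 ?sum_norm_ge0.
apply: min1_bound; rewrite ?addr_ge0 ?sum_norm_ge0 //; last exact: expsum_bounded.
move=> a a01; have /andP[a0 a1] := a01; have h := hC a a01.
rewrite -[expsum a](subrK (g * (- a) ^+ k)) addrC.
apply: le_trans (ler_normD _ _) _; rewrite mulrDl; apply: lerD.
  by rewrite normrM normrX normrN (ger0_norm a0).
apply: le_trans h _; rewrite ler_wpM2l // exprS ler_piMl ?exprn_ge0 //.
Qed.

(** The leading Taylor term is truncated like the moments h_k, so that the expansion holds for every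
    [a >= 0] and can be averaged over the mixture. *)
Lemma expsum_lead_min k : vanishing k -> exists g : R, exists2 C : R, 0 <= C &
  forall a, 0 <= a ->
    `|expsum a - g * Num.min 1 a ^+ k| <= C * Num.min 1 a ^+ k.+1.
Proof.
move=> van; have [C C0 hC] := expsum_lead van.
exists ((\sum_l c l * D l ^+ k) / k`!%:R * (-1) ^+ k).
set g := _ * _ ^+ k.
exists (C + (\sum_l `|c l| + `|g|)); first by rewrite !addr_ge0 ?sum_norm_ge0.
apply: min1_bound => //; first by rewrite addr_ge0 ?sum_norm_ge0.
  move=> a a01; have /andP[a0 a1] := a01; rewrite (min_idPr a1).
  by apply: le_trans (hC a a01); rewrite /g -[- a]mulN1r exprMn mulrA.
move=> a a0; apply: le_trans (ler_normB _ _) _; apply: lerD.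
  exact: expsum_bounded.
rewrite normrM ler_piMr // normrX exprn_ile1 // ger0_norm.
  by rewrite ge_min lexx.
by rewrite le_min ler01.
Qed.

End exponential_sums.

Section exponential_sums_derivative.
Context {R : realType} (J : finType) (c D : J -> R).
Hypothesis D0 : forall l, 0 <= D l.

Let cD l := c l * D l.

Let dexpsumE a : dexpsum c D a = a * expsum cD D a.
Proof.
rewrite /dexpsum /expsum mulr_sumr; apply: eq_bigr => l _.
by rewrite /cD; ring.
Qed.

Let vanishingD k : vanishing c D k.+1 -> vanishing cD D k.
Proof.
move=> van q qk; apply: etrans (van q.+1 qk); apply: eq_bigr => l _.
by rewrite /cD exprS mulrA.
Qed.

Lemma dexpsum_le k : vanishing c D k -> exists2 C : R, 0 <= C &
  forall a, 0 <= a -> `|dexpsum c D a| <= C * Num.min 1 a ^+ k.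
Proof.
case: k => [_|k /vanishingD /(expsum_le D0) [C C0 hC]].
  exists (\sum_l `|c l|) => [|a a0]; first exact: sum_norm_ge0.
  by rewrite expr0 mulr1; exact: dexpsum_bounded.
exists (C + \sum_l `|c l|); first by rewrite addr_ge0 ?sum_norm_ge0.
apply: min1_bound => //; [exact: sum_norm_ge0| |exact: dexpsum_bounded].
move=> a /andP[a0 a1]; rewrite dexpsumE normrM (ger0_norm a0) exprS mulrCA.
by rewrite ler_wpM2l //; apply: le_trans (hC a a0) _; rewrite (min_idPr a1).
Qed.

(** On the leading term [a ^+ k] the operator [- a d/da] acts as multiplication by [- k], so adding
    [k%:R] times [expsum] cancels it. This is the shift used when all degrees are equal. *)
Lemma dexpsum_lead k : vanishing c D k -> exists2 C : R, 0 <= C &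
  forall a, 0 <= a ->
    `|dexpsum c D a + k%:R * expsum c D a| <= C * Num.min 1 a ^+ k.+1.
Proof.
move=> van.
have bnd a : 0 <= a -> `|dexpsum c D a + k%:R * expsum c D a| <=
    \sum_l `|c l| + k%:R * \sum_l `|c l|.
  move=> a0; apply: le_trans (ler_normD _ _) _; apply: lerD.
    exact: dexpsum_bounded.
  by rewrite normrM ger0_norm // ler_wpM2l //; exact: expsum_bounded.
have S0 := sum_norm_ge0 c.
suff [C C0 hC] : exists2 C : R, 0 <= C & forall a, 0 <= a <= 1 ->
    `|dexpsum c D a + k%:R * expsum c D a| <= C * a ^+ k.+1.
  exists (C + (\sum_l `|c l| + k%:R * \sum_l `|c l|)).
    by rewrite !addr_ge0 ?mulr_ge0.
  by apply: min1_bound => //; rewrite addr_ge0 ?mulr_ge0.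
have [C C0 hC] := expsum_lead D0 van.
case: k van bnd hC => [|k] van bnd hC.
  exists (\sum_l `|cD l|) => [|a /andP[a0 a1]]; first exact: sum_norm_ge0.
  rewrite mul0r addr0 dexpsumE normrM (ger0_norm a0) expr1 mulrC.
  by rewrite ler_wpM2r //; exact: expsum_bounded.
have [C' C'0 hC'] := expsum_lead D0 (vanishingD van).
exists (C' + k.+1%:R * C) => [|a a01]; first by rewrite addr_ge0 ?mulr_ge0.
have /andP[a0 a1] := a01; have h := hC a a01; have h' := hC' a a01.
have f0 : k`!%:R != 0 :> R by rewrite pnatr_eq0 -lt0n fact_gt0.
have eM : \sum_l cD l * D l ^+ k = \sum_l c l * D l ^+ k.+1.
  by apply: eq_bigr => l _; rewrite /cD exprS mulrA.
rewrite eM in h'; move: h h'; set M := \sum_l _ => h h'.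
have -> : dexpsum c D a + k.+1%:R * expsum c D a =
   a * (expsum cD D a - M / k`!%:R * (- a) ^+ k) +
   k.+1%:R * (expsum c D a - M / (k.+1)`!%:R * (- a) ^+ k.+1).
  rewrite dexpsumE factS natrM exprS; field.
  by rewrite f0 addrC natr1 pnatr_eq0.
apply: le_trans (ler_normD _ _) _; rewrite mulrDl; apply: lerD.
  by rewrite normrM (ger0_norm a0) exprS mulrCA ler_wpM2l.
by rewrite normrM (ger0_norm (ler0n _ _)) -[leRHS]mulrA ler_wpM2l.
Qed.

(** Rests on [y * y^e <= 1 + y ^+ 2 <= 2 * expR y]. It serves near [theta = 0], where the scale
    [theta ^- 2] is large. *)
Lemma dexpsum_decay (e : R) : 0 < e <= 1 -> exists2 C : R, 0 <= C &
  forall a, 0 < a -> `|dexpsum c D a| <= C * a `^ (- e).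
Proof.
move=> /andP[e0 e1]; exists (\sum_l `|c l| * (2 * D l `^ (- e))).
  by apply: sumr_ge0 => l _; rewrite !mulr_ge0 ?powR_ge0.
move=> a a0; apply: le_trans (ler_norm_sum _ _ _) _; rewrite mulr_suml.
apply: ler_sum => l _; rewrite normrM -[leRHS]mulrA ler_wpM2l //.
rewrite ger0_norm; last by rewrite !mulr_ge0 ?expR_ge0 // ltW.
have [->|Dl] := eqVneq (D l) 0.
  by rewrite mulr0 mul0r !mulr_ge0 ?powR_ge0.
have Dp : 0 < D l by rewrite lt_def Dl D0.
rewrite -[leRHS]mulrA -powRM ?(ltW a0) // [D l * a]mulrC.
have y0 : 0 < a * D l by rewrite mulr_gt0.
move: (a * D l) y0 => y y0.
rewrite expRN powRN -[leRHS]/(2 / _) ler_pdivrMr ?expR_gt0 //.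
rewrite mulrAC ler_pdivlMr ?powR_gt0 //.
have h : y * y `^ e <= 1 + y ^+ 2.
  have [y1|/ltW y1] := leP y 1.
    apply: le_trans (_ : 1 <= _); last by rewrite lerDl sqr_ge0.
    rewrite mulr_ile1 ?powR_ge0 ?(ltW y0) //.
    by rewrite -[leRHS](powRr0 y); apply: ger_powR; rewrite ?y0 // ltW.
  apply: le_trans (_ : y ^+ 2 <= _); last by rewrite lerDr.
  rewrite expr2 ler_wpM2l ?(ltW y0) //.
  exact: ler1_powR.
apply: le_trans h _; have := expR_ge1Dxn 1 (ltW y0).
by rewrite (_ : 2`! = 2)%N //; have := expR_gt0 y; lra.
Qed.

End exponential_sums_derivative.

(** * Lower bound on the Gaussian form, uniform in the scale *)

Section kernel_form_bounds.
Context {R : realType} (r n m : nat) (x : 'I_n -> 'rV[R]_r) (W : 'M[R]_(n, m)).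
Hypotheses (hx : injective x) (hW : W^T *m W = 1%:M).

(** Diagonal dominance: distinct points are separated, so at a large scale the off-diagonal entries
    sum to at most 1/2 on each row. *)
Lemma se_form_ge_large : exists2 A : R, 1 <= A &
  forall a (w : 'I_n -> R), A <= a -> 2^-1 * \sum_i w i ^+ 2 <= se_form x a w.
Proof.
(* A positive lower bound on the squared distances between distinct points, obtained without a
   minimum. The diagonal terms are [0^-1 = 0] and do no harm. *)
pose e := (1 + \sum_i \sum_j (sqdist (x i) (x j))^-1)^-1.
have s0 : 0 <= \sum_i \sum_j (sqdist (x i) (x j))^-1.
  by apply: sumr_ge0 => i _; apply: sumr_ge0 => j _; rewrite invr_ge0 sqdist_ge0.
have e0 : 0 < e by rewrite invr_gt0 ltr_pwDl.
have eD i j : i != j -> e <= sqdist (x i) (x j).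
  move=> ij; have d0 := sqdist_gt0 hx ij.
  rewrite -[leRHS]invrK lef_pV2 ?posrE ?invr_gt0 ?ltr_pwDl //.
  apply: ler_wpDl => //; rewrite (bigD1 i) //= (bigD1 j) //= -addrA.
  rewrite lerDl addr_ge0 //; apply: sumr_ge0 => l _; rewrite ?invr_ge0 ?sqdist_ge0 //.
  by apply: sumr_ge0 => q _; rewrite invr_ge0 sqdist_ge0.
(* Chosen so that [1 + a * e >= 2 * n%:R] for [a >= A], whence [n%:R * expR (- (a * e)) <= 2^-1]. *)
pose A := 1 + 2 * n%:R / e.
exists A; first by rewrite lerDl divr_ge0 ?mulr_ge0 ?(ltW e0).
move=> a w Aa.
have ne : n%:R * expR (- (a * e)) <= 2^-1.
  rewrite expRN ler_pdivrMr ?expR_gt0 //.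
  apply: le_trans (_ : 2^-1 * (1 + a * e) <= _); last first.
    by rewrite ler_wpM2l ?invr_ge0 // expR_ge1Dx.
  have : A * e <= a * e by rewrite ler_wpM2r // ltW.
  rewrite /A mulrDl mul1r divfK ?gt_eqF //.
  by have := ltW e0; lra.
have key i j : (w i ^+ 2 + w j ^+ 2) / 2 * (- expR (- (a * e)))
   + (if i == j then w i ^+ 2 else 0)
   <= w i * w j * expR (- (a * sqdist (x i) (x j))).
  have E0 := expR_ge0 (- (a * e)).
  have [<-|ij] := eqVneq i j.
    have -> : sqdist (x i) (x i) = 0 by apply/eqP; rewrite sqdist_eq0.
    rewrite mulr0 oppr0 expR0 mulr1 -expr2.
    by have := mulr_ge0 (sqr_ge0 (w i)) E0; lra.
  rewrite addr0 mulrN lerNl -mulNr.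
  apply: le_trans (_ : (w i ^+ 2 + w j ^+ 2) / 2 *
     expR (- (a * sqdist (x i) (x j))) <= _).
    by apply: ler_wpM2r; rewrite ?expR_ge0 //; have := sqr_ge0 (w i + w j); nra.
  apply: ler_wpM2l; first by rewrite divr_ge0 ?addr_ge0 ?sqr_ge0.
  rewrite ler_expR lerN2 ler_wpM2l ?eD //.
  by apply: le_trans Aa; rewrite /A addr_ge0 ?divr_ge0 ?mulr_ge0 ?(ltW e0).
apply: le_trans (_ : \sum_i \sum_j ((w i ^+ 2 + w j ^+ 2) / 2
    * - expR (- (a * e)) + (if i == j then w i ^+ 2 else 0)) <= _); last first.
  by apply: ler_sum => i _; apply: ler_sum => j _; exact: key.
have s2 : \sum_i \sum_j (w i ^+ 2 + w j ^+ 2) = 2 * n%:R * \sum_i w i ^+ 2.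
  under eq_bigr => i _ do rewrite big_split /= sumr_const card_ord.
  by rewrite big_split /= sumr_const card_ord sumrMnl -[X in X + X]mulr_natl; ring.
have -> : \sum_i \sum_j ((w i ^+ 2 + w j ^+ 2) / 2 * - expR (- (a * e)) +
      (if i == j then w i ^+ 2 else 0)) =
    (1 - n%:R * expR (- (a * e))) * \sum_i w i ^+ 2.
  transitivity (\sum_i \sum_j (w i ^+ 2 + w j ^+ 2) * (- expR (- (a * e)) / 2)
     + \sum_i w i ^+ 2).
    rewrite -big_split; apply: eq_bigr => i _ /=.
    have ei : \sum_j (if i == j then w i ^+ 2 else 0) = w i ^+ 2.
      by rewrite -big_mkcond /= (big_pred1 i) // => j; rewrite /= eq_sym.
    rewrite big_split /= ei.
    by congr (_ + _); apply: eq_bigr => j _; ring.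
  under eq_bigr => i _ do rewrite -mulr_suml.
  by rewrite -mulr_suml s2; field.
by apply: ler_wpM2r; [apply: sumr_ge0 => i _; exact: sqr_ge0|lra].
Qed.

(** Moment bounds cover the scales up to [A] and diagonal dominance those beyond; the truncated
    power of [a] is a weight that both ranges support. *)
Lemma adapted_kernel_basis : exists (U : 'M[R]_m) (deg : 'I_m -> nat),
  [/\ U \in unitmx,
      exists2 C : R, 0 < C & forall a (v : 'cV[R]_m) i, 0 < a ->
        Num.min 1 a ^+ deg i * v i 0 ^+ 2 <=
          C * se_form x a (fun s => (W *m U *m v) s 0) &
      forall i j q, (q.*2 < deg i + deg j)%N ->
        \sum_s \sum_t (W *m U) s i * (W *m U) t j * sqdist (x s) (x t) ^+ q = 0].
Proof.
have [U [w [uU hv hz]]] := adapted_basis hx hW.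
exists U, (fun i => size (w i)); split=> //; last first.
  move=> i j q; apply: (@sqdist_exp_bilinear _ _ _ x (fun s => (W *m U) s i)
    (fun s => (W *m U) s j)); exact: hz.
have [A A1 hA] := se_form_ge_large.
have hs i : exists C : R, 0 <= C /\ forall a (v : 'cV[R]_m), 0 <= a <= A ->
    a ^+ size (w i) * v i 0 ^+ 2 <= C * se_form x a (fun s => (W *m U *m v) s 0).
  have [C C0 hC] := @poly_moment_le _ _ _ x hx A A1 (size (w i)) (monom coor (w i))
    (poly_le_mon _ (leqnn _)).
  by exists C; split=> // a v ha; rewrite -hv; exact: hC.
have [C hC] := choice hs.
pose M i := \sum_s monom coor (w i) (x s) ^+ 2.
have M0 i : 0 <= M i by apply: sumr_ge0 => s _; exact: sqr_ge0.
have C0 i : 0 <= C i by case: (hC i).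
exists (1 + \sum_i (C i + 2 * M i)).
  by rewrite ltr_pwDl // sumr_ge0 // => i _; rewrite addr_ge0 // mulr_ge0.
move=> a v i a0; set f := fun s => (W *m U *m v) s 0.
have f0 : 0 <= se_form x a f by apply: se_form_ge0; exact: ltW.
have m0 : 0 <= Num.min 1 a by rewrite le_min ler01 ltW.
apply: le_trans (_ : (C i + 2 * M i) * se_form x a f <= _); last first.
  apply: ler_wpM2r => //; apply: ler_wpDl => //; rewrite (bigD1 i) //= lerDl.
  by apply: sumr_ge0 => j _; rewrite addr_ge0 // mulr_ge0.
rewrite mulrDl; have [aA|/ltW Aa] := leP a A.
  apply: ler_wpDr; first by rewrite mulr_ge0 // mulr_ge0.
  have [_ h] := hC i; apply: le_trans (h a v _); last by rewrite (ltW a0).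
  apply: ler_wpM2r; first exact: sqr_ge0.
  by rewrite lerXn2r ?nnegrE ?(ltW a0) // ge_min lexx orbT.
apply: ler_wpDl; first by rewrite mulr_ge0.
apply: le_trans (_ : v i 0 ^+ 2 <= _).
  rewrite ler_piMl ?sqr_ge0 // exprn_ile1 // ge_min lexx //.
apply: le_trans (_ : M i * \sum_s f s ^+ 2 <= _); last first.
  by rewrite (mulrC 2) -mulrA ler_wpM2l //; have := hA a f Aa; lra.
rewrite -hv.
under eq_bigr do rewrite mulrC.
exact: sqr_sum_mul_le.
Qed.

End kernel_form_bounds.

(** * Means against the Gamma weight *)

Section gamma_weight.
Context {R : realType}.
Let mu := @lebesgue_measure R.
Implicit Types (nu t : R) (f g : R -> R).

(* The Gamma weight s^(nu - 1) exp(-s) ds in the variable t = ln s. *)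
Definition gweight nu t : R := expR (nu * t - expR t).

Definition wintegrable nu f : Prop :=
  mu.-integrable setT (EFin \o (fun t => f t * gweight nu t)).

(** Not normalised: the total mass is [Gamma nu], by which the kernels are divided later. *)
Definition wmean nu f : R := \int[mu]_(t in setT) (f t * gweight nu t).

Lemma gweight_gt0 nu t : 0 < gweight nu t. Proof. exact: expR_gt0. Qed.

Lemma measurable_lin (a b : R) : measurable_fun setT (fun t : R => a * t + b).
Proof. by apply: measurable_funD => //; apply: measurable_funM. Qed.

Lemma measurable_explin (a b : R) :
  measurable_fun setT (fun t : R => expR (a * t + b)).
Proof. by apply: measurableT_comp => //; exact: measurable_lin. Qed.

Lemma measurable_gweight nu : measurable_fun setT (gweight nu).
Proof.
by apply: measurableT_comp => //; apply: measurable_funB => //.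
Qed.

Lemma gweightM nu (a : R) t : expR (a * t) * gweight nu t = gweight (nu + a) t.
Proof. by rewrite /gweight -expRD; congr expR; ring. Qed.

(** The right-hand side is a logistic density up to a constant, with an explicit bounded primitive;
    it yields integrability and, later, the vanishing of boundary terms. *)
Lemma gweight_le nu : 0 < nu -> exists2 C : R, 0 < C & forall t,
  gweight nu t <= C * (nu * expR (nu * t) / (1 + expR (nu * t)) ^+ 2).
Proof.
(* So that [N.+1 > 2 * nu]: for [t >= 0] the term of degree [N.+1] in the series of [expR (expR t)]
   then dominates [E ^+ 2]. *)
move=> nu0; pose N := Num.trunc (2 * nu).
have f0 : 0 < (N.+1)`!%:R :> R by rewrite ltr0n fact_gt0.
exists (4 * (N.+1)`!%:R / nu); first by rewrite divr_gt0 // mulr_gt0.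
move=> t; set E := expR (nu * t); have E0 : 0 < E by exact: expR_gt0.
have -> : 4 * (N.+1)`!%:R / nu * (nu * E / (1 + E) ^+ 2) =
    E * (4 * (N.+1)`!%:R / (1 + E) ^+ 2).
  by field; rewrite !gt_eqF // addr_gt0.
rewrite /gweight expRD -/E ler_pM2l // expRN ler_pdivlMr ?exprn_gt0 ?addr_gt0 //.
rewrite mulrC ler_pdivrMr ?expR_gt0 //.
have f1 : 1 <= (N.+1)`!%:R :> R by rewrite ler1n fact_gt0.
have [t0|/ltW t0] := leP t 0.
  apply: le_trans (_ : 4 * 1 * 1 <= _).
    have E1 : E <= 1 by rewrite /E expR_le1 mulr_ge0_le0 // ltW.
    by nra.
  apply: ler_pM => //; rewrite ?ler_pM2l //.
  by rewrite -expR0 ler_expR expR_ge0.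
apply: le_trans (_ : 4 * E ^+ 2 <= _).
  by have E1 : 1 <= E; [rewrite /E -expR0 ler_expR mulr_ge0 // ltW|nra].
rewrite -mulrA ler_pM2l //.
apply: le_trans (_ : (expR t) ^+ N.+1 <= _).
  rewrite -!expRM_natl ler_expR mulrA ler_wpM2r //.
  exact/ltW/truncnS_gt.
have := expR_ge1Dxn N (expR_ge0 t); rewrite -lerBrDl => h.
rewrite -ler_pdivrMl // mulrC; apply: le_trans h _.
by rewrite lerBlDr lerDl.
Qed.

Lemma integral_logistic_le (C nu l : R) : 0 <= C -> 0 < nu ->
  (\int[mu]_t (C * (nu * expR (l + nu * t) / (1 + expR (l + nu * t)) ^+ 2))%:E <=
    (2 * C)%:E)%E.
Proof.
move=> C0 nu0.
pose f t := C * (nu * expR (l + nu * t) / (1 + expR (l + nu * t)) ^+ 2).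
pose F t := - C * (1 + expR (l + nu * t))^-1.
have E0 t : 0 < 1 + expR (l + nu * t) by rewrite addr_gt0 ?expR_gt0.
have dE (t : R) : is_derive t 1 (fun t => 1 + expR (l + nu * t)) (nu * expR (l + nu * t)).
  have h1 : is_derive t 1 (fun t => expR (l + nu * t)) (expR (l + nu * t) * nu).
    exact: (is_derive1_comp (is_derive_expR _) (is_derive_affine nu l t)).
  have h2 : is_derive t 1 (cst (1 : R)) (0 : R) := is_derive_cst _ _ _.
  by have := is_deriveD h2 h1; rewrite !add0r mulrC.
have dF (t : R) : is_derive t 1 F (f t).
  have h := is_deriveV (f := fun t => 1 + expR (l + nu * t)) (lt0r_neq0 (E0 t)) (dE t).
  have -> : F = (- C) *: (fun t => (1 + expR (l + nu * t))^-1) by [].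
  apply: (is_derive_eq (is_deriveZ (- C) h)).
  by rewrite /GRing.scale /= /f; field; rewrite gt_eqF.
have cf : continuous f.
  move=> t; have c1 := is_derive_continuous (dE t).
  have cE : {for t, continuous (fun t => expR (l + nu * t))}.
    apply: continuous_comp; last exact: continuous_expR.
    exact: is_derive_continuous (is_derive_affine nu l t).
  apply: cvgM; first exact: cvg_cst.
  apply: cvgM; first by apply: cvgM; [exact: cvg_cst|exact: cE].
  apply: cvgV; first by rewrite expf_neq0 // gt_eqF.
  by apply: cvgM; exact: c1.
apply: (integralT_le (f := f) (F := F)) => // t.
  by rewrite /f !mulr_ge0 ?(ltW nu0) ?expR_ge0 // invr_ge0 sqr_ge0.
rewrite /F normrM normrN (ger0_norm C0) ler_piMr //.
by rewrite gtr0_norm ?invr_gt0 // invf_le1 // lerDl expR_ge0.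
Qed.

Lemma integrable_gweight nu : 0 < nu -> mu.-integrable setT (EFin \o gweight nu).
Proof.
move=> nu0; have [C C0 hC] := gweight_le nu0; have mw := measurable_gweight nu.
apply/integrableP; split; first exact/measurable_EFinP.
apply: le_lt_trans (ltry (2 * C)).
apply: le_trans (integral_logistic_le 0 (ltW C0) nu0).
apply: le_integral_nonneg => t _ /=; first by rewrite lee_fin.
by rewrite lee_fin ger0_norm ?(ltW (gweight_gt0 _ _)) // add0r hC.
Qed.

Lemma wintegrable_exp nu (a : R) : 0 < nu + a -> wintegrable nu (fun t => expR (a * t)).
Proof.
move=> h; rewrite /wintegrable; under eq_fun do rewrite gweightM.
exact: integrable_gweight.
Qed.

Lemma wintegrable_dom nu f g : measurable_fun setT f ->
  (forall t, `|f t| <= g t) -> wintegrable nu g -> wintegrable nu f.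
Proof.
move=> mf fg; apply: le_integrable => //.
  apply/measurable_EFinP; apply: measurable_funM => //.
  exact: measurable_gweight.
move=> t _ /=; rewrite lee_fin !normrM ler_wpM2r //.
exact: le_trans (fg t) (ler_norm _).
Qed.

Lemma wintegrableD nu f g : wintegrable nu f -> wintegrable nu g ->
  wintegrable nu (fun t => f t + g t).
Proof.
move=> hf hg; rewrite /wintegrable.
have := integrableD (measurableT : measurable setT) hf hg.
by apply: eq_integrable => // t _ /=; rewrite mulrDl EFinD.
Qed.

Lemma wintegrableZ nu (c : R) f : wintegrable nu f ->
  wintegrable nu (fun t => c * f t).
Proof.
move=> hf; rewrite /wintegrable.
have := integrableZl (measurableT : measurable setT) c hf.
by apply: eq_integrable => // t _ /=; rewrite -EFinM mulrA.
Qed.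

Lemma wmeanD nu f g : wintegrable nu f -> wintegrable nu g ->
  wmean nu (fun t => f t + g t) = wmean nu f + wmean nu g.
Proof.
move=> hf hg; rewrite /wmean -RintegralD //.
by apply: eq_Rintegral => t _; rewrite mulrDl.
Qed.

Lemma wmeanZ nu (c : R) f : wintegrable nu f ->
  wmean nu (fun t => c * f t) = c * wmean nu f.
Proof.
move=> hf; rewrite /wmean -RintegralZl //.
by apply: eq_Rintegral => t _; rewrite mulrA.
Qed.

Lemma wmean_le nu f g : wintegrable nu f -> wintegrable nu g ->
  (forall t, f t <= g t) -> wmean nu f <= wmean nu g.
Proof.
move=> hf hg fg; apply: le_Rintegral => // t _.
by rewrite ler_wpM2r ?(ltW (gweight_gt0 _ _)).
Qed.

Lemma wintegrable_sum nu (J : finType) (F : J -> R -> R) :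
  (forall j, wintegrable nu (F j)) -> wintegrable nu (fun t => \sum_j F j t).
Proof.
move=> h; have : forall s : seq J, wintegrable nu (fun t => \sum_(j <- s) F j t).
  elim=> [|j s IH].
    rewrite /wintegrable; apply: (eq_integrable _ (cst 0%E)) => //.
      by move=> t _ /=; rewrite big_nil mul0r.
    exact: integrable0.
  by under eq_fun do rewrite big_cons; exact: wintegrableD.
exact.
Qed.

Lemma wmean_sum nu (J : finType) (F : J -> R -> R) :
  (forall j, wintegrable nu (F j)) ->
  wmean nu (fun t => \sum_j F j t) = \sum_j wmean nu (F j).
Proof.
move=> h.
have key : forall s : seq J, wintegrable nu (fun t => \sum_(j <- s) F j t) /\
    wmean nu (fun t => \sum_(j <- s) F j t) = \sum_(j <- s) wmean nu (F j).
  elim=> [|j s [IH1 IH2]].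
    split; last by rewrite big_nil /wmean /Rintegral integral0_eq // => t _;
      rewrite big_nil mul0r.
    rewrite /wintegrable; apply: (eq_integrable _ (cst 0%E)) => //.
      by move=> t _ /=; rewrite big_nil mul0r.
    exact: integrable0.
  split; first by under eq_fun do rewrite big_cons; exact: wintegrableD.
  by rewrite big_cons -IH2 -wmeanD //; congr wmean; apply/funext => t; rewrite big_cons.
by case: (key (index_enum J)).
Qed.

Lemma wmean_norm_le nu f g : wintegrable nu f -> wintegrable nu g ->
  (forall t, `|f t| <= g t) -> `|wmean nu f| <= wmean nu g.
Proof.
move=> hf hg fg; rewrite ler_norml -mulN1r -wmeanZ //.
apply/andP; split; apply: wmean_le => //; try exact: wintegrableZ.
- by move=> t; rewrite mulN1r; have := fg t; rewrite ler_norml => /andP[].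
- by move=> t; have := fg t; rewrite ler_norml => /andP[].
Qed.

Lemma wmean_ge0 nu f : (forall t, 0 <= f t) -> 0 <= wmean nu f.
Proof.
move=> f0; apply: Rintegral_ge0 => t _.
by rewrite mulr_ge0 ?(ltW (gweight_gt0 _ _)).
Qed.

Lemma wmean_gt0 nu f (a b c : R) : a < b -> 0 < c -> wintegrable nu f ->
  (forall t, 0 <= f t) -> (forall t, a <= t <= b -> c <= f t * gweight nu t) ->
  c * (b - a) <= wmean nu f.
Proof.
move=> ab c0 hf f0 hc.
rewrite -lee_fin /wmean /Rintegral fineK; last first.
  exact: (integrable_fin_num _ hf).
have -> : (c * (b - a))%:E = (\int[mu]_(t in `[a, b]) (cst c%:E) t)%E.
  by rewrite integral_cst //= lebesgue_measure_itv /= lte_fin ab -EFinD EFinM.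
apply: (@le_trans _ _ (\int[mu]_(t in `[a, b]) (f t * gweight nu t)%:E)%E).
  apply: le_integral_nonneg => t; rewrite /= in_itv /= => h; rewrite lee_fin ?(ltW c0) //.
  exact: hc.
apply: ge0_subset_integral => //.
- by case/integrableP : hf.
- by move=> t _; rewrite lee_fin mulr_ge0 ?(ltW (gweight_gt0 _ _)).
Qed.

End gamma_weight.

(** * Translation and exponential substitution *)

Section change_of_variables.
Context {R : realType}.
Let mu := @lebesgue_measure R.

Lemma integralT_shift (G : R -> R) (s : R) : continuous G -> (forall t, 0 <= G t) ->
  (\int[mu]_t (G t)%:E = \int[mu]_t (G (t + s))%:E)%E.
Proof.
move=> cG G0; pose F (t : R) : R := s + 1 * t.
have dF (t : R) : is_derive t 1 F 1 by exact: is_derive_affine.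
have F' : derive1 F = cst 1.
  by apply/funext => t; rewrite derive1E; have [_ ->] := dF t.
rewrite (@increasing_ge0_integration_by_substitutionT _ F G) //.
- apply: eq_integral => t _; rewrite F' /GRing.mul /= mulr1 /F.
  by rewrite mul1r addrC.
- by move=> t u tu; rewrite /F !mul1r ltrD2l.
- by rewrite F' => t; exact: cvg_cst.
- by rewrite F'; exact: is_cvg_cst.
- by rewrite F'; exact: is_cvg_cst.
- apply/cvgrNyPle => M; near=> t; rewrite /F mul1r -lerBrDl.
  by near: t; apply: nbhs_ninfty_le; rewrite num_real.
- apply/cvgryPge => M; near=> t; rewrite /F mul1r -lerBlDl.
  by near: t; apply: nbhs_pinfty_ge; rewrite num_real.
Unshelve. all: end_near. Qed.

Lemma RintegralT_shift (G : R -> R) (s : R) : continuous G -> (forall t, 0 <= G t) ->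
  \int[mu]_(t in setT) (G t) = \int[mu]_(t in setT) (G (t + s)).
Proof. by move=> cG G0; rewrite /Rintegral (integralT_shift s cG G0). Qed.

(** Both sides are limits along exhaustions by compact intervals that the exponential maps onto each
    other, and on those the substitution rule applies. *)
Lemma integral0y_expR (G : R -> R) : (forall t, 0 < t -> {for t, continuous G}) ->
  (forall t, 0 < t -> 0 <= G t) ->
  (\int[mu]_(t in `]0%R, +oo[) (G t)%:E = \int[mu]_t (G (expR t) * expR t)%:E)%E.
Proof.
move=> cG G0.
pose I n : set R := `[- (n.+1%:R : R), n.+1%:R]%classic.
pose J n : set R := `[expR (- (n.+1%:R : R)), expR n.+1%:R]%classic.
have eJ : `]0%R, +oo[%classic = \bigcup_n J n.
  apply/seteqP; split=> t /=; rewrite in_itv /= ?andbT; last first.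
    move=> [n _ /=]; rewrite /J /= in_itv /= => /andP[h _].
    by apply: lt_le_trans h; exact: expR_gt0.
  move=> t0; have : setT (ln t) by [].
  rewrite setT_bigcup_itv => -[n _]; rewrite /= in_itv /= => /andP[h1 h2].
  exists n => //; rewrite /J /= in_itv /= -(lnK t0) !ler_expR.
  by rewrite h1 h2.
have t0 t : `]0%R, +oo[%classic t -> 0 < t :> R by rewrite /= in_itv /= andbT.
have cvI := cvg_integral_exhaustion (f := fun t => G (expR t) * expR t) setT_bigcup_itv.
have cvJ := cvg_integral_exhaustion (f := G) eJ.
rewrite -(cvg_lim _ (cvI _ _ _ _)) //; last first.
- move=> t _; apply: cvgM; last exact: continuous_expR.
  by apply: continuous_comp; [exact: continuous_expR|exact/cG/expR_gt0].
- by move=> t _; rewrite mulr_ge0 ?expR_ge0 ?G0 ?expR_gt0.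
- by move=> n; rewrite ler_nat.
- by move=> n; rewrite lerN2 ler_nat.
rewrite -(cvg_lim _ (cvJ _ _ _ _)) //; last first.
- by move=> t /t0; exact: cG.
- by move=> t /t0; exact: G0.
- by move=> n; rewrite ler_expR ler_nat.
- by move=> n; rewrite ler_expR lerN2 ler_nat.
suff e n : (\int[mu]_(t in J n) (G t)%:E =
    \int[mu]_(t in I n) (G (expR t) * expR t)%:E)%E.
  by congr (limn _); exact/funext.
have dE : derive1 (@expR R) = expR.
  by apply/funext => t; rewrite derive1E; have [_ ->] := is_derive_expR t.
rewrite (@integration_by_substitution_increasing _ expR G); first last.
- apply: continuous_in_subspaceT => t; rewrite inE /= in_itv /= => /andP[h _].
  by apply: cG; apply: lt_le_trans h; exact: expR_gt0.
- split.
  + by move=> t _; exact: derivable_expR.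
  + by apply: cvg_at_right_filter; exact: continuous_expR.
  + by apply: cvg_at_left_filter; exact: continuous_expR.
- rewrite dE; apply/cvg_ex; exists (expR n.+1%:R).
  by apply: cvg_at_left_filter; exact: continuous_expR.
- rewrite dE; apply/cvg_ex; exists (expR (- n.+1%:R)).
  by apply: cvg_at_right_filter; exact: continuous_expR.
- by rewrite dE => t _; exact: continuous_expR.
- by move=> t u _ _; rewrite ltr_expR.
- by rewrite (le_trans (y := 0)) ?oppr_le0.
by apply: eq_integral => t _; rewrite dE.
Qed.

End change_of_variables.

(** * Continuity and integrability of the mixed exponentials *)

Section mixture_representation.
Context {R : realType}.
Let mu := @lebesgue_measure R.

Lemma continuous_expRN : continuous (fun t : R => expR (- t)).
Proof.
by move=> t; apply: continuous_comp; [exact: cvgN cvg_id|exact: continuous_expR].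
Qed.

Lemma continuous_gmix (nu c1 c2 : R) :
  continuous (fun t : R => expR (nu * t - c1 * expR t - c2 * expR (- t))).
Proof.
move=> t; apply: continuous_comp; last exact: continuous_expR.
apply: cvgB; last by apply: cvgM; [exact: cvg_cst|exact: continuous_expRN].
by apply: cvgB; apply: cvgM; (try exact: cvg_cst);
  [exact: cvg_id|exact: continuous_expR].
Qed.

Lemma wintegrable_expN (nu : R) (f : R -> R) : 0 < nu -> continuous f ->
  (forall t, 0 <= f t) -> wintegrable nu (fun t => expR (- f t)).
Proof.
move=> nu0 cf f0; apply: (wintegrable_dom (g := fun t => expR (0 * t))).
- apply: measurableT_comp => //; apply: measurableT_comp => //.
  exact: continuous_measurable_fun.
- by move=> t; rewrite mul0r (ger0_norm (expR_ge0 _)) ler_expR oppr_le0.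
- by apply: wintegrable_exp; rewrite addr0.
Qed.

Lemma wmean1_gt0 (nu : R) : 0 < nu -> 0 < wmean nu (cst 1).
Proof.
move=> nu0; have hi : wintegrable nu (cst 1).
  rewrite /wintegrable; under eq_fun do rewrite /= mul1r.
  exact: integrable_gweight.
have : expR (- expR 1) * (1 - 0) <= wmean nu (cst 1).
  apply: wmean_gt0 => // t /andP[t0 t1]; rewrite mul1r ler_expR.
  have e1 : expR t <= expR 1 by rewrite ler_expR.
  by have := mulr_ge0 (ltW nu0) t0; lra.
by rewrite subr0 mulr1; apply: lt_le_trans; exact: expR_gt0.
Qed.

End mixture_representation.

(** * Differentiation of Laplace transforms and integration by parts *)

Section laplace.
Context {R : realType}.
Let mu := @lebesgue_measure R.

Lemma Rintegral_setT_cvg (G : R -> R) : (forall t, 0 <= G t) -> continuous G ->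
  mu.-integrable setT (EFin \o G) ->
  \int[mu]_(t in `[- (n.+1%:R : R), n.+1%:R]) (G t) @[n --> \oo] -->
    \int[mu]_(t in setT) (G t).
Proof.
move=> G0 cG iG; apply: fine_cvg.
rewrite -/(Rintegral _ _ _) /Rintegral fineK; last exact: (integrable_fin_num _ iG).
apply: cvg_integral_exhaustion => //; first exact: setT_bigcup_itv.
- by move=> n; rewrite lerN2 ler_nat.
- by move=> n; rewrite ler_nat.
- by move=> t _; exact: cG.
Qed.

(** The derivative of [F] is split into two non-negative integrable parts because convergence along
    the exhaustion comes from monotonicity. *)
Lemma Rintegral_derive_vanish (G1 G2 F : R -> R) :
  (forall t, 0 <= G1 t) -> (forall t, 0 <= G2 t) ->
  continuous G1 -> continuous G2 ->
  mu.-integrable setT (EFin \o G1) -> mu.-integrable setT (EFin \o G2) ->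
  (forall t : R, is_derive t 1 F (G1 t - G2 t)) ->
  F (n.+1%:R) - F (- n.+1%:R) @[n --> \oo] --> 0 ->
  \int[mu]_(t in setT) (G1 t) = \int[mu]_(t in setT) (G2 t).
Proof.
move=> p1 p2 c1 c2 i1 i2 dF F0.
have h1 := Rintegral_setT_cvg p1 c1 i1; have h2 := Rintegral_setT_cvg p2 c2 i2.
apply/eqP; rewrite -subr_eq0; apply/eqP.
rewrite -(cvg_lim _ (cvgB h1 h2)) //; apply/cvg_lim => //.
rewrite [X in X @ _ --> _](_ : _ = fun n : nat => F (n.+1%:R) - F (- n.+1%:R)) //.
apply/funext => n /=; rewrite !fctE.
have j1 : mu.-integrable `[- (n.+1%:R : R), n.+1%:R] (EFin \o G1).
  by apply: integrableS i1 => //; exact: measurable_itv.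
have j2 : mu.-integrable `[- (n.+1%:R : R), n.+1%:R] (EFin \o G2).
  by apply: integrableS i2 => //; exact: measurable_itv.
rewrite -RintegralB //.
rewrite /Rintegral (continuous_FTC2 (F := F)) //.
- by rewrite (@lt_trans _ _ 0) // ltr0n.
- apply: continuous_subspaceT => t; exact: cvgB (c1 t) (c2 t).
- split.
  + by move=> t _; have [] := dF t.
  + by apply: cvg_at_right_filter; exact: is_derive_continuous (dF _).
  + by apply: cvg_at_left_filter; exact: is_derive_continuous (dF _).
- by move=> t _; rewrite derive1E; have [_ ->] := dF t.
Qed.

Lemma laplace_derive (psi q : R -> R) : measurable_fun setT psi ->
  measurable_fun setT q -> (forall t, 0 <= psi t) -> (forall t, 0 <= q t) ->
  (forall x, 0 < x -> mu.-integrable setT (EFin \o (fun t => expR (- (x * psi t)) * q t))) ->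
  forall x : R, 0 < x -> is_derive x 1
    (fun x => \int[mu]_(t in setT) (expR (- (x * psi t)) * q t))
    (- \int[mu]_(t in setT) (psi t * expR (- (x * psi t)) * q t)).
Proof.
move=> mpsi mq psi0 q0 hi x x0.
pose f (x t : R) := expR (- (x * psi t)) * q t.
(* Dominates the derivative for all parameters [y > x / 2]: the surplus [(y - x / 4) * psi t] is at
   least [x / 4 * psi t], and its exponential absorbs the factor [psi t]. *)
pose G (t : R) := 4 / x * (expR (- (x / 4 * psi t)) * q t).
have df (y t : R) : is_derive y 1 (f ^~ t) (- (psi t * f y t)).
  have h1 : is_derive y 1 (fun y => expR (0 + - psi t * y)) (expR (0 + - psi t * y) * - psi t).
    exact: (is_derive1_comp (is_derive_expR _) (is_derive_affine _ _ _)).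
  have -> : f ^~ t = q t *: (fun y => expR (0 + - psi t * y)).
    apply/funext => u; rewrite /f /GRing.scale /= mulrC add0r.
    by congr (_ * expR _); ring.
  apply: (is_derive_eq (is_deriveZ (q t) h1)).
  rewrite /GRing.scale /= /f add0r -[in RHS](mulrC (psi t)) mulNr.
  by ring.
have Ix : `]x / 2, 2 * x[%classic x.
  by rewrite /= in_itv /=; apply/andP; split; lra.
have I0 y : `]x / 2, 2 * x[%classic y -> x / 2 < y.
  by rewrite /= in_itv /= => /andP[].
have y0 y : x / 2 < y -> 0 < y by apply: lt_trans; rewrite divr_gt0.
have hif y : `]x / 2, 2 * x[%classic y -> mu.-integrable setT (EFin \o f y).
  by move=> /I0 /y0; exact: hi.
have hdf y t : `]x / 2, 2 * x[%classic y -> [set: R] t -> derivable (f ^~ t) y 1.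
  by move=> _ _; have [] := df y t.
have hG t : 0 <= G t.
  by rewrite /G !mulr_ge0 ?expR_ge0 ?invr_ge0 ?(ltW x0).
have hiG : mu.-integrable setT (EFin \o G).
  have x4 : 0 < x / 4 by rewrite divr_gt0.
  have := integrableZl (measurableT : measurable setT) (4 / x) (hi _ x4).
  by apply: eq_integrable => // t _ /=; rewrite -EFinM.
have hub y t : `]x / 2, 2 * x[%classic y -> [set: R] t ->
    `|partial1of2 f y t| <= G t.
  move=> /I0 hy _; rewrite partial1of2E; have [_ ->] := df y t.
  have p0 : 0 <= psi t * f y t by rewrite /f !mulr_ge0 ?expR_ge0.
  rewrite normrN (ger0_norm p0) /f /G !mulrA ler_wpM2r //.
  have -> : expR (- (y * psi t)) = expR (- (y * psi t - x / 4 * psi t)) *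
      expR (- (x / 4 * psi t)).
    by rewrite -expRD; congr expR; ring.
  rewrite mulrA ler_wpM2r ?expR_ge0 //.
  rewrite expRN ler_pdivrMr ?expR_gt0 //.
  have h1 := expR_ge1Dx (y * psi t - x / 4 * psi t).
  have h2 : x / 4 * psi t <= y * psi t - x / 4 * psi t.
    by rewrite -mulrBl ler_wpM2r //; lra.
  have h3 : psi t = 4 / x * (x / 4 * psi t) by field; rewrite gt_eqF.
  rewrite [leLHS]h3 ler_wpM2l ?divr_ge0 ?(ltW x0) //.
  by rewrite (le_trans h2) // (le_trans _ h1) // lerDr.
have D := @derivable_under_integral R _ _ mu f setT measurableT x _ _ Ix hif hdf
  G hG hiG hub.
apply: DeriveDef; first exact: D.
rewrite -derive1E (@differentiation_under_integral R _ _ mu f setT measurableT x _ _ Ix hif hdf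
  G hG hiG hub).
under eq_Rintegral do rewrite partial1of2E.
rewrite -mulN1r -RintegralZl //.
  apply: eq_Rintegral => t _; have [_ ->] := df x t.
  by rewrite mulN1r /f mulrA.
apply: (le_integrable _ _ _ hiG) => //.
  apply/measurable_EFinP; apply: measurable_funM => //; apply: measurable_funM => //.
  by apply: measurableT_comp => //; apply: measurableT_comp => //; exact: measurable_funM.
move=> t _ /=; rewrite lee_fin.
have := hub x t Ix I; rewrite partial1of2E; have [_ ->] := df x t.
rewrite normrN /f mulrA => h; apply: le_trans h _; exact: ler_norm.
Qed.

(* Integrating the derivative of [s^nu exp(- s - z / s)] in [t = ln s]. *)
Lemma wmean_by_parts (nu z : R) : 0 < nu -> 0 <= z ->
  wmean nu (fun t => z * expR (- t) * expR (- (z * expR (- t)))) =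
  wmean nu (fun t => (expR t - nu) * expR (- (z * expR (- t)))).
Proof.
move=> nu0 z0.
pose F (t : R) := expR (nu * t - 1 * expR t - z * expR (- t)).
have F0 t : 0 <= F t by exact: expR_ge0.
have FE t : expR (- (z * expR (- t))) * gweight nu t = F t.
  by rewrite /F /gweight -expRD mul1r addrC.
have E1 t : expR (- (z * expR (- t))) <= 1.
  by rewrite -expR0 ler_expR oppr_le0 mulr_ge0 // expR_ge0.
have cF : continuous F by exact: continuous_gmix.
have cz : continuous (fun t => z * expR (- t)).
  by move=> t; apply: cvgM; [exact: cvg_cst|exact: continuous_expRN].
have mz := continuous_measurable_fun cz.
have mE : measurable_fun setT (fun t : R => expR (- (z * expR (- t)))).
  by apply: measurableT_comp => //; exact: measurableT_comp.
have i0 : wintegrable nu (fun t => expR (- (z * expR (- t)))).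
  by apply: wintegrable_expN => // t; rewrite mulr_ge0 ?expR_ge0.
have i1 : wintegrable nu (fun t => z * expR (- t) * expR (- (z * expR (- t)))).
  apply: (wintegrable_dom (g := fun t => expR (0 * t))) => //.
  - exact: measurable_funM.
  - move=> t; rewrite mul0r expR0 ger0_norm ?mulx_expRN_le1 //.
    by rewrite !mulr_ge0 ?expR_ge0.
  - by apply: wintegrable_exp; rewrite addr0.
have i2 : wintegrable nu (fun t => expR t * expR (- (z * expR (- t)))).
  apply: (wintegrable_dom (g := fun t => expR (1 * t))) => //.
  - exact: measurable_funM.
  - move=> t; rewrite mul1r ger0_norm ?mulr_ge0 ?expR_ge0 //.
    by rewrite ler_piMr ?expR_ge0.
  - by apply: wintegrable_exp; rewrite addr_gt0.
(* The term in [nu] is moved to the left, since [expR t - nu] changes sign and both integrands must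
   be non-negative. *)
have key : wmean nu (fun t => nu * expR (- (z * expR (- t))) +
      z * expR (- t) * expR (- (z * expR (- t)))) =
    wmean nu (fun t => expR t * expR (- (z * expR (- t)))).
  apply: (Rintegral_derive_vanish (F := F)).
  - by move=> t; rewrite -mulrDl !mulr_ge0 ?expR_ge0 ?addr_ge0 ?mulr_ge0 ?expR_ge0 ?(ltW nu0) // ltW // gweight_gt0.
  - by move=> t; rewrite !mulr_ge0 ?expR_ge0.
  - rewrite (_ : (fun t => _) = fun t => (nu + z * expR (- t)) * F t); last first.
      by apply/funext => t; rewrite -FE; ring.
    move=> t; apply: cvgM; last exact: cF.
    by apply: cvgD; [exact: cvg_cst|exact: cz].
  - rewrite (_ : (fun t => _) = fun t => expR t * F t); last first.
      by apply/funext => t; rewrite -FE; ring.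
    by move=> t; apply: cvgM; [exact: continuous_expR|exact: cF].
  - exact: (wintegrableD (wintegrableZ nu i0) i1).
  - exact: i2.
  - move=> t.
    have d1 : is_derive t 1 (fun t => expR (0 + -1 * t)) (expR (0 + -1 * t) * -1).
      exact: (is_derive1_comp (is_derive_expR _) (is_derive_affine _ _ _)).
    have d2 : is_derive t 1 (fun t => nu * t - 1 * expR t - z * expR (- t))
        (nu - expR t + z * expR (- t)).
      have -> : (fun t => nu * t - 1 * expR t - z * expR (- t)) =
          ((fun t => 0 + nu * t) - 1 *: @expR R) - z *: (fun t => expR (0 + -1 * t)).
        by apply/funext => u; rewrite !fctE /GRing.scale /= !add0r mulN1r.
      apply: (is_derive_eq (is_deriveB (is_deriveB (is_derive_affine nu 0 t)
        (is_deriveZ 1 (is_derive_expR t))) (is_deriveZ z d1))).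
      by rewrite /GRing.scale /= add0r mul1r mulN1r mulrN1 mulrN opprK.
    apply: (is_derive_eq (is_derive1_comp (is_derive_expR _) d2)).
    rewrite -/(F t) -(FE t); clear.
    by move: (expR (- (z * expR (- t)))) (expR t) (expR (- t)) => u v w; ring.
  (* Boundary terms: the logistic bound decays exponentially on both sides, hence at least like
     [1 / n]. *)
  have [C C0 hC] := gweight_le nu0.
  have FC t : F t <= C * (nu * expR (nu * t) / (1 + expR (nu * t)) ^+ 2).
    by apply: le_trans (hC t); rewrite -FE ler_piMl // ltW // gweight_gt0.
  have hn (n : nat) : expR (- (nu * n.+1%:R)) <= (nu * n.+1%:R)^-1.
    rewrite expRN lef_pV2 ?posrE ?expR_gt0 ?mulr_gt0 //.
    by apply: le_trans (expR_ge1Dx _); rewrite lerDr.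
  have Fp (n : nat) : F n.+1%:R <= C * n.+1%:R^-1.
    apply: le_trans (FC _) _; rewrite ler_pM2l // -mulrA -ler_pdivlMl //.
    rewrite -invfM; apply: le_trans (hn n); rewrite expRN.
    rewrite ler_pdivrMr ?exprn_gt0 ?addr_gt0 ?expR_gt0 // ler_pdivlMl ?expR_gt0 //.
    by have := expR_ge0 (nu * n.+1%:R); nra.
  have Fn (n : nat) : F (- n.+1%:R) <= C * n.+1%:R^-1.
    apply: le_trans (FC _) _; rewrite ler_pM2l // -mulrA -ler_pdivlMl //.
    rewrite -invfM mulrN; apply: le_trans (hn n).
    rewrite ler_pdivrMr ?exprn_gt0 ?addr_gt0 ?expR_gt0 //.
    by have := expR_gt0 (- (nu * n.+1%:R)); nra.
  apply: norm_cvg0; apply: (@squeeze_cvgr _ _ _ _ (cst 0) (fun n => C * harmonic n)).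
  - apply/nearW => n; rewrite /= normr_ge0 /= ler_norml /harmonic.
    have := Fn n; have := Fp n; have := F0 n.+1%:R; have := F0 (- n.+1%:R).
    move: (F _) (F _) (C / _) => u v w *.
    by apply/andP; split; lra.
  - exact: cvg_cst.
  - by rewrite -[X in _ --> X](mulr0 C); apply: cvgM; [exact: cvg_cst|exact: cvg_harmonic].
have eq1 : (fun t => (expR t - nu) * expR (- (z * expR (- t)))) =
  (fun t => expR t * expR (- (z * expR (- t))) + (- nu) * expR (- (z * expR (- t)))).
  by apply/funext => t; ring.
rewrite eq1 wmeanD //; last exact: wintegrableZ.
rewrite -key wmeanD //; last exact: wintegrableZ.
by rewrite !wmeanZ //; ring.
Qed.

End laplace.

(** * The three kernels as scale mixtures of Gaussians *)

Section mixtures.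
Context {R : realType}.
Let mu := @lebesgue_measure R.

Lemma continuous_powR_gt0 (a t : R) : 0 < t -> {for t, continuous (fun t => t `^ a)}.
Proof. by move=> t0; exact: is_derive_continuous (is_derive1_powR a t0). Qed.

Lemma Gamma_gweight (nu : R) : Gamma nu = wmean nu (cst 1).
Proof.
rewrite /Gamma /wmean /Rintegral integral0y_expR.
- congr fine; apply: eq_integral => t _; congr (_%:E).
  rewrite mul1r /powR gt_eqF ?expR_gt0 // expRK -!expRD /gweight; congr expR.
  by ring.
- by move=> t t0; apply: cvgM; [exact: continuous_powR_gt0|exact: continuous_expRN].
- by move=> t t0; rewrite mulr_ge0 ?powR_ge0 ?expR_ge0.
Qed.

(** The Laplace transform of the Gamma law at [tau ^+ 2]: in the logarithmic variable, rescaling by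
    [c = 1 + tau ^+ 2] is a translation by [- ln c], which brings out [c] to the power [- nu]. *)
Lemma rational_quadratic_mix (nu tau : R) : 0 < nu ->
  rational_quadratic nu tau =
  (wmean nu (cst 1))^-1 * wmean nu (fun t => expR (- (tau ^+ 2 * expR (1 * t + 0)))).
Proof.
move=> nu0; have Z0 := wmean1_gt0 nu0.
set c := 1 + tau ^+ 2.
have c0 : 0 < c by rewrite /c ltr_pwDl // sqr_ge0.
suff e : wmean nu (fun t => expR (- (tau ^+ 2 * expR (1 * t + 0)))) =
    c `^ (- nu) * wmean nu (cst 1).
  by rewrite /rational_quadratic -/c e mulrCA mulVf ?mulr1 ?gt_eqF.
rewrite /wmean.
transitivity (\int[mu]_(t in setT) (expR (nu * t - c * expR t - 0 * expR (- t)))).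
  apply: eq_Rintegral => t _; rewrite /gweight -expRD mul1r addr0 /c.
  by congr expR; ring.
rewrite (RintegralT_shift (- ln c) (@continuous_gmix _ _ _ _)); last by move=> t; exact: expR_ge0.
rewrite -RintegralZl //; last first.
  have := integrable_gweight nu0; apply: eq_integrable => // t _ /=.
  by rewrite mul1r.
apply: eq_Rintegral => t _; rewrite mul1r /powR gt_eqF // /gweight -expRD.
congr expR; rewrite expRD expRN lnK ?posrE //.
by field; rewrite gt_eqF.
Qed.

(** With slope 0 the mixing variable is the constant 1, so the shape of the Gamma weight may be any
    positive number. *)
Lemma squared_exponential_mix (nu tau : R) : 0 < nu ->
  squared_exponential tau =
  (wmean nu (cst 1))^-1 * wmean nu (fun t => expR (- (tau ^+ 2 * expR (0 * t + 0)))).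
Proof.
move=> nu0; have Z0 := wmean1_gt0 nu0.
have -> : (fun t : R => expR (- (tau ^+ 2 * expR (0 * t + 0)))) =
    fun t => squared_exponential tau * cst 1 t.
  by apply/funext => t; rewrite mul0r addr0 expR0 !mulr1.
have i1 : wintegrable nu (cst 1).
  have := integrable_gweight nu0; apply: eq_integrable => // t _ /=.
  by rewrite mul1r.
by rewrite wmeanZ // mulrCA mulVf ?mulr1 // gt_eqF.
Qed.

Lemma integral0y_reflect (f : R -> R) : continuous f -> (forall t, 0 <= f t) ->
  (\int[mu]_(t in `]0%R, +oo[) (f t + f (- t))%:E = \int[mu]_t (f t)%:E)%E.
Proof.
move=> cf f0.
have mf : measurable_fun setT (EFin \o f).
  by apply/measurable_EFinP; exact: continuous_measurable_fun.
have mfN : measurable_fun setT (EFin \o (f \o -%R)).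
  apply/measurable_EFinP; apply: continuous_measurable_fun => t.
  by apply: continuous_comp; [exact: cvgN cvg_id|exact: cf].
have f0E (t : R) : (0 <= (EFin \o f) t)%E by rewrite /= lee_fin f0.
have fN0 (t : R) : (0 <= (EFin \o (f \o -%R)) t)%E by rewrite /= lee_fin f0.
under eq_integral => t _ do rewrite EFinD.
have mI : measurable (`]0%R, +oo[ : set (measurableTypeR R)) by [].
rewrite (ge0_integralD mu mI (fun t _ => f0E t) (measurable_funTS mf)
  (fun t _ => fN0 t) (measurable_funTS mfN)).
rewrite (integral_itv_obnd_cbnd (measurable_funTS mfN)).
rewrite (ge0_integration_by_substitution0 mfN fN0).
rewrite [X in (_ + X)%E](_ : _ = \int[mu]_(t in `]-oo, 0%R]) (f t)%:E)%E; last first.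
  by apply: eq_integral => t _ /=; rewrite opprK.
have eU : `]-oo, 0%R] `|` `]0%R, +oo[ = [set: R].
  by rewrite -itv_bndbnd_setU // set_itvNyy.
rewrite addeC -ge0_integral_setU //.
- by congr (integral _ _ _).
- by rewrite eU.
- by move=> t _; rewrite lee_fin f0.
- apply/disj_setPS => t [] /=; rewrite !in_itv /= andbT => h1 h2.
  by have := lt_le_trans h2 h1; rewrite ltxx.
Qed.

(** The product of the exponential and [cosh (nu * t)] is [g t + g (- t)], so the half-line integral
    unfolds to the whole line. Translating by [ln (2 / z)] then turns [- z * cosh t] into
    [- expR t - z ^+ 2 / 4 * expR (- t)], in which the Gamma weight appears. *)
Lemma besselK_mix (nu z : R) : 0 < nu -> 0 < z ->
  besselK nu z = 2^-1 * (2 / z) `^ nu *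
    wmean nu (fun t => expR (- (z ^+ 2 / 4 * expR (- t)))).
Proof.
move=> nu0 z0; have z2 : 0 <= z ^+ 2 / 4 by rewrite divr_ge0 // sqr_ge0.
have hi : wintegrable nu (fun t => expR (- (z ^+ 2 / 4 * expR (- t)))).
  apply: wintegrable_expN => // [t|t]; last by rewrite mulr_ge0 ?expR_ge0.
  by apply: cvgM; [exact: cvg_cst|exact: continuous_expRN].
pose f (t : R) := expR (nu * t - z / 2 * expR t - z / 2 * expR (- t)).
have f0 t : 0 <= f t by exact: expR_ge0.
have cf : continuous f by exact: continuous_gmix.
pose g (t : R) := 2^-1 * f t.
have g0 t : 0 <= g t by rewrite mulr_ge0.
have cg : continuous g by move=> t; apply: cvgM; [exact: cvg_cst|exact: cf].
rewrite /besselK /Rintegral.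
rewrite [X in fine X](_ : _ = \int[mu]_(t in `]0%R, +oo[) (g t + g (- t))%:E)%E; last first.
  apply: eq_integral => t _; congr (_%:E).
  rewrite /cosh /g /f mulrA mulrC -mulrDr; congr (_ * _).
  rewrite mulrDr -!expRD opprK.
  by congr (expR _ + expR _); field.
rewrite (integral0y_reflect cg g0) (integralT_shift (ln (2 / z)) cg g0).
rewrite -[LHS]/(Rintegral mu setT (fun t => g (t + ln (2 / z)))) -RintegralZl //.
have h0 : 0 < 2 / z by rewrite divr_gt0.
apply: eq_Rintegral => t _; rewrite /g /f -[RHS]mulrA; congr (_ * _).
have e1 : expR (t + ln (2 / z)) = expR t * (2 / z) by rewrite expRD lnK.
have e2 : expR (- (t + ln (2 / z))) = expR (- t) * (z / 2).
  by rewrite opprD expRD [expR (- ln _)]expRN lnK // invf_div.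
rewrite e1 e2 /powR gt_eqF // /gweight -!expRD; congr expR.
by field; rewrite gt_eqF.
Qed.

(** With [z = 2 * Num.sqrt nu * tau] one has [z ^+ 2 / 4 = nu * tau ^+ 2], whence the offset [ln nu]
    in the rate. *)
Lemma matern_mix (nu tau : R) : 0 < nu -> 0 <= tau ->
  matern nu tau =
  (wmean nu (cst 1))^-1 * wmean nu (fun t => expR (- (tau ^+ 2 * expR (- 1 * t + ln nu)))).
Proof.
move=> nu0; have Z0 := wmean1_gt0 nu0.
rewrite le_eqVlt /matern => /predU1P[<-|tau0].
  rewrite eqxx; have -> : (fun t : R => expR (- (0 ^+ 2 * expR (- 1 * t + ln nu)))) = cst 1.
    by apply/funext => t; rewrite expr0n mul0r oppr0 expR0.
  by rewrite mulVf // gt_eqF.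
rewrite gt_eqF //; set z := 2 * Num.sqrt nu * tau.
have s0 : 0 < Num.sqrt nu by rewrite sqrtr_gt0.
have z0 : 0 < z by rewrite !mulr_gt0.
have eM : wmean nu (fun t => expR (- (tau ^+ 2 * expR (- 1 * t + ln nu)))) =
    wmean nu (fun t => expR (- (z ^+ 2 / 4 * expR (- t)))).
  apply: eq_Rintegral => t _; congr (expR (- _) * _).
  rewrite mulN1r expRD lnK ?posrE // /z !exprMn sqr_sqrtr ?(ltW nu0) //.
  by field.
rewrite eM; clear eM; clearbody z.
rewrite Gamma_gweight (besselK_mix nu0 z0).
set v := wmean nu (fun t => expR (- (z ^+ 2 / 4 * expR (- t)))).
move: Z0; generalize (wmean nu (cst 1)) => Z Z0; clearbody v.
have e1 : (2 / z) `^ nu * z `^ nu = 2 `^ nu.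
  by rewrite -powRM ?divfK ?gt_eqF ?divr_ge0 ?(ltW z0).
have e2 : 2 `^ (1 - nu) * 2 `^ nu = 2 :> R.
  by rewrite -powRD_gt0 // subrK powRr1.
transitivity (Z^-1 * (2 `^ (1 - nu) * ((2 / z) `^ nu * z `^ nu)) * 2^-1 * v).
  by ring.
by rewrite e1 e2; field; rewrite gt_eqF.
Qed.

End mixtures.

(** * Truncated moments of the mixing variable *)

Section truncated_moments.
Context {R : realType}.
Let mu := @lebesgue_measure R.
Implicit Types (nu sg b p rho q : R) (k : nat).

(* The scale of the Gaussian mixture, for a Gamma variable [exp t]: [sg] is 1 for
   Rational Quadratic, 0 for Squared Exponential and -1 for Matern kernels. *)
Definition mixrate sg b (t : R) : R := expR (sg * t + b).

Lemma mixrate_gt0 sg b t : 0 < mixrate sg b t. Proof. exact: expR_gt0. Qed.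

Lemma mulr_mixrate_ge0 sg b rho t : 0 <= rho -> 0 <= rho * mixrate sg b t.
Proof. by move=> r0; rewrite mulr_ge0 // expR_ge0. Qed.

Lemma measurable_mixrate sg b : measurable_fun setT (mixrate sg b).
Proof. exact: measurable_explin. Qed.

(** For [p = 0] this is h_k(rho) up to the total mass. The value [p = 1] adds the Gamma variable as
    a weight, as produced by the integration by parts for Matern kernels. *)
Definition tmom nu sg b p k rho : R :=
  wmean nu (fun t => expR (p * t) * Num.min 1 (rho * mixrate sg b t) ^+ k).

Lemma wintegrable_le_exp nu p (C : R) (f : R -> R) : measurable_fun setT f ->
  0 < nu + p -> (forall t, `|f t| <= C * expR (p * t)) -> wintegrable nu f.
Proof.
move=> mf np hf; apply: (wintegrable_dom mf hf); apply: wintegrableZ.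
exact: wintegrable_exp.
Qed.

Lemma measurable_min_mixrate sg b rho k :
  measurable_fun setT (fun t => Num.min 1 (rho * mixrate sg b t) ^+ k).
Proof.
apply: measurable_funX; apply: measurable_minr => //.
by apply: measurable_funM => //; exact: measurable_mixrate.
Qed.

Lemma min1_ge0 (a : R) : 0 <= a -> 0 <= Num.min 1 a.
Proof. by move=> a0; rewrite le_min ler01. Qed.

Lemma min1X_ge0 (a : R) k : 0 <= a -> 0 <= Num.min 1 a ^+ k.
Proof. by move=> a0; rewrite exprn_ge0 // min1_ge0. Qed.

Lemma min1X_le1 (a : R) k : 0 <= a -> Num.min 1 a ^+ k <= 1.
Proof. by move=> a0; rewrite exprn_ile1 ?min1_ge0 // ge_min lexx. Qed.

Lemma tmom_integrable nu sg b p k rho : 0 < nu + p -> 0 <= rho ->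
  wintegrable nu (fun t => expR (p * t) * Num.min 1 (rho * mixrate sg b t) ^+ k).
Proof.
move=> np r0; have a0 t := mulr_mixrate_ge0 sg b t r0.
apply: (wintegrable_le_exp (C := 1) (p := p)) => //.
  apply: measurable_funM; last exact: measurable_min_mixrate.
  by apply: measurableT_comp => //; exact: measurable_funM.
move=> t; rewrite mul1r normrM (ger0_norm (expR_ge0 _)).
by rewrite (ger0_norm (min1X_ge0 _ _)) // ler_piMr ?expR_ge0 // min1X_le1.
Qed.

Lemma tmom_ge0 nu sg b p k rho : 0 <= rho -> 0 <= tmom nu sg b p k rho.
Proof.
move=> r0; apply: wmean_ge0 => t; rewrite mulr_ge0 ?expR_ge0 // min1X_ge0 //.
exact: mulr_mixrate_ge0.
Qed.

Lemma tmom_le_deg nu sg b p k l rho : 0 < nu + p -> 0 <= rho -> (k <= l)%N ->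
  tmom nu sg b p l rho <= tmom nu sg b p k rho.
Proof.
move=> np r0 kl; apply: wmean_le; [exact: tmom_integrable|exact: tmom_integrable|].
move=> t; rewrite ler_wpM2l ?expR_ge0 // ler_min1_exp //.
exact: mulr_mixrate_ge0.
Qed.

Lemma tmom_le nu sg b p k rho1 rho2 : 0 < nu + p -> 0 <= rho1 -> rho1 <= rho2 ->
  tmom nu sg b p k rho1 <= tmom nu sg b p k rho2.
Proof.
move=> np r0 r12; have r2 : 0 <= rho2 := le_trans r0 r12.
apply: wmean_le; [exact: tmom_integrable|exact: tmom_integrable|].
move=> t; rewrite ler_wpM2l ?expR_ge0 //.
apply: lerXn2r; rewrite ?nnegrE ?min1_ge0 ?mulr_mixrate_ge0 //.
by rewrite le_min !ge_min lexx /= ler_wpM2r ?orbT // ltW // mixrate_gt0.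
Qed.

Lemma tmom_gt0 nu sg b p k rho : 0 < nu -> 0 <= p -> 0 < rho ->
  0 < tmom nu sg b p k rho.
Proof.
(* A lower bound for [mixrate sg b] on the interval from 0 to 1, to which the mean is restricted. *)
move=> nu0 p0 r0; pose c := expR (- (`|sg| + `|b|)).
have c0 : 0 < c by exact: expR_gt0.
pose d := Num.min 1 (rho * c) ^+ k * expR (- expR 1).
have d0 : 0 < d by rewrite mulr_gt0 ?expR_gt0 // exprn_gt0 // lt_min ltr01 mulr_gt0.
suff : d * (1 - 0) <= tmom nu sg b p k rho.
  by rewrite subr0 mulr1; apply: lt_le_trans.
apply: wmean_gt0 => //.
- by apply: tmom_integrable; [rewrite ltr_wpDr|exact: ltW].
- by move=> t; rewrite mulr_ge0 ?expR_ge0 // min1X_ge0 // mulr_mixrate_ge0 // ltW.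
- move=> t /andP[t0 t1]; rewrite /d -mulrA.
  have m0 : 0 <= Num.min 1 (rho * mixrate sg b t) ^+ k * gweight nu t.
    by rewrite mulr_ge0 ?expR_ge0 // min1X_ge0 // mulr_mixrate_ge0 // ltW.
  have p1 : 1 <= expR (p * t) by rewrite -expR0 ler_expR mulr_ge0.
  apply: le_trans (ler_peMl m0 p1).
  have e1 : expR t <= expR 1 by rewrite ler_expR.
  apply: ler_pM.
  + by rewrite exprn_ge0 // min1_ge0 // mulr_ge0 // ltW.
  + exact: expR_ge0.
  + apply: lerXn2r; rewrite ?nnegrE ?min1_ge0 ?mulr_ge0 ?(ltW r0) ?(ltW c0) //.
      by rewrite ltW // mixrate_gt0.
    rewrite le_min !ge_min lexx /= ler_wpM2l ?orbT ?(ltW r0) // /c ler_expR.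
    have h1 := ler_norm (- sg); have h2 := ler_norm (- b).
    have h3 := ler_norm sg; have h4 := normr_ge0 sg.
    by move: h1 h2; rewrite !normrN => h1 h2; nra.
  + by rewrite /gweight ler_expR; have := mulr_ge0 (ltW nu0) t0; lra.
Qed.

Lemma mulr_mixrate_powR sg b rho q t : 0 < rho ->
  (rho * mixrate sg b t) `^ q = rho `^ q * expR (q * b) * expR (sg * q * t).
Proof.
move=> r0; rewrite powRM ?(ltW r0) ?(ltW (mixrate_gt0 _ _ _)) // -mulrA; congr (_ * _).
rewrite /mixrate -expRD /powR gt_eqF ?expR_gt0 // expRK; congr expR; ring.
Qed.

Lemma min1X_le_powR (a q : R) k : 0 < a -> 0 <= q <= k%:R ->
  Num.min 1 a ^+ k <= a `^ q.
Proof.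
move=> a0 /andP[q0 qk]; have [a1|/ltW a1] := leP a 1.
  by rewrite -powR_mulrn ?(ltW a0) // (ger_powR _ qk) // a0 a1.
have := @ler_powR R a a1 0 q q0; rewrite powRr0.
by rewrite expr1n.
Qed.

Lemma wmean_powR_mixrate nu sg b p q : 0 < nu + (p + sg * q) ->
  exists2 C : R, 0 <= C & forall rho, 0 < rho ->
    wintegrable nu (fun t => expR (p * t) * (rho * mixrate sg b t) `^ q) /\
    wmean nu (fun t => expR (p * t) * (rho * mixrate sg b t) `^ q) = C * rho `^ q.
Proof.
move=> h; exists (expR (q * b) * wmean nu (fun t => expR ((p + sg * q) * t))).
  by rewrite mulr_ge0 ?expR_ge0 // wmean_ge0 // => t; exact: expR_ge0.
move=> rho r0.
have -> : (fun t => expR (p * t) * (rho * mixrate sg b t) `^ q) =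
    fun t => rho `^ q * expR (q * b) * expR ((p + sg * q) * t).
  apply/funext => t; rewrite mulr_mixrate_powR // mulrCA; congr (_ * _).
  by rewrite -expRD; congr expR; ring.
split; first by apply: wintegrableZ; exact: wintegrable_exp.
by rewrite wmeanZ; [ring|exact: wintegrable_exp].
Qed.

(** A truncated [k]-th power is at most any power of exponent [q] between 0 and [k]; [q] only has to
    be small enough for the untruncated moment to be finite, which is the last positivity
    condition. *)
Lemma tmom_le_powR nu sg b p k q : 0 < nu + p -> 0 <= q <= k%:R ->
  0 < nu + (p + sg * q) ->
  exists2 C : R, 0 <= C & forall rho, 0 < rho -> tmom nu sg b p k rho <= C * rho `^ q.
Proof.
move=> np qk h; have [C C0 hC] := wmean_powR_mixrate b h.
exists C => // rho r0; have [i1 <-] := hC rho r0.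
apply: wmean_le => //; first by apply: tmom_integrable => //; exact: ltW.
move=> t; rewrite ler_wpM2l ?expR_ge0 // min1X_le_powR //.
by rewrite mulr_gt0 // mixrate_gt0.
Qed.

(** For [rho <= 1], [min(1, rho T) >= rho min(1, T)]. *)
Lemma tmom_ge_exp nu sg b k rho : 0 < nu -> 0 < rho <= 1 ->
  tmom nu sg b 0 k 1 * rho ^+ k <= tmom nu sg b 0 k rho.
Proof.
move=> nu0 /andP[r0 r1]; have np : 0 < nu + 0 by rewrite addr0.
rewrite mulrC -wmeanZ; last exact: tmom_integrable.
apply: wmean_le; last first.
- move=> t; rewrite mulrCA ler_wpM2l ?expR_ge0 // -exprMn.
  have m0 := mixrate_gt0 sg b t.
  apply: lerXn2r; rewrite ?nnegrE ?mulr_ge0 ?min1_ge0 ?mulr_ge0 ?(ltW r0) ?(ltW m0) //.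
  rewrite mul1r le_min; apply/andP; split.
    rewrite (le_trans _ r1) // ler_piMr ?(ltW r0) // ge_min lexx.
    done.
  by rewrite ler_pM2l // ge_min lexx orbT.
- by apply: tmom_integrable => //; exact: ltW.
- by apply: wintegrableZ; exact: tmom_integrable.
Qed.

Lemma le_addr_sqr (x y z : R) : 0 <= y -> 0 <= z -> x ^+ 2 <= y * z ->
  2 * x <= y + z.
Proof.
move=> y0 z0 h; have [x0|/ltW x0] := leP x 0.
  by apply: (@le_trans _ _ 0); [lra|exact: addr_ge0].
rewrite -(@ler_pXn2r _ 2) ?nnegrE ?addr_ge0 ?mulr_ge0 //.
by have := sqr_ge0 (y - z); rewrite exprMn; nra.
Qed.

Lemma le_sqrtM (x A B : R) : 0 < A -> 0 <= B ->
  (forall s, 0 < s -> 2 * x <= s * A + s^-1 * B) -> x <= Num.sqrt (A * B).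
Proof.
move=> A0; rewrite le_eqVlt => /predU1P[<- h|B0 h].
  rewrite mulr0 sqrtr0 leNgt; apply/negP => x0.
  have := h (x / A) (divr_gt0 x0 A0); rewrite mulr0 addr0 divfK ?gt_eqF //.
  by lra.
have sA : 0 < Num.sqrt A by rewrite sqrtr_gt0.
have sB : 0 < Num.sqrt B by rewrite sqrtr_gt0.
have := h (Num.sqrt B / Num.sqrt A) (divr_gt0 sB sA).
rewrite sqrtrM ?(ltW A0) // invf_div.
rewrite -[X in _ * X + _](sqr_sqrtr (ltW A0)) -[X in _ + _ * X](sqr_sqrtr (ltW B0)).
move: (Num.sqrt A) (Num.sqrt B) sA sB => u v u0 v0.
have -> : v / u * u ^+ 2 + u / v * v ^+ 2 = 2 * (u * v).
  by field; rewrite !gt_eqF.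
by rewrite ler_pM2l.
Qed.

(* Cauchy-Schwarz, through the weighted arithmetic-geometric inequality. *)
Lemma tmom_uphalf nu sg b p k l rho : 0 < nu + p -> 0 <= rho ->
  0 < tmom nu sg b p k rho ->
  tmom nu sg b p (uphalf (k + l)) rho <=
  Num.sqrt (tmom nu sg b p k rho * tmom nu sg b p l rho).
Proof.
move=> np r0 k0; apply: le_sqrtM => //; first exact: tmom_ge0.
move=> s s0.
have ik (q : nat) := tmom_integrable sg b q np r0.
rewrite /tmom -!wmeanZ // -wmeanD; try exact: wintegrableZ.
apply: wmean_le; [exact: wintegrableZ|apply: wintegrableD; exact: wintegrableZ|].
move=> t; have a0 := mulr_mixrate_ge0 sg b t r0.
rewrite !(mulrCA _ (expR (p * t))) -mulrDr ler_wpM2l ?expR_ge0 //.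
set v := Num.min 1 _.
have v0 : 0 <= v by exact: min1_ge0.
have v1 : v <= 1 by rewrite ge_min lexx.
have x2 : (v ^+ uphalf (k + l)) ^+ 2 <= (s * v ^+ k) * (s^-1 * v ^+ l).
  rewrite mulrACA divff ?gt_eqF // mul1r -exprD -exprM.
  by apply: ler_wiXn2l => //; rewrite muln2 -leq_uphalf_double.
have y0 : 0 <= s * v ^+ k by rewrite mulr_ge0 ?exprn_ge0 ?(ltW s0).
have z0 : 0 <= s^-1 * v ^+ l by rewrite mulr_ge0 ?exprn_ge0 ?invr_ge0 ?(ltW s0).
exact: le_addr_sqr.
Qed.

End truncated_moments.

(** * Sharp orders of the truncated moments for Matern kernels *)

Section matern_moments.
Context {R : realType}.
Let mu := @lebesgue_measure R.
Context (nu : R) (nu1 : 1 <= nu).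
Implicit Types (rho : R) (k : nat).

Let nu0 : 0 < nu. Proof. exact: lt_le_trans nu1. Qed.

Lemma mulr_mixrateN rho t : 0 < rho ->
  rho * mixrate (-1) (ln nu) t = nu * expR (ln rho - t).
Proof.
by move=> r0; rewrite /mixrate mulN1r !expRD !lnK //; ring.
Qed.

Lemma powR_expR_ln rho q : 0 < rho -> rho `^ q = expR (q * ln rho).
Proof. by move=> r0; rewrite /powR gt_eqF. Qed.

(** Where the Gamma variable [expR t] is at most [rho] the truncated power equals 1, and the unit
    interval of [t] below [ln rho] already has mass of order [rho] to the power [nu]. *)
Lemma matern_tmom_ge k : exists2 c : R, 0 < c & forall rho, 0 < rho <= 1 ->
  c * rho `^ nu <= tmom nu (-1) (ln nu) 0 k rho.
Proof.
exists (expR (- nu - 1)); first exact: expR_gt0.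
move=> rho /andP[r0 r1]; have l0 : ln rho <= 0 by exact: ln_le0.
rewrite powR_expR_ln // -expRD.
have -> : expR (- nu - 1 + nu * ln rho) =
    expR (- nu - 1 + nu * ln rho) * (ln rho - (ln rho - 1)) by ring.
apply: wmean_gt0.
- by lra.
- exact: expR_gt0.
- by apply: tmom_integrable; rewrite ?addr0 // ltW.
- by move=> t; rewrite mulr_ge0 ?expR_ge0 // min1X_ge0 // mulr_mixrate_ge0 // ltW.
- move=> t /andP[t1 t2]; rewrite mulr_mixrateN // mul0r expR0 mul1r.
  have a1 : 1 <= nu * expR (ln rho - t).
    by rewrite mulr_ege1 // -expR0 ler_expR subr_ge0.
  rewrite (min_idPl a1) expr1n mul1r ler_expR.
  have e1 : expR t <= 1 by rewrite -expR0 ler_expR; lra.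
  have : nu * (ln rho - 1) <= nu * t by rewrite ler_pM2l.
  by lra.
Qed.

(** When [nu = k], the decay of the power in [t] balances the growth of the weight exactly: the
    integrand stays of order [rho] to the power [nu] from [ln rho - 1] to 0, and the logarithm is
    the length of that interval. *)
Lemma matern_tmom_ge_ln k : nu = k%:R -> exists2 c : R, 0 < c &
  forall rho, 0 < rho <= 1 ->
  c * (rho `^ nu * (1 - ln rho)) <= tmom nu (-1) (ln nu) 0 k rho.
Proof.
move=> nuk; exists (expR (- nu - 1)); first exact: expR_gt0.
move=> rho /andP[r0 r1]; have l0 : ln rho <= 0 by exact: ln_le0.
rewrite powR_expR_ln // mulrA -expRD.
rewrite (_ : 1 - ln rho = 0 - (ln rho - 1)); last by ring.
apply: wmean_gt0.
- by lra.
- exact: expR_gt0.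
- by apply: tmom_integrable; rewrite ?addr0 // ltW.
- by move=> t; rewrite mulr_ge0 ?expR_ge0 // min1X_ge0 // mulr_mixrate_ge0 // ltW.
- move=> t /andP[t1 t2]; rewrite mulr_mixrateN // mul0r expR0 mul1r.
  rewrite /gweight [expR (nu * t - _)]expRD (_ : expR (nu * t) = expR t ^+ k); last first.
    by rewrite nuk expRM_natl.
  rewrite mulrA -exprMn (_ : expR (- nu - 1 + nu * ln rho) =
      (expR (ln rho - 1)) ^+ k * expR (- 1)); last first.
    by rewrite -expRM_natl -nuk -expRD; congr expR; ring.
  apply: ler_pM; rewrite ?exprn_ge0 ?expR_ge0 //.
    apply: lerXn2r; rewrite ?nnegrE ?expR_ge0 ?mulr_ge0 ?expR_ge0 //.
      by rewrite min1_ge0 // mulr_ge0 ?expR_ge0 // ltW.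
    have [a1|a1] := leP (nu * expR (ln rho - t)) 1.
      rewrite -mulrA -expRD subrK.
      apply: (@le_trans _ _ (1 * expR (ln rho))); last by rewrite ler_wpM2r ?expR_ge0.
      by rewrite mul1r ler_expR; lra.
    by rewrite mul1r ler_expR.
  by rewrite ler_expR lerN2 -expR0 ler_expR.
Qed.

(** The left side decays exponentially in both directions, at rate [nu >= 1] towards minus infinity
    and [k - nu >= 1] towards plus infinity, and a logistic density decays at rate 1. *)
Lemma min1_exp_logistic k (tau : R) : nu + 1 <= k%:R ->
  Num.min 1 (expR (- tau)) ^+ k * expR (nu * tau) <=
  4 * (expR tau / (1 + expR tau) ^+ 2).
Proof.
move=> nk; have e0 := expR_gt0 tau.
rewrite mulrA ler_pdivlMr ?exprn_gt0 ?addr_gt0 //.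
have [t0|/ltW t0] := leP tau 0.
  have h1 : Num.min 1 (expR (- tau)) ^+ k * expR (nu * tau) <= expR tau.
    rewrite (min_idPl _) ?expr1n ?mul1r; last by rewrite -expR0 ler_expR oppr_ge0.
    by rewrite ler_expR -[leRHS]mul1r ler_wnM2r.
  have h2 : expR tau <= 1 by rewrite -expR0 ler_expR.
  have h3 : (1 + expR tau) ^+ 2 <= 4 by nra.
  by rewrite mulrC; apply: ler_pM; rewrite ?sqr_ge0 // mulr_ge0 ?min1X_ge0 ?expR_ge0.
have h1 : Num.min 1 (expR (- tau)) ^+ k * expR (nu * tau) <= (expR tau)^-1.
  rewrite (min_idPr _); last by rewrite -expR0 ler_expR oppr_le0.
  by rewrite -expRM_natl -expRD -expRN ler_expR; nra.
have h2 : 1 <= expR tau by rewrite -expR0 ler_expR.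
have h3 : (1 + expR tau) ^+ 2 <= 4 * expR tau ^+ 2 by nra.
apply: le_trans (ler_wpM2r (sqr_ge0 _) h1) _.
apply: le_trans (ler_wpM2l _ h3) _; first by rewrite invr_ge0 expR_ge0.
by apply: eqW; field; rewrite gt_eqF.
Qed.

(** A degree at least [nu + 1] produces no logarithm: once the factor [exp(- exp t)] is dropped, the
    integrand concentrates around [ln (nu * rho)] and is integrable in the recentred variable
    [tau]. *)
Lemma matern_tmom_le k : nu + 1 <= k%:R -> exists2 C : R, 0 <= C & forall rho,
  0 < rho -> tmom nu (-1) (ln nu) 0 k rho <= C * rho `^ nu.
Proof.
move=> nk; exists (2 * 4 * nu `^ nu); first by rewrite !mulr_ge0 ?powR_ge0.
move=> rho r0; pose l := ln (nu * rho).
have nr0 : 0 < nu * rho by rewrite mulr_gt0.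
have np : 0 < nu + 0 by rewrite addr0.
have it := tmom_integrable (-1) (ln nu) k np (ltW r0).
rewrite -mulrA -powRM ?(ltW nu0) ?(ltW r0) // powR_expR_ln // -/l.
rewrite -lee_fin /tmom /wmean /Rintegral fineK; last exact: (integrable_fin_num _ it).
pose C := 4 * expR (nu * l).
rewrite -mulrA -/C.
have C0 : 0 <= C by rewrite mulr_ge0 ?expR_ge0.
apply: le_trans (integral_logistic_le (- l) C0 (ltr01)).
apply: le_integral_nonneg => t _; rewrite lee_fin.
  rewrite mul0r expR0 mul1r mulr_ge0 ?(ltW (gweight_gt0 _ _)) // min1X_ge0 //.
  exact: mulr_mixrate_ge0 (ltW r0).
rewrite !mul1r mul0r expR0 mul1r mulr_mixrateN //.
have -> : nu * expR (ln rho - t) = expR (- (- l + t)).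
  by rewrite opprD opprK /l !expRD !lnK ?posrE // mulrA.
set tau := - l + t.
have gt : gweight nu t <= expR (nu * l) * expR (nu * tau).
  by rewrite -expRD ler_expR /tau; have := expR_ge0 t; nra.
apply: (@le_trans _ _ (Num.min 1 (expR (- tau)) ^+ k * (expR (nu * l) * expR (nu * tau)))).
  by rewrite ler_wpM2l // min1X_ge0 // expR_ge0.
have -> : C * (expR tau / (1 + expR tau) ^+ 2) =
    expR (nu * l) * (4 * (expR tau / (1 + expR tau) ^+ 2)) by rewrite /C; ring.
by rewrite mulrCA ler_wpM2l ?expR_ge0 // min1_exp_logistic.
Qed.

End matern_moments.

(** * Differentiating mixtures in the range parameter *)

Section mixture_correlation.
Context {R : realType} (nu sg b : R).
Hypothesis nu0 : 0 < nu.
Let mu := @lebesgue_measure R.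
Let T := mixrate sg b.
Let Z := wmean nu (cst 1).

Lemma measurable_comp_mixrate (f : R -> R) (rho : R) : measurable_fun setT f ->
  measurable_fun setT (fun t => f (rho * T t)).
Proof.
move=> mf; apply: measurableT_comp => //; apply: measurable_funM => //.
exact: measurable_mixrate.
Qed.

Lemma wintegrable_mix (D rho : R) : 0 <= D -> 0 <= rho ->
  wintegrable nu (fun t => expR (- (rho * T t * D))).
Proof.
move=> D0 r0; apply: (wintegrable_le_exp (C := 1) (p := 0)).
- apply: measurableT_comp => //; apply: measurableT_comp => //.
  by do 2![apply: measurable_funM => //]; exact: measurable_mixrate.
- by rewrite addr0.
- move=> t; rewrite mul0r expR0 mul1r (ger0_norm (expR_ge0 _)) -expR0 ler_expR.
  by rewrite oppr_le0 !mulr_ge0 // ltW // mixrate_gt0.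
Qed.

Lemma wintegrable_dmix (D rho : R) : 0 <= D -> 0 <= rho ->
  wintegrable nu (fun t => rho * T t * D * expR (- (rho * T t * D))).
Proof.
move=> D0 r0; apply: (wintegrable_le_exp (C := 1) (p := 0)).
- have mD : measurable_fun setT (fun t => rho * T t * D).
    by do 2![apply: measurable_funM => //]; exact: measurable_mixrate.
  by apply: measurable_funM => //; apply: measurableT_comp => //; exact: measurableT_comp.
- by rewrite addr0.
- move=> t; rewrite mul0r expR0 mul1r ger0_norm ?mulx_expRN_le1 //.
  by rewrite mulr_ge0 ?expR_ge0 // !mulr_ge0 // ltW // mixrate_gt0.
Qed.

Section sums.
Context (J : finType) (c D : J -> R).
Hypothesis D0 : forall l, 0 <= D l.

Lemma wintegrable_expsum (rho : R) : 0 <= rho ->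
  wintegrable nu (fun t => expsum c D (rho * T t)).
Proof.
move=> r0; apply: wintegrable_sum => l; apply: wintegrableZ.
exact: wintegrable_mix.
Qed.

Lemma wintegrable_dexpsum (rho : R) : 0 <= rho ->
  wintegrable nu (fun t => dexpsum c D (rho * T t)).
Proof.
move=> r0; apply: wintegrable_sum => l; apply: wintegrableZ.
exact: wintegrable_dmix.
Qed.

Lemma wmean_expsum (rho : R) : 0 <= rho ->
  wmean nu (fun t => expsum c D (rho * T t)) =
  \sum_l c l * wmean nu (fun t => expR (- (rho * T t * D l))).
Proof.
move=> r0; have h l : wintegrable nu (fun t => c l * expR (- (rho * T t * D l))).
  by apply: wintegrableZ; exact: wintegrable_mix.
rewrite /expsum (wmean_sum h).
by apply: eq_bigr => l _; rewrite wmeanZ //; exact: wintegrable_mix.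
Qed.

Lemma wmean_dexpsum (rho : R) : 0 <= rho ->
  wmean nu (fun t => dexpsum c D (rho * T t)) =
  \sum_l c l * wmean nu (fun t => rho * T t * D l * expR (- (rho * T t * D l))).
Proof.
move=> r0; have h l : wintegrable nu
    (fun t => c l * (rho * T t * D l * expR (- (rho * T t * D l)))).
  by apply: wintegrableZ; exact: wintegrable_dmix.
rewrite /dexpsum (wmean_sum h).
by apply: eq_bigr => l _; rewrite wmeanZ //; exact: wintegrable_dmix.
Qed.

End sums.

Lemma is_derive_invsqr (D theta : R) : 0 < theta ->
  is_derive theta 1 (fun t => D * t ^- 2) (- 2 * (D * theta ^- 2) / theta).
Proof.
move=> t0; have h2 : is_derive theta 1 (fun t : R => t ^+ 2) (2 * theta).
  have di : is_derive theta 1 (id : R -> R) (1 : R) := is_derive_id _ _.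
  apply: (is_derive_eq (is_deriveM di di)).
  by rewrite /GRing.scale /= mulr1; ring.
have n0 : theta ^+ 2 != 0 by rewrite expf_neq0 // gt_eqF.
have h := is_deriveV (f := fun t : R => t ^+ 2) n0 h2.
apply: (is_derive_eq (is_deriveZ D h)).
by rewrite /GRing.scale /=; field; rewrite gt_eqF.
Qed.

(** Chain rule through the Laplace transform at [D * theta ^- 2], differentiable at positive
    arguments; a zero distance gives a constant entry and is treated apart. *)
Lemma is_derive_mix (D theta : R) : 0 <= D -> 0 < theta ->
  is_derive theta 1 (fun x => wmean nu (fun t => expR (- (x ^- 2 * T t * D))))
    (2 / theta * wmean nu (fun t => theta ^- 2 * T t * D *
       expR (- (theta ^- 2 * T t * D)))).
Proof.
rewrite le_eqVlt => /predU1P[<-|D0] t0.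
  rewrite (_ : (fun x => _) = cst Z); last first.
    apply/funext => x; rewrite /Z; congr wmean; apply/funext => t.
    by rewrite mulr0 oppr0 expR0.
  rewrite (_ : _ / theta * _ = 0); first exact: is_derive_cst.
  rewrite (_ : (fun t => _) = fun t => 0 * 1).
    rewrite wmeanZ ?mul0r ?mulr0 //; apply: (wintegrable_le_exp (C := 1) (p := 0)) => //.
      by rewrite addr0.
    by move=> t; rewrite normr1 mul1r mul0r expR0.
  by apply/funext => t; rewrite mulr0 !mul0r.
have hL := @laplace_derive R T (gweight nu) (measurable_mixrate _ _)
  (measurable_gweight _) (fun t => ltW (mixrate_gt0 _ _ t)) (fun t => ltW (gweight_gt0 _ t)).
have hi x : 0 < x -> mu.-integrable setT (EFin \o (fun t => expR (- (x * T t)) * gweight nu t)).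
  move=> x0; have := wintegrable_mix (ltW x0) ler01; apply: eq_integrable => // t _ /=.
  by rewrite mul1r (mulrC x).
have x0 : 0 < D * theta ^- 2 by rewrite mulr_gt0 // invr_gt0 exprn_gt0.
have h := @is_derive1_comp R _ (fun t : R => D * t ^- 2) theta _ _ (hL hi _ x0)
  (is_derive_invsqr D t0).
rewrite (_ : (fun x => _) = (fun x => \int[mu]_(t in setT) (expR (- (x * T t)) * gweight nu t))
   \o (fun t => D * t ^- 2)); last first.
  apply/funext => x /=; apply: eq_Rintegral => t _; congr (expR (- _) * _).
  by ring.
apply: (is_derive_eq h).
have := wintegrable_dmix (ltW D0) (ltW (_ : 0 < theta ^- 2)).
rewrite invr_gt0 exprn_gt0 // => /(_ isT) id.
have -> : (fun t => theta ^- 2 * T t * D * expR (- (theta ^- 2 * T t * D))) =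
   (fun t => D * theta ^- 2 * (T t * expR (- (D * theta ^- 2 * T t)))).
  apply/funext => t.
  have -> : theta ^- 2 * T t * D = D * theta ^- 2 * T t by ring.
  by rewrite mulrA.
rewrite wmeanZ.
  rewrite /wmean; set I := (X in - X); set I' := Rintegral _ _ _.
  have -> : I = I' by [].
  by ring.
have := wintegrableZ (D * theta ^- 2)^-1 id; apply: eq_integrable => // t _ /=.
congr ((_ * _)%:E).
have -> : theta ^- 2 * T t * D = D * theta ^- 2 * T t by ring.
by rewrite -(mulrA (D * theta ^- 2)) mulKf // gt_eqF.
Qed.

End mixture_correlation.

(** * Entries of the projected correlation matrix as mixed exponential sums *)

Definition pair_sqdist (R : realType) r n (x : 'I_n -> 'rV[R]_r) (l : 'I_n * 'I_n) : R :=
  sqdist (x l.1) (x l.2).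

Section correlation_entries.
Context {R : realType} (r n m : nat) (x : 'I_n -> 'rV[R]_r) (W : 'M[R]_(n, m)).
Context (nu sg b : R) (K : R -> R).
Hypothesis nu0 : 0 < nu.
Let T := mixrate sg b.
Let Z := wmean nu (cst 1).
Hypothesis hK : forall tau, 0 <= tau ->
  K tau = Z^-1 * wmean nu (fun t => expR (- (tau ^+ 2 * T t))).

Let Z0 : 0 < Z. Proof. exact: wmean1_gt0. Qed.

Let D := pair_sqdist x.

Let D0 l : 0 <= D l. Proof. exact: sqdist_ge0. Qed.

Lemma corr_mx_mix (theta : R) s t : 0 < theta ->
  corr_mx K x theta s t =
  Z^-1 * wmean nu (fun u => expR (- (theta ^- 2 * T u * D (s, t)))).
Proof.
move=> t0; rewrite mxE hK; last by rewrite divr_ge0 ?sqrtr_ge0 ?(ltW t0).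
congr (_ * wmean _ _); apply/funext => u; congr (expR (- _)).
by rewrite expr_div_n euclid_normE /D /pair_sqdist /=; ring.
Qed.

Lemma corr_mx_sym (theta : R) : 0 < theta -> (corr_mx K x theta)^T = corr_mx K x theta.
Proof.
move=> t0; apply/matrixP => s t; rewrite [LHS]mxE.
by rewrite (corr_mx_mix t s t0) (corr_mx_mix s t t0) /D /pair_sqdist /= sqdistC.
Qed.

Lemma is_derive_corr_mx (theta : R) s t : 0 < theta ->
  is_derive theta 1 (fun u => corr_mx K x u s t)
    (Z^-1 * (2 / theta * wmean nu (fun u => theta ^- 2 * T u * D (s, t) *
       expR (- (theta ^- 2 * T u * D (s, t)))))).
Proof.
move=> t0; have h := is_deriveZ Z^-1 (is_derive_mix sg b nu0 (D0 (s, t)) t0).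
apply: near_eq_is_derive h.
have nt : - theta < 0 by rewrite oppr_lt0.
apply: filterS (Nlt_nbhsl nt) => u u0; rewrite corr_mx_mix //.
by rewrite -oppr_lt0.
Qed.

Lemma deriv_proj_mx (theta : R) : 0 < theta ->
  deriv_mx (proj_mx_fun W (corr_mx K x)) theta =
  W^T *m deriv_mx (corr_mx K x) theta *m W.
Proof.
move=> t0; apply/matrixP => i j; rewrite mxE derive1E.
pose d s t := Z^-1 * (2 / theta * wmean nu (fun u => theta ^- 2 * T u * D (s, t) *
       expR (- (theta ^- 2 * T u * D (s, t))))).
have dS s t : is_derive theta 1 (fun u => corr_mx K x u s t) (d s t).
  exact: is_derive_corr_mx.
have h : is_derive theta 1 (fun u => proj_mx_fun W (corr_mx K x) u i j)
    (\sum_t (\sum_s W^T i s * d s t) * W t j).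
  have -> : (fun u => proj_mx_fun W (corr_mx K x) u i j) =
      \sum_t W t j *: (\sum_s W^T i s *: (fun u => corr_mx K x u s t)).
    apply/funext => u; rewrite /proj_mx_fun mxE fct_sumE; apply: eq_bigr => t _.
    rewrite mxE mulrC /GRing.scale /=; congr (_ * _); rewrite fct_sumE.
    by apply: eq_bigr.
  apply: (is_derive_eq (is_derive_sum (fun t => is_deriveZ (W t j)
    (is_derive_sum (fun s => is_deriveZ (W^T i s) (dS s t)))))).
  by apply: eq_bigr => t _; rewrite mulrC.
have [_ ->] := h.
rewrite mxE; apply: eq_bigr => t _; rewrite mxE; congr (_ * _).
apply: eq_bigr => s _; rewrite [deriv_mx _ _ _ _]mxE derive1E; congr (_ * _).
by have [_ ->] := dS s t.
Qed.

Context (U : 'M[R]_m).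

(** Indexing by ordered pairs of design points turns each entry of [U^T W^T M W U] into a single
    sum, to which the estimates on [expsum] apply. *)
Definition pair_coef i j (l : 'I_n * 'I_n) : R := (W *m U) l.1 i * (W *m U) l.2 j.

Lemma bilinear_entry (M : 'M[R]_n) i j :
  (U^T *m (W^T *m M *m W) *m U) i j = \sum_l pair_coef i j l * M l.1 l.2.
Proof.
have -> : U^T *m (W^T *m M *m W) *m U = (W *m U)^T *m M *m (W *m U).
  by rewrite trmx_mul !mulmxA.
rewrite mxE -(pair_bigA _ (fun s t => pair_coef i j (s, t) * M s t)) exchange_big /=.
apply: eq_bigr => t _; rewrite mxE mulr_suml; apply: eq_bigr => s _.
by rewrite /pair_coef [X in X * _]mulrC mxE /=; ring.
Qed.

Lemma proj_corr_entry (theta : R) i j : 0 < theta ->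
  (U^T *m proj_mx_fun W (corr_mx K x) theta *m U) i j =
  Z^-1 * wmean nu (fun t => expsum (pair_coef i j) D (theta ^- 2 * T t)).
Proof.
move=> t0; rewrite bilinear_entry wmean_expsum //; last by rewrite invr_ge0 sqr_ge0.
rewrite mulr_sumr; apply: eq_bigr => -[s t] _; rewrite corr_mx_mix //.
by rewrite mulrCA.
Qed.

Lemma deriv_corr_entry (theta : R) i j : 0 < theta ->
  (U^T *m deriv_mx (proj_mx_fun W (corr_mx K x)) theta *m U) i j =
  Z^-1 * (2 / theta) * wmean nu (fun t => dexpsum (pair_coef i j) D (theta ^- 2 * T t)).
Proof.
move=> t0; rewrite deriv_proj_mx // bilinear_entry wmean_dexpsum //; last by rewrite invr_ge0 sqr_ge0.
rewrite mulr_sumr; apply: eq_bigr => -[s t] _; rewrite mxE derive1E.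
by have [_ ->] := is_derive_corr_mx s t t0; rewrite !mulrA mulrC !mulrA; ring.
Qed.

End correlation_entries.

(** * The posterior density in terms of truncated moments *)

Section posterior_bound.
Context {R : realType} (r n : nat) (x : 'I_n -> 'rV[R]_r).
Context (nu sg b : R) (K : R -> R).
Hypothesis nu0 : 0 < nu.
Let T := mixrate sg b.
Let Z := wmean nu (cst 1).
Hypothesis hK : forall tau, 0 <= tau ->
  K tau = Z^-1 * wmean nu (fun t => expR (- (tau ^+ 2 * T t))).

Let Z0 : 0 < Z. Proof. exact: wmean1_gt0. Qed.
Let np : 0 < nu + 0. Proof. by rewrite addr0. Qed.

Let rho_gt0 (theta : R) : 0 < theta -> 0 < theta ^- 2.
Proof. by move=> t0; rewrite invr_gt0 exprn_gt0. Qed.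

Local Notation h k theta := (tmom nu sg b 0 k (theta ^- 2)).

Lemma h_gt0 k (theta : R) : 0 < theta -> 0 < h k theta.
Proof. by move=> t0; apply: tmom_gt0 => //; exact: rho_gt0. Qed.

Lemma wmean_le_tmom p k (C rho : R) (f : R -> R) : 0 < nu + p -> 0 <= C -> 0 <= rho ->
  measurable_fun setT f -> (forall a, 0 <= a -> `|f a| <= C * Num.min 1 a ^+ k) ->
  `|wmean nu (fun t => expR (p * t) * f (rho * T t))| <= C * tmom nu sg b p k rho.
Proof.
move=> npp C0 r0 mf hf; have it := tmom_integrable sg b k npp r0.
have a0 t := mulr_mixrate_ge0 sg b t r0.
have bnd t : `|expR (p * t) * f (rho * T t)| <=
    C * (expR (p * t) * Num.min 1 (rho * T t) ^+ k).
  rewrite normrM (ger0_norm (expR_ge0 _)) mulrCA ler_wpM2l ?expR_ge0 //.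
  exact: hf.
rewrite /tmom -wmeanZ //; apply: wmean_norm_le => //; last exact: wintegrableZ.
apply: wintegrable_dom (wintegrableZ C it) => //.
apply: measurable_funM; last exact: measurable_comp_mixrate.
by apply: measurableT_comp => //; exact: measurable_funM.
Qed.

Lemma se_form_expsum (rho : R) (w : 'I_n -> R) :
  (fun t => se_form x (rho * T t) w) =
  fun t => expsum (fun l => w l.1 * w l.2) (pair_sqdist x) (rho * T t).
Proof. by apply/funext => t; rewrite /se_form /expsum pair_bigA. Qed.

Lemma qform_corr (theta : R) (w : 'cV[R]_n) : 0 < theta ->
  qform (corr_mx K x theta) w =
  Z^-1 * wmean nu (fun t => se_form x (theta ^- 2 * T t) (fun s => w s 0)).
Proof.
move=> t0; rewrite se_form_expsum wmean_expsum //; first last.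
- by rewrite ltW // rho_gt0.
- by move=> l; exact: sqdist_ge0.
rewrite qform_sum pair_bigA mulr_sumr; apply: eq_bigr => -[s t] _ /=.
by rewrite (corr_mx_mix x hK s t t0) mulrCA.
Qed.

Section lower.
Context (m : nat) (W : 'M[R]_(n, m)) (U : 'M[R]_m) (deg : 'I_m -> nat).
Hypothesis basis_ge : exists2 C : R, 0 < C & forall a (v : 'cV[R]_m) i, 0 < a ->
  Num.min 1 a ^+ deg i * v i 0 ^+ 2 <= C * se_form x a (fun s => (W *m U *m v) s 0).

Local Notation S theta := (proj_mx_fun W (corr_mx K x) theta).

Lemma proj_corr_ge : exists2 c : R, 0 < c & forall theta (v : 'cV[R]_m), 0 < theta ->
  \sum_i c * h (deg i) theta * v i 0 ^+ 2 <= qform (U^T *m S theta *m U) v.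
Proof.
have [C C0 hC] := basis_ge.
(* The [m] bounds, one per coordinate, are added up; [m.+1] in place of [m] keeps the constant
   positive when [m] is 0. *)
have mC : 0 < m.+1%:R * (C * Z) by rewrite !mulr_gt0.
exists (m.+1%:R * (C * Z))^-1; first by rewrite invr_gt0.
move=> theta v t0; have r0 := rho_gt0 t0.
rewrite qform_congr qform_congr qform_corr // mulmxA.
set w := W *m U *m v; set I := wmean _ _.
have I0 : 0 <= I.
  by apply: wmean_ge0 => t; apply: se_form_ge0; exact: mulr_mixrate_ge0 (ltW r0).
have iI : wintegrable nu (fun t => se_form x (theta ^- 2 * T t) (fun s => w s 0)).
  rewrite se_form_expsum.
  by apply: wintegrable_expsum => //; [move=> l; exact: sqdist_ge0|exact: ltW].
have hi i : h (deg i) theta * v i 0 ^+ 2 <= C * I.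
  have it := tmom_integrable sg b (deg i) np (ltW r0).
  rewrite mulrC /tmom -!wmeanZ //; apply: wmean_le; try exact: wintegrableZ.
  move=> t; rewrite mul0r expR0 mul1r mulrC; apply: hC.
  by rewrite mulr_gt0 // mixrate_gt0.
under eq_bigr do rewrite -mulrA.
rewrite -mulr_sumr ler_pdivrMl //.
apply: (@le_trans _ _ (\sum_(i < m) C * I)); first by apply: ler_sum => i _.
rewrite sumr_const card_ord -[leLHS]mulr_natl.
have -> : m.+1%:R * (C * Z) * (Z^-1 * I) = m.+1%:R * (C * I).
  by field; rewrite gt_eqF.
by rewrite ler_wpM2r ?ler_nat // mulr_ge0 // ltW.
Qed.

Lemma proj_corr_sym (theta : R) : 0 < theta -> (S theta)^T = S theta.
Proof.
move=> t0; rewrite /proj_mx_fun !trmx_mul trmxK mulmxA.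
by rewrite (corr_mx_sym x hK t0).
Qed.

Hypothesis uU : U \in unitmx.

Lemma unit_conj_sym (theta : R) : 0 < theta ->
  (U^T *m S theta *m U)^T = U^T *m S theta *m U.
Proof. by move=> t0; rewrite 2!trmx_mul trmxK mulmxA proj_corr_sym. Qed.

Lemma posdef_proj_corr (theta : R) : 0 < theta -> posdef (S theta).
Proof.
move=> t0; have [c c0 hc] := proj_corr_ge.
have pA : posdef (U^T *m S theta *m U).
  apply: (diag_lower_posdef (d := fun i => c * h (deg i) theta)).
  - exact: unit_conj_sym.
  - by move=> i; rewrite mulr_gt0 // h_gt0.
  - by move=> v; exact: hc.
have := posdef_congr (P := invmx U) pA.
rewrite trmx_inv !mulmxA -trmx_inv -trmx_mul mulmxV // trmx1 mul1mx mulmxK //.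
by apply=> v /(congr1 (mulmx U)); rewrite mulmxA mulmxV // mul1mx mulmx0.
Qed.

Lemma prior_corr_le (theta lam eta : R) : 0 < theta -> 0 <= eta ->
  forall c, 0 < c ->
  (forall v : 'cV[R]_m, \sum_i c * h (deg i) theta * v i 0 ^+ 2 <=
     qform (U^T *m S theta *m U) v) ->
  (forall i j, `|(U^T *m (deriv_mx (proj_mx_fun W (corr_mx K x)) theta -
       lam *: S theta) *m U) i j|
     <= eta * Num.sqrt (h (deg i) theta * h (deg j) theta)) ->
  reference_prior (proj_mx_fun W (corr_mx K x)) theta <= m%:R ^+ 2 * (c^-1 * eta).
Proof.
move=> t0 eta0 c c0 hc he.
have d0 i : 0 < c * h (deg i) theta by rewrite mulr_gt0 // h_gt0.
apply: (reference_prior_le (U := U) (c := lam)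
  (s := fun i => Num.sqrt (c * h (deg i) theta))) => //.
- exact: proj_corr_sym.
- by move=> i; rewrite sqrtr_gt0.
- by rewrite mulr_ge0 ?invr_ge0 ?(ltW c0).
- move=> v; apply: le_trans (hc v); apply: ler_sum => i _.
  by rewrite sqr_sqrtr // ltW.
- move=> i j; apply: le_trans (he i j) _.
  have c1 := ltW c0; have h1 i' := ltW (h_gt0 (deg i') t0).
  rewrite !sqrtrM // [X in _ <= _ * X]mulrACA -expr2 sqr_sqrtr //.
  apply: eqW.
  by field; rewrite gt_eqF.
Qed.

Lemma proj_corr_diag_le i : vanishing (pair_coef W U i i) (pair_sqdist x) (deg i) ->
  exists2 C : R, 0 < C & forall theta, 0 < theta ->
    (U^T *m S theta *m U) i i <= C * h (deg i) theta.
Proof.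
move=> /(expsum_le (fun l => sqdist_ge0 _ _)) [C C0 hC].
exists (Z^-1 * (C + 1)); first by rewrite mulr_gt0 ?invr_gt0 // ltr_wpDl.
move=> theta t0; have r0 := ltW (rho_gt0 t0).
rewrite (proj_corr_entry x W nu0 hK U i i t0) -mulrA ler_wpM2l ?invr_ge0 ?(ltW Z0) //.
have mf : measurable_fun setT (expsum (pair_coef W U i i) (pair_sqdist x)).
  rewrite /expsum; apply: measurable_sum => l; apply: measurable_funM => //.
  by apply: measurableT_comp => //; apply: measurableT_comp => //; exact: measurable_funM.
have := wmean_le_tmom np C0 r0 mf hC.
rewrite (_ : (fun t => expR (0 * t) * _) = fun t => expsum (pair_coef W U i i) (pair_sqdist x) (theta ^- 2 * T t)); last first.
  by apply/funext => t; rewrite mul0r expR0 mul1r.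
move=> h1; apply: le_trans (ler_norm _) _; apply: le_trans h1 _.
by rewrite ler_wpM2r ?lerDl // ltW // h_gt0.
Qed.

End lower.

Lemma prod_sqrtr (J : finType) (f : J -> R) : (forall j, 0 <= f j) ->
  \prod_j Num.sqrt (f j) = Num.sqrt (\prod_j f j).
Proof.
move=> f0; have p1 : 0 <= \prod_j f j by apply: prodr_ge0.
apply/eqP; rewrite -(@eqrXn2 _ 2) ?sqrtr_ge0 //; last first.
  by apply: prodr_ge0 => j _; exact: sqrtr_ge0.
rewrite sqr_sqrtr // -prodrXl; apply/eqP/eq_bigr => j _.
by rewrite sqr_sqrtr.
Qed.

Section product.
Context (p m : nat) (H : 'M[R]_(n, p)) (W : 'M[R]_(n, m)).
Hypothesis xinj : injective x.
Hypothesis npm : n = (p + m)%N.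
Hypothesis m0 : (0 < m)%N.
Hypothesis hH : \rank H = p.
Hypothesis hW : W^T *m W = 1%:M.
Hypothesis hHW : H^T *m W = 0.

(** The case [W = 1] of the previous results, with its own adapted basis. *)
Lemma posdef_corr (theta : R) : 0 < theta -> posdef (corr_mx K x theta).
Proof.
move=> t0; have h1 : (1%:M : 'M[R]_n)^T *m 1%:M = 1%:M by rewrite trmx1 mulmx1.
have [U [deg [uU hge _]]] := adapted_kernel_basis xinj h1.
have := posdef_proj_corr hge uU t0.
by rewrite /proj_mx_fun trmx1 mul1mx mulmx1.
Qed.

Context (U : 'M[R]_m) (deg : 'I_m -> nat) (i0 : 'I_m).
Hypothesis uU : U \in unitmx.
Hypothesis basis_ge : exists2 C : R, 0 < C & forall a (v : 'cV[R]_m) i, 0 < a ->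
  Num.min 1 a ^+ deg i * v i 0 ^+ 2 <= C * se_form x a (fun s => (W *m U *m v) s 0).
Hypothesis van : vanishing (pair_coef W U i0 i0) (pair_sqdist x) (deg i0).

Local Notation S theta := (proj_mx_fun W (corr_mx K x) theta).

Lemma powR_half_sqrt (y : R) : 0 < y -> y `^ (- (1 / 2)) = (Num.sqrt y)^-1.
Proof. by move=> y0; rewrite powRN mul1r powR12_sqrt // ltW. Qed.

Lemma powR_halfn_sqrt (y : R) : 0 < y -> y `^ (- (m%:R / 2)) = (Num.sqrt y) ^- m.
Proof.
move=> y0; rewrite powRN mulrC powRrM powR12_sqrt ?(ltW y0) //.
by rewrite powR_mulrn // sqrtr_ge0.
Qed.

(* Cauchy-Schwarz for [S] between [col i0 U] and [S^-1 W^T y]. *)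
Lemma proj_residual_ge (theta C : R) (y : 'cV[R]_n) : 0 < theta ->
  (U^T *m S theta *m U) i0 i0 <= C ->
  ((col i0 U)^T *m (W^T *m y)) 0 0 ^+ 2 <= C * qform (invmx (S theta)) (W^T *m y).
Proof.
move=> t0 hC; have pS := posdef_proj_corr basis_ge uU t0.
have uS := posdef_unit pS; set z := W^T *m y.
have := qform_CS (col i0 U) (invmx (S theta) *m z) pS.
rewrite -mulmxA (mulmxA (S theta)) mulmxV // mul1mx -qform_invmx //; last by case: pS.
move=> h1; apply: le_trans h1 _; apply: ler_wpM2r.
  have [/= _ pI] := posdef_inv pS.
  have [->|z0] := eqVneq z 0; first by rewrite /qform mulmx0 mxE.
  exact/ltW/pI.
apply: le_trans hC; apply: eqW.
rewrite colE -qform_congr; move: (_ *m U) => A.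
by rewrite /qform trmx_delta -rowE -colE !mxE.
Qed.

(** The determinant is at least a constant times the product of the h_(d_i), and the residual form
    is at least a constant over h_(d_(i0)). The latter enters with exponent [- m / 2], that is, one
    square root of h_(d_(i0)) for each of the [m] factors of the determinant. *)
Lemma posterior_le (y : 'cV[R]_n) : ((col i0 U)^T *m (W^T *m y)) 0 0 != 0 ->
  exists2 C : R, 0 < C & forall theta lam eta : R, 0 < theta -> 0 <= eta ->
  (forall i j, `|(U^T *m (deriv_mx (proj_mx_fun W (corr_mx K x)) theta -
       lam *: S theta) *m U) i j|
     <= eta * Num.sqrt (h (deg i) theta * h (deg j) theta)) ->
  (integrated_likelihood H (corr_mx K x) y theta *
     (reference_prior (proj_mx_fun W (corr_mx K x)) theta)%:E <=
   (C * (eta * \prod_i Num.sqrt (h (deg i0) theta / h (deg i) theta)))%:E)%E.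
Proof.
set kap := (_ *m _) 0 0 => kap0.
have [C1 C10 hC1] := integrated_likelihood_le npm m0 hH hW hHW.
have [c c0 hc] := proj_corr_ge basis_ge.
have [C2 C20 hC2] := proj_corr_diag_le van.
have z0 : W^T *m y != 0.
  by apply: contraNneq kap0 => e; rewrite /kap e mulmx0 mxE.
pose E := C1 * `|\det U| * (Num.sqrt (C2 / c) / `|kap|) ^+ m.
have dU : 0 < `|\det U| by rewrite normr_gt0; move: uU; rewrite unitmxE unitfE.
have E0 : 0 < E.
  by rewrite !mulr_gt0 // exprn_gt0 // divr_gt0 ?normr_gt0 // sqrtr_gt0 divr_gt0.
exists (E * (m%:R ^+ 2 * c^-1)).
  by rewrite mulr_gt0 // divr_gt0 // exprn_gt0 // ltr0n.
move=> theta lam eta t0 eta0 he.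
have hp := prior_corr_le uU t0 eta0 c0 (fun v => hc theta v t0) he.
have hl := hC1 (corr_mx K x) theta y (posdef_corr t0) z0.
set P := \prod_i _.
have pS := posdef_proj_corr basis_ge uU t0.
have dS : 0 < \det (S theta) := posdef_det_gt0 pS.
have Q0 : 0 < qform (invmx (S theta)) (W^T *m y) by have [_] := posdef_inv pS; apply.
have h0 i : 0 < h (deg i) theta by exact: h_gt0.
have hQ : `|kap| / Num.sqrt (C2 * h (deg i0) theta) <=
    Num.sqrt (qform (invmx (S theta)) (W^T *m y)).
  have CH : 0 < C2 * h (deg i0) theta by rewrite mulr_gt0.
  rewrite ler_pdivrMr ?sqrtr_gt0 // -sqrtrM ?(ltW Q0) // -sqrtr_sqr ler_wsqrtr //.
  by rewrite [leRHS]mulrC; apply: proj_residual_ge => //; exact: hC2.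
have hD : (\prod_i Num.sqrt (c * h (deg i) theta)) / `|\det U| <=
    Num.sqrt (\det (S theta)).
  have hd : \prod_i (c * h (deg i) theta) <= \det (U^T *m S theta *m U).
    apply: diag_lower_det; first exact: unit_conj_sym.
      by move=> i; rewrite mulr_gt0.
    by move=> v; exact: hc.
  rewrite ler_pdivrMr // -sqrtr_sqr -sqrtrM ?(ltW dS) //.
  rewrite prod_sqrtr; last by move=> i; rewrite mulr_ge0 // ltW.
  apply: ler_wsqrtr; apply: le_trans hd _; apply: eqW.
  by rewrite !det_mulmx det_tr; ring.
have hL : (integrated_likelihood H (corr_mx K x) y theta <= (E * P)%:E)%E.
  apply: le_trans hl _; rewrite lee_fin -/(S theta).
  rewrite powR_half_sqrt // powR_halfn_sqrt //.
  have s1 : 0 < Num.sqrt (\det (S theta)) by rewrite sqrtr_gt0.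
  have s2 : 0 < Num.sqrt (qform (invmx (S theta)) (W^T *m y)) by rewrite sqrtr_gt0.
  have pr0 : 0 < \prod_i Num.sqrt (c * h (deg i) theta).
    by apply: prodr_gt0 => i _; rewrite sqrtr_gt0 mulr_gt0.
  have q0 : 0 < `|kap| / Num.sqrt (C2 * h (deg i0) theta).
    by rewrite divr_gt0 ?normr_gt0 // sqrtr_gt0 mulr_gt0.
  have D1 : (Num.sqrt (\det (S theta)))^-1 <=
      `|\det U| / \prod_i Num.sqrt (c * h (deg i) theta).
    rewrite -invf_div lef_pV2 ?posrE //.
    by rewrite divr_gt0.
  have Q1 : (Num.sqrt (qform (invmx (S theta)) (W^T *m y)))^-1 <=
      Num.sqrt (C2 * h (deg i0) theta) / `|kap|.
    by rewrite -invf_div lef_pV2 ?posrE.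
  rewrite -exprVn /E -mulrA -!(mulrA C1) ler_pM2l // -mulrA.
  have -> : (Num.sqrt (C2 / c) / `|kap|) ^+ m * P =
      (\prod_i Num.sqrt (c * h (deg i) theta))^-1 *
      (Num.sqrt (C2 * h (deg i0) theta) / `|kap|) ^+ m.
    have pc z : z ^+ m = \prod_(i < m) z :> R by rewrite prodr_const card_ord.
    rewrite !pc /P -prodfV -!big_split; apply: eq_bigr => i _ /=.
    have k0 : `|kap| != 0 by rewrite normr_eq0.
    have c1 := ltW c0; have C21 := ltW C20; have h1 i' := ltW (h0 i').
    rewrite !sqrtrM // !sqrtrV //.
    by field; rewrite k0 !gt_eqF ?sqrtr_gt0.
  rewrite mulrA; apply: ler_pM => //.
  by apply: lerXn2r => //; rewrite nnegrE ?invr_ge0 ?sqrtr_ge0.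
have R0 : 0 <= reference_prior (proj_mx_fun W (corr_mx K x)) theta by exact: sqrtr_ge0.
apply: le_trans (lee_wpmul2r _ hL) _; first by rewrite lee_fin.
rewrite -EFinM lee_fin.
have P0 : 0 <= P by apply: prodr_ge0 => i _; exact: sqrtr_ge0.
have EP : 0 <= E * P by rewrite mulr_ge0 // ltW.
apply: le_trans (ler_wpM2l EP hp) _.
by apply: eqW; ring.
Qed.

End product.

End posterior_bound.

(** * Uniform constants and comparison of powers with logarithms *)

Section uniform_constants.
Context {R : realType}.

Lemma uniform_bound (J : finType) (X : Type) (Q : X -> Prop) (F G : J -> X -> R) :
  (forall j x, Q x -> 0 <= G j x) ->
  (forall j, exists2 C : R, 0 <= C & forall x, Q x -> F j x <= C * G j x) ->
  exists2 C : R, 0 <= C & forall j x, Q x -> F j x <= C * G j x.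
Proof.
move=> G0 h; have h' j : exists C : R, 0 <= C /\ forall x, Q x -> F j x <= C * G j x.
  by have [C C0 hC] := h j; exists C.
have [f hf] := choice h'; exists (\sum_j f j).
  by apply: sumr_ge0 => j _; have [] := hf j.
move=> j x Qx; have [_ hj] := hf j; apply: le_trans (hj x Qx) _.
rewrite ler_wpM2r ?G0 // (bigD1 j) //= lerDl.
by apply: sumr_ge0 => k _; have [] := hf k.
Qed.

Lemma expR_ge_sqr (u : R) : 0 <= u -> u ^+ 2 / 2 <= expR u.
Proof.
move=> u0; have := expR_ge1Dxn 1 u0; rewrite (_ : (2`!)%:R = 2) //.
by apply: le_trans; rewrite lerDr.
Qed.

Lemma powRN_le_ln (d : R) : 0 < d -> exists2 C : R, 0 <= C &
  forall theta, 1 <= theta -> theta `^ (- d) * (1 + 2 * ln theta) ^+ 2 <= C.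
Proof.
move=> d0; exists (2 + 16 / d ^+ 2) => [|theta t1].
  by rewrite addr_ge0 // divr_ge0 // sqr_ge0.
have l0 : 0 <= ln theta by exact: ln_ge0.
have t0 : 0 < theta by exact: lt_le_trans t1.
rewrite powRN mulrC ler_pdivrMr ?powR_gt0 //.
rewrite powR_expR_ln //; set e := expR _.
have e1 : 1 <= e by rewrite /e -expR0 ler_expR mulr_ge0 // ltW.
have e2 : (d * ln theta) ^+ 2 / 2 <= e by apply: expR_ge_sqr; rewrite mulr_ge0 // ltW.
have e3 : ln theta ^+ 2 <= 2 / d ^+ 2 * e.
  rewrite -ler_pdivrMl ?divr_gt0 ?exprn_gt0 //; apply: le_trans e2.
  by apply: eqW; field; rewrite gt_eqF.
have -> : (2 + 16 / d ^+ 2) * e = 2 * e + 8 * (2 / d ^+ 2 * e) by ring.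
have := sqr_ge0 (1 - 2 * ln theta).
by nra.
Qed.

Lemma ln_invsqr (theta : R) : 0 < theta -> ln (theta ^- 2) = - (2 * ln theta).
Proof. by move=> t0; rewrite lnV ?posrE ?exprn_gt0 // lnXn // mulr_natl. Qed.

Lemma powR_invsqr (theta q : R) : 0 < theta -> (theta ^- 2) `^ q = theta `^ (- (2 * q)).
Proof.
move=> t0; rewrite !powR_expR_ln ?invr_gt0 ?exprn_gt0 // ln_invsqr //.
by congr expR; ring.
Qed.

Lemma powRN_le1 (theta q : R) : 1 <= theta -> 0 <= q -> theta `^ (- q) <= 1.
Proof.
move=> t1 q0; rewrite powRN invf_le1 ?powR_gt0 ?(lt_le_trans _ t1) //.
by have := ler_powR t1 q0; rewrite powRr0.
Qed.

Lemma invsqr_bounds (theta : R) : 1 <= theta -> 0 < theta ^- 2 <= 1.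
Proof.
move=> t1; have t0 : 0 < theta := lt_le_trans ltr01 t1.
by rewrite invr_gt0 exprn_gt0 //= invf_le1 ?exprn_gt0 // exprn_ege1.
Qed.

End uniform_constants.

(** * Decay rates available when enough moments are finite *)

Section fisher_rates.
Context {R : realType} (I J : finType) (c : I -> I -> J -> R) (D : J -> R).
Context (deg : I -> nat) (i0 j0 : I) (nu sg b : R).
Hypothesis D0 : forall l, 0 <= D l.
Hypothesis nu0 : 0 < nu.
Hypothesis van : forall i j, vanishing (c i j) D (uphalf (deg i + deg j)).
Hypothesis hmax : forall i, (deg i <= deg i0)%N.
Hypothesis hmin : forall i, (deg j0 <= deg i)%N.
Let T := mixrate sg b.
Let np : 0 < nu + 0. Proof. by rewrite addr0. Qed.

Local Notation h k rho := (tmom nu sg b 0 k rho).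
Local Notation Eg rho i j := (wmean nu (fun t => expsum (c i j) D (rho * T t))).
Local Notation EG rho i j := (wmean nu (fun t => dexpsum (c i j) D (rho * T t))).

(* [B] bounds the posterior density up to a constant: [eta] controls the prior,
   [lam] being a shift of the logarithmic derivative that the prior does not see,
   and the product controls the integrated likelihood. *)
Definition fisher_le (theta B : R) : Prop := exists lam eta : R,
  [/\ 0 <= eta,
      forall i j, `|2 / theta * EG (theta ^- 2) i j - lam * Eg (theta ^- 2) i j|
        <= eta * Num.sqrt (h (deg i) (theta ^- 2) * h (deg j) (theta ^- 2)) &
      eta * \prod_i Num.sqrt (h (deg i0) (theta ^- 2) / h (deg i) (theta ^- 2)) <= B].

Lemma measurable_expsum i j : measurable_fun setT (expsum (c i j) D).
Proof.
apply: measurable_sum => l; apply: measurable_funM => //.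
by apply: measurableT_comp => //; apply: measurableT_comp => //; exact: measurable_funM.
Qed.

Lemma measurable_dexpsum i j : measurable_fun setT (dexpsum (c i j) D).
Proof.
have m1 l : measurable_fun setT (fun a : R => a * D l) by exact: measurable_funM.
apply: measurable_sum => l; apply: measurable_funM => //; apply: measurable_funM => //.
by apply: measurableT_comp => //; exact: measurableT_comp.
Qed.

Let h0 k rho : 0 < rho -> 0 < h k rho. Proof. by move=> r0; exact: tmom_gt0. Qed.

(** Truncated moments decrease with the degree, so each factor is at most 1 and all but one may be
    dropped. Keeping [i0] gives 1, keeping [j0] gives the whole gap between the extreme degrees. *)
Lemma ratio_prod_le rho j : 0 < rho ->
  \prod_i Num.sqrt (h (deg i0) rho / h (deg i) rho) <=
  Num.sqrt (h (deg i0) rho / h (deg j) rho).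
Proof.
move=> r0; rewrite (bigD1 j) //= ler_piMr ?sqrtr_ge0 //.
apply: prodr_ile1 => i _; rewrite sqrtr_ge0 /= -sqrtr1 ler_wsqrtr //.
by rewrite ler_pdivrMr ?h0 // mul1r tmom_le_deg // ltW.
Qed.

Lemma fisher_leI theta lam X B j : 0 < theta -> 0 <= X ->
  (forall i i', `|EG (theta ^- 2) i i' - lam * Eg (theta ^- 2) i i'| <=
     X * Num.sqrt (h (deg i) (theta ^- 2) * h (deg i') (theta ^- 2))) ->
  2 / theta * X * Num.sqrt (h (deg i0) (theta ^- 2) / h (deg j) (theta ^- 2)) <= B ->
  fisher_le theta B.
Proof.
move=> t0 X0 hX hB; have t2 : 0 <= 2 / theta by rewrite divr_ge0 // ltW.
have e0 : 0 <= 2 / theta * X by rewrite mulr_ge0.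
exists (2 / theta * lam), (2 / theta * X); split=> // [i i'|].
  by rewrite -[X in _ - X]mulrA -mulrBr normrM (ger0_norm t2) -[leRHS]mulrA ler_wpM2l.
apply: le_trans hB; rewrite ler_wpM2l // ratio_prod_le //.
by rewrite invr_gt0 exprn_gt0.
Qed.

Lemma wmean_expsum_le p (C rho : R) k (f : R -> R) : 0 <= p -> 0 <= C -> 0 < rho ->
  measurable_fun setT f -> (forall a, 0 <= a -> `|f a| <= C * Num.min 1 a ^+ k) ->
  `|wmean nu (fun t => expR (p * t) * f (rho * T t))| <= C * tmom nu sg b p k rho.
Proof. by move=> p0 C0 r0; apply: wmean_le_tmom => //; [rewrite ltr_wpDr|exact: ltW]. Qed.

Lemma wmean_expR0 (f : R -> R) : wmean nu (fun t => expR (0 * t) * f t) = wmean nu f.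
Proof. by congr wmean; apply/funext => t; rewrite mul0r expR0 mul1r. Qed.

(** For [theta <= 1] the moments h_k are at least their value at 1, while the derivative decays like
    [rho] to the power [- e], that is [theta] to the power [2 * e]. No shift is used; the condition
    on [nu - sg * e] makes E T^(- e) finite. *)
Lemma fisher_le_near0 (e : R) : 0 < e <= 1 -> 0 < nu - sg * e ->
  exists2 C : R, 0 <= C &
    forall theta, 0 < theta <= 1 -> fisher_le theta (C * theta `^ (2 * e - 1)).
Proof.
move=> e01 he.
have he' : 0 < nu + (0 + sg * - e) by rewrite add0r mulrN.
have [C1 C10 hC1] := wmean_powR_mixrate b he'.
have [|[i j]|C C0 hC] := @uniform_bound _ (I * I)%type R (fun theta => 0 < theta <= 1)
  (fun ij theta => `|EG (theta ^- 2) ij.1 ij.2|)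
  (fun ij theta => theta `^ (2 * e) *
     Num.sqrt (h (deg ij.1) (theta ^- 2) * h (deg ij.2) (theta ^- 2))).
- by move=> ij theta _; rewrite mulr_ge0 ?powR_ge0 ?sqrtr_ge0.
- have [C C0 hC] := dexpsum_decay (c i j) D0 e01.
  pose s := Num.sqrt (h (deg i) 1 * h (deg j) 1).
  have s0 : 0 < s by rewrite sqrtr_gt0 mulr_gt0 ?h0.
  exists (C * C1 / s); first by rewrite divr_ge0 ?mulr_ge0 // ltW.
  move=> theta /andP[t0 t1] /=; set rho := theta ^- 2.
  have r0 : 0 < rho by rewrite invr_gt0 exprn_gt0.
  have r1 : 1 <= rho by rewrite invf_ge1 ?exprn_gt0 // exprn_ile1 // ltW.
  have [i1 e1] := hC1 rho r0.
  have hG : `|EG rho i j| <= C * (C1 * rho `^ (- e)).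
    rewrite -e1 -wmeanZ //; apply: wmean_norm_le; first by apply: wintegrable_dexpsum => //; exact: ltW.
      exact: wintegrableZ.
    move=> t; rewrite mul0r expR0 mul1r; apply: hC.
    by rewrite mulr_gt0 // mixrate_gt0.
  have hs : s <= Num.sqrt (h (deg i) rho * h (deg j) rho).
    apply: ler_wsqrtr; apply: ler_pM; rewrite ?(ltW (h0 _ _)) // ?tmom_le //.
  apply: le_trans hG _; rewrite /rho powR_invsqr // -/rho mulrN opprK.
  set th := theta `^ _.
  have -> : C * (C1 * th) = C * C1 / s * (th * s) by field; rewrite gt_eqF.
  by rewrite ler_wpM2l ?divr_ge0 ?mulr_ge0 ?(ltW s0) // ler_wpM2l ?powR_ge0.
exists (2 * C) => [|theta t01]; first by rewrite mulr_ge0.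
have /andP[t0 t1] := t01.
apply: (@fisher_leI theta 0 (C * theta `^ (2 * e)) _ i0) => //.
- by rewrite mulr_ge0 ?powR_ge0.
- by move=> i j; rewrite mul0r subr0 -mulrA; exact: (hC (i, j)).
- rewrite divff ?gt_eqF ?h0 ?invr_gt0 ?exprn_gt0 // sqrtr1 mulr1.
  apply: eqW; rewrite powRB ?(gt_eqF t0) ?implybT // powRr1 ?(ltW t0) //.
  by field; rewrite gt_eqF.
Qed.

(** The shift by [- k] removes the leading term, leaving a truncated moment of degree [k.+1], of
    order at most [k + d] in [rho], against h_k of order at least [rho ^+ k]. The resulting exponent
    [- 2 d] is relaxed to [- d], the rate of the other case. *)
Lemma fisher_le_const_deg (d : R) : 0 < d <= 1 -> deg j0 = deg i0 ->
  0 < nu + sg * ((deg i0)%:R + d) ->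
  exists2 C : R, 0 <= C &
    forall theta, 1 <= theta -> fisher_le theta (C * (theta^-1 * theta `^ (- d))).
Proof.
move=> /andP[d0 d1] dj hd; set k := deg i0 in hd *.
have dk i : deg i = k.
  by apply/eqP; rewrite eqn_leq hmax -[k]dj hmin.
have qk : 0 <= k%:R + d <= k.+1%:R.
  by rewrite addr_ge0 ?ler0n ?(ltW d0) //= -natr1 lerD2l.
have hd' : 0 < nu + (0 + sg * (k%:R + d)) by rewrite add0r.
have [C1 C10 hC1] := tmom_le_powR b np qk hd'.
have c0 := h0 k ltr01; set c1 := h k 1 in c0.
have [|[i j]|C C0 hC] := @uniform_bound _ (I * I)%type R (fun rho => 0 < rho <= 1)
  (fun ij rho => `|EG rho ij.1 ij.2 + k%:R * Eg rho ij.1 ij.2|)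
  (fun _ rho => rho `^ d * h k rho).
- by move=> ij rho /andP[r0 _]; rewrite mulr_ge0 ?powR_ge0 ?(ltW (h0 _ r0)).
- have vk := @van i j; rewrite !dk addnn uphalf_double in vk.
  have [C C0 hC] := dexpsum_lead D0 vk.
  exists (C * C1 / c1); first by rewrite divr_ge0 ?mulr_ge0 // ltW.
  move=> rho /andP[r0 r1] /=; have r0' := ltW r0.
  have mf : measurable_fun setT (fun a => dexpsum (c i j) D a + k%:R * expsum (c i j) D a).
    apply: measurable_funD; first exact: measurable_dexpsum.
    by apply: measurable_funM => //; exact: measurable_expsum.
  have := wmean_expsum_le (lexx 0) C0 r0 mf hC.
  rewrite wmean_expR0 wmeanD; first last.
  + by apply: wintegrableZ; exact: wintegrable_expsum.
  + exact: wintegrable_dexpsum.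
  rewrite wmeanZ; last exact: wintegrable_expsum.
  move=> h1; apply: le_trans h1 _.
  have h2 : tmom nu sg b 0 k.+1 rho <= C1 * (rho ^+ k * rho `^ d).
    by rewrite -powR_mulrn // -powRD_gt0 //; exact: hC1.
  have h3 : rho ^+ k <= h k rho / c1.
    by rewrite ler_pdivlMr // mulrC; apply: tmom_ge_exp; rewrite ?r0.
  apply: (@le_trans _ _ (C * (C1 * (h k rho / c1 * rho `^ d)))).
    apply: ler_wpM2l => //; apply: le_trans h2 _; apply: ler_wpM2l => //.
    by rewrite ler_wpM2r ?powR_ge0.
  by apply: eqW; ring.
exists (2 * C); first by rewrite mulr_ge0.
move=> theta t1; have t0 : 0 < theta := lt_le_trans ltr01 t1.
have r01 := invsqr_bounds t1; have /andP[r0 r1] := r01.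
apply: (@fisher_leI theta (- k%:R) (C * (theta ^- 2) `^ d) _ i0) => //.
- by rewrite mulr_ge0 ?powR_ge0.
- move=> i j; rewrite mulNr opprK !dk -expr2 sqrtr_sqr (ger0_norm (ltW (h0 _ r0))).
  by rewrite -mulrA; exact: (hC (i, j)).
- rewrite divff ?gt_eqF ?h0 // sqrtr1 mulr1 powR_invsqr //.
  rewrite -!mulrA !(mulrCA _ C) !ler_wpM2l // ?invr_ge0 ?(ltW t0) //.
  rewrite mulrDl mul1r opprD powRD_gt0 // ler_piMl ?powR_ge0 //.
  by apply: powRN_le1 => //; exact: ltW.
Qed.

(** Without a shift the prior is only O(1 / theta); the decay is the square root of the ratio of the
    moments of degrees [deg i0] and [deg j0], which is of order at most [rho] to the power [d]. *)
Lemma fisher_le_gap (d : R) : 0 < d <= 1 -> (deg j0 < deg i0)%N ->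
  0 < nu + sg * ((deg j0)%:R + d) ->
  exists2 C : R, 0 <= C &
    forall theta, 1 <= theta -> fisher_le theta (C * (theta^-1 * theta `^ (- d))).
Proof.
move=> /andP[d0 d1] dj hd; set k := deg j0 in hd dj *.
have qk : 0 <= k%:R + d <= k.+1%:R.
  by rewrite addr_ge0 ?ler0n ?(ltW d0) //= -natr1 lerD2l.
have hd' : 0 < nu + (0 + sg * (k%:R + d)) by rewrite add0r.
have [C1 C10 hC1] := tmom_le_powR b np qk hd'.
have c0 := h0 k ltr01; set c1 := h k 1 in c0.
have [|[i j]|C C0 hC] := @uniform_bound _ (I * I)%type R (fun rho => 0 < rho)
  (fun ij rho => `|EG rho ij.1 ij.2|)
  (fun ij rho => Num.sqrt (h (deg ij.1) rho * h (deg ij.2) rho)).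
- by move=> *; exact: sqrtr_ge0.
- have [C C0 hC] := dexpsum_le D0 (@van i j); exists C => // rho r0.
  have := wmean_expsum_le (lexx 0) C0 r0 (measurable_dexpsum i j) hC.
  rewrite wmean_expR0 => h1; apply: le_trans h1 _.
  by rewrite ler_wpM2l // tmom_uphalf ?h0 // ltW.
exists (2 * C * Num.sqrt (C1 / c1)); first by rewrite !mulr_ge0 ?sqrtr_ge0.
move=> theta t1; have t0 : 0 < theta := lt_le_trans ltr01 t1.
have r01 := invsqr_bounds t1; have /andP[r0 r1] := r01.
have e0 : 0 <= 2 / theta * C by rewrite !mulr_ge0 ?invr_ge0 ?(ltW t0).
apply: (@fisher_leI theta 0 C _ j0) => //.
- by move=> i j; rewrite mul0r subr0; exact: (hC (i, j)).
- rewrite -/k; set rho := theta ^- 2 in r0 r1 *.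
  have h1 : h (deg i0) rho <= C1 * (rho ^+ k * rho `^ d).
    rewrite -powR_mulrn ?(ltW r0) // -powRD_gt0 //; apply: le_trans (hC1 _ r0).
    by apply: tmom_le_deg => //; exact: ltW.
  have h2 : c1 * rho ^+ k <= h k rho by apply: tmom_ge_exp; rewrite ?r0.
  have rk : 0 < rho ^+ k by rewrite exprn_gt0.
  have h3 : h (deg i0) rho / h k rho <= C1 / c1 * rho `^ d.
    rewrite ler_pdivrMr ?h0 //; apply: le_trans h1 _.
    have -> : C1 * (rho ^+ k * rho `^ d) = C1 / c1 * rho `^ d * (c1 * rho ^+ k).
      by field; rewrite gt_eqF.
    by rewrite ler_wpM2l // !mulr_ge0 ?powR_ge0 ?invr_ge0 // ltW.
  have h4 : Num.sqrt (rho `^ d) = theta `^ (- d).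
    rewrite /rho powR_invsqr // -powR12_sqrt ?powR_ge0 // -powRrM.
    by congr (_ `^ _); field.
  apply: le_trans (ler_wpM2l e0 (ler_wsqrtr h3)) _.
  rewrite sqrtrM ?divr_ge0 ?(ltW c0) // h4.
  by apply: eqW; ring.
Qed.

End fisher_rates.

(** * Decay rates for Matern kernels of least degree at least the smoothness *)

Section matern_rates.
Context {R : realType} (I J : finType) (c : I -> I -> J -> R) (D : J -> R).
Context (deg : I -> nat) (i0 j0 : I) (nu : R).
Hypothesis D0 : forall l, 0 <= D l.
Hypothesis nu1 : 1 <= nu.
Hypothesis van : forall i j, vanishing (c i j) D (uphalf (deg i + deg j)).
Hypothesis hmax : forall i, (deg i <= deg i0)%N.
Hypothesis hmin : forall i, (deg j0 <= deg i)%N.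
Let T := mixrate (-1) (ln nu).
Let nu0 : 0 < nu. Proof. exact: lt_le_trans nu1. Qed.
Let np : 0 < nu + 0. Proof. by rewrite addr0. Qed.
Let np1 : 0 < nu + 1. Proof. by rewrite addr_gt0. Qed.

Local Notation h k rho := (tmom nu (-1) (ln nu) 0 k rho).
Local Notation h1 k rho := (tmom nu (-1) (ln nu) 1 k rho).
Local Notation Eg rho i j := (wmean nu (fun t => expsum (c i j) D (rho * T t))).
Local Notation EG rho i j := (wmean nu (fun t => dexpsum (c i j) D (rho * T t))).
Local Notation Es rho i j :=
  (wmean nu (fun t => expR (1 * t) * expsum (c i j) D (rho * T t))).

Let h0 k rho : 0 < rho -> 0 < h k rho. Proof. by move=> r0; exact: tmom_gt0. Qed.

(** Termwise [wmean_by_parts] with [z = rho * nu * D l]. The weight [expR t] raises the Gamma shape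
    from [nu] to [nu + 1], so one more order of moments is finite. *)
Lemma matern_dexpsum rho i j : 0 <= rho -> EG rho i j + nu * Eg rho i j = Es rho i j.
Proof.
move=> r0.
have is_ l : wintegrable nu (fun t => expR (1 * t) * expR (- (rho * T t * D l))).
  apply: (wintegrable_le_exp (C := 1) (p := 1)) => //.
    apply: measurable_funM; first by apply: measurableT_comp => //; exact: measurable_funM.
    apply: measurableT_comp => //; apply: measurableT_comp => //.
    by do 2![apply: measurable_funM => //]; exact: measurable_mixrate.
  move=> t; rewrite [leRHS]mul1r normrM !(ger0_norm (expR_ge0 _)).
  rewrite ler_piMr ?expR_ge0 // -expR0 ler_expR oppr_le0.
  by rewrite !mulr_ge0 // ltW // mixrate_gt0.
rewrite wmean_expsum // wmean_dexpsum // mulr_sumr -big_split /=.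
have is' l : wintegrable nu (fun t => c i j l * (expR (1 * t) * expR (- (rho * T t * D l)))).
  exact: wintegrableZ.
transitivity (wmean nu (fun t => \sum_l c i j l * (expR (1 * t) * expR (- (rho * T t * D l))))).
  rewrite (wmean_sum is'); apply: eq_bigr => l _; rewrite wmeanZ // mulrCA -mulrDr.
  congr (_ * _).
  have z0 : 0 <= rho * nu * D l by rewrite !mulr_ge0 // ltW.
  have e t : rho * T t * D l = rho * nu * D l * expR (- t).
    by rewrite /T /mixrate mulN1r expRD lnK //; ring.
  have ib : wintegrable nu (fun t => expR (- (rho * T t * D l))) by exact: wintegrable_mix.
  have := wmean_by_parts nu0 z0.
  have -> : (fun t => rho * nu * D l * expR (- t) * expR (- (rho * nu * D l * expR (- t)))) =
     (fun t => rho * T t * D l * expR (- (rho * T t * D l))).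
    by apply/funext => t; rewrite e.
  have -> : (fun t => (expR t - nu) * expR (- (rho * nu * D l * expR (- t)))) =
     (fun t => expR (1 * t) * expR (- (rho * T t * D l)) + (- nu) * expR (- (rho * T t * D l))).
    by apply/funext => t; rewrite e mul1r; ring.
  rewrite wmeanD //; last exact: wintegrableZ.
  rewrite wmeanZ // => ->; ring.
congr wmean; apply/funext => t; rewrite /expsum mulr_sumr.
by apply: eq_bigr => l _; rewrite mulrCA.
Qed.

(** With shape [nu + 1] the moment of order [nu + d] is finite because [d < 1], so the weighted
    moment gains the factor [rho] to the power [d] over the lower bound of h_k. *)
Lemma matern_smom_gt k (d : R) : 0 <= d < 1 -> nu + d <= k%:R ->
  exists2 C : R, 0 <= C & forall rho, 0 < rho <= 1 ->
    h1 k rho <= C * rho `^ d * h k rho.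
Proof.
move=> /andP[d0 d1] dk.
have qk : 0 <= nu + d <= k%:R by rewrite dk addr_ge0 // ltW.
have hd : 0 < nu + (1 + -1 * (nu + d)) by lra.
have [C C0 hC] := tmom_le_powR (ln nu) np1 qk hd.
have [c' c0 hc] := matern_tmom_ge nu1 k.
exists (C / c'); first by rewrite divr_ge0 // ltW.
move=> rho r01; have /andP[r0 r1] := r01; apply: le_trans (hC rho r0) _.
rewrite powRD_gt0 //.
have -> : C * (rho `^ nu * rho `^ d) = C / c' * rho `^ d * (c' * rho `^ nu).
  by field; rewrite gt_eqF.
rewrite ler_wpM2l //; last exact: hc.
by rewrite !mulr_ge0 ?powR_ge0 ?invr_ge0 // ltW.
Qed.

(** Here the degree caps the exponent at [nu], and the whole gain is the logarithm in the lower
    bound of h_k. *)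
Lemma matern_smom_eq k : nu = k%:R ->
  exists2 C : R, 0 <= C & forall rho, 0 < rho <= 1 ->
    h1 k rho <= C / (1 - ln rho) * h k rho.
Proof.
move=> dk; have qk : 0 <= nu <= k%:R by rewrite dk lexx ler0n.
have hd : 0 < nu + (1 + -1 * nu) by lra.
have [C C0 hC] := tmom_le_powR (ln nu) np1 qk hd.
have [c' c0 hc] := matern_tmom_ge_ln nu1 dk.
exists (C / c'); first by rewrite divr_ge0 // ltW.
move=> rho r01; have /andP[r0 r1] := r01; apply: le_trans (hC rho r0) _.
have l0 : 0 < 1 - ln rho by have := ln_le0 r1; lra.
have -> : C * rho `^ nu = C / c' / (1 - ln rho) * (c' * (rho `^ nu * (1 - ln rho))).
  by field; rewrite !gt_eqF.
rewrite ler_wpM2l //; last exact: hc.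
by rewrite !mulr_ge0 ?invr_ge0 // ltW.
Qed.

Lemma matern_es_le : exists2 C : R, 0 <= C & forall rho X, 0 < rho -> 0 <= X ->
  (forall i, h1 (deg i) rho <= X * h (deg i) rho) ->
  forall i j, `|Es rho i j| <= C * X * Num.sqrt (h (deg i) rho * h (deg j) rho).
Proof.
have [|[i j]|C C0 hC] := @uniform_bound _ (I * I)%type R (fun rho => 0 < rho)
  (fun ij rho => `|Es rho ij.1 ij.2|)
  (fun ij rho => Num.sqrt (h1 (deg ij.1) rho * h1 (deg ij.2) rho)).
- by move=> *; exact: sqrtr_ge0.
- have [C C0 hC] := expsum_le D0 (@van i j); exists C => // rho r0.
  have := wmean_le_tmom (-1) (ln nu) np1 C0 (ltW r0) (measurable_expsum _ _ i j) hC.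
  move=> h2; apply: le_trans h2 _.
  by rewrite ler_wpM2l // tmom_uphalf ?(ltW r0) // tmom_gt0.
exists C => // rho X r0 X0 hX i j.
apply: le_trans (hC (i, j) _ r0) _; rewrite -mulrA ler_wpM2l //=.
rewrite -[X in _ <= X * _](ger0_norm X0) -sqrtr_sqr -sqrtrM ?sqr_ge0 // ler_wsqrtr //.
rewrite expr2 mulrACA; apply: ler_pM; rewrite ?hX // tmom_ge0 // ltW //.
Qed.

Local Notation L theta := (1 + 2 * ln theta).

Let L1 (theta : R) : 1 <= theta -> 1 <= L theta.
Proof. by move=> t1; have := ln_ge0 t1; lra. Qed.

Lemma matern_shift (theta mu : R) i j : 0 < theta ->
  EG (theta ^- 2) i j - (mu - nu) * Eg (theta ^- 2) i j =
  Es (theta ^- 2) i j - mu * Eg (theta ^- 2) i j.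
Proof.
move=> t0; rewrite -matern_dexpsum; last by rewrite invr_ge0 sqr_ge0.
by ring.
Qed.

(** The likelihood factor is simply bounded by 1; the decay comes from the prior, shifted by [- nu]
    so that only the weighted moments remain. Capping [d] at 1/2 keeps it below 1. *)
Lemma matern_fisher_gt : nu < (deg j0)%:R -> exists2 d : R, 0 < d &
  exists2 C : R, 0 <= C & forall theta, 1 <= theta ->
    fisher_le c D deg i0 nu (-1) (ln nu) theta (C * (theta^-1 * theta `^ (- d))).
Proof.
move=> nd; pose d := Num.min (1 / 2) ((deg j0)%:R - nu).
have d0 : 0 < d by rewrite lt_min subr_gt0 nd divr_gt0.
have d1 : 0 <= d < 1.
  by rewrite (ltW d0) /= gt_min; apply/orP; left; lra.
have dk i : nu + d <= (deg i)%:R.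
  have : (deg j0)%:R <= (deg i)%:R :> R by rewrite ler_nat hmin.
  have : d <= (deg j0)%:R - nu by rewrite ge_min lexx orbT.
  by lra.
exists (2 * d); first by rewrite mulr_gt0.
have [|i|C1 C10 hC1] := @uniform_bound _ I R (fun rho => 0 < rho <= 1)
  (fun i rho => h1 (deg i) rho) (fun i rho => rho `^ d * h (deg i) rho).
- by move=> i rho /andP[r0 _]; rewrite mulr_ge0 ?powR_ge0 // ltW // h0.
- have [C C0 hC] := matern_smom_gt d1 (dk i); exists C => // rho r01.
  by rewrite mulrA; exact: hC.
have [C C0 hC] := matern_es_le.
exists (2 * (C * C1)); first by rewrite !mulr_ge0.
move=> theta t1; have t0 : 0 < theta := lt_le_trans ltr01 t1.
have r01 := invsqr_bounds t1; have /andP[r0 r1] := r01.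
have X0 : 0 <= C1 * (theta ^- 2) `^ d by rewrite mulr_ge0 ?powR_ge0.
apply: (@fisher_leI _ _ _ c D deg i0 nu _ _ nu0 hmax theta (0 - nu)
  (C * (C1 * (theta ^- 2) `^ d)) _ i0) => //; first exact: mulr_ge0.
- move=> i j; rewrite matern_shift // mul0r subr0.
  by apply: hC => // i'; rewrite -mulrA; exact: hC1.
- rewrite divff ?gt_eqF ?h0 // sqrtr1 mulr1 powR_invsqr //.
  by apply: eqW; ring.
Qed.

Lemma matern_smom_le : nu = (deg j0)%:R -> exists2 C : R, 0 <= C & forall theta i,
  1 <= theta -> h1 (deg i) (theta ^- 2) <= C / L theta * h (deg i) (theta ^- 2).
Proof.
move=> nd.
have [|i|C1 C10 hC1] := @uniform_bound _ I R (fun theta => 1 <= theta)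
  (fun i theta => h1 (deg i) (theta ^- 2))
  (fun i theta => (L theta)^-1 * h (deg i) (theta ^- 2)); last first.
- by exists C1 => // theta i t1; rewrite -mulrA; exact: hC1.
- have [e|ne] := eqVneq (deg i) (deg j0).
    have [C C0 hC] := matern_smom_eq nd.
    exists C => // theta t1; have r01 := invsqr_bounds t1.
    have := hC _ r01; rewrite ln_invsqr ?(lt_le_trans ltr01 t1) // opprK.
    by rewrite e mulrA.
  have dj : (deg j0 < deg i)%N by rewrite ltn_neqAle eq_sym ne hmin.
  have dk : nu + 1 / 2 <= (deg i)%:R.
    have : (deg j0).+1%:R <= (deg i)%:R :> R by rewrite ler_nat.
    by rewrite -natr1 -nd; lra.
  have d01 : 0 <= (1 / 2 : R) < 1 by rewrite divr_ge0 //=; lra.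
  have [C C0 hC] := matern_smom_gt d01 dk.
  have [C2 C20 hC2] := powRN_le_ln (ltr01 : 0 < (1 : R)).
  exists (C * C2); first by rewrite mulr_ge0.
  move=> theta t1; have r01 := invsqr_bounds t1; have l1 := L1 t1.
  have t0 : 0 < theta := lt_le_trans ltr01 t1.
  have /andP[r0 _] := r01; apply: le_trans (hC _ r01) _.
  rewrite mulrA ler_wpM2r ?(ltW (h0 _ r0)) // -mulrA ler_wpM2l //.
  have l0 : 0 < L theta := lt_le_trans ltr01 l1.
  rewrite ler_pdivlMr //; apply: le_trans (hC2 theta t1).
  rewrite powR_invsqr // mul1r mulfV // ler_wpM2l ?powR_ge0 //.
  by rewrite expr2 ler_peMl // ltW.
- move=> i theta t1; have /andP[r0 _] := invsqr_bounds t1.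
  by rewrite mulr_ge0 ?(ltW (h0 _ r0)) // invr_ge0 (le_trans ler01) // L1.
Qed.

(** Two logarithmic gains multiply: [1 / L] from the prior shifted by [- nu], and the square root of
    [1 / L] from the likelihood, because the moment of degree [deg i0] carries no logarithm while
    that of degree [deg j0 = nu] does. *)
Lemma matern_fisher_gap : nu = (deg j0)%:R -> (deg j0 < deg i0)%N ->
  exists2 C : R, 0 <= C & forall theta, 1 <= theta ->
    fisher_le c D deg i0 nu (-1) (ln nu) theta
      (C * (theta^-1 * (L theta * Num.sqrt (L theta))^-1)).
Proof.
move=> nd dj.
have [C C0 hC] := matern_es_le; have [C1 C10 hC1] := matern_smom_le nd.
have [c' c0 hc] := matern_tmom_ge_ln nu1 nd.
have dk : nu + 1 <= (deg i0)%:R by rewrite nd natr1 ler_nat.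
have [C2 C20 hC2] := matern_tmom_le nu1 dk.
exists (2 * (C * C1) * Num.sqrt (C2 / c')); first by rewrite !mulr_ge0 ?sqrtr_ge0.
move=> theta t1; have t0 : 0 < theta := lt_le_trans ltr01 t1.
have r01 := invsqr_bounds t1; have /andP[r0 r1] := r01.
have l0 : 0 < L theta := lt_le_trans ltr01 (L1 t1).
have X0 : 0 <= C1 / L theta by rewrite divr_ge0 // ltW.
apply: (@fisher_leI _ _ _ c D deg i0 nu _ _ nu0 hmax theta (0 - nu)
  (C * (C1 / L theta)) _ j0) => //; first exact: mulr_ge0.
- move=> i j; rewrite matern_shift // mul0r subr0.
  by apply: hC => // i'; exact: hC1.
- have hq : h (deg i0) (theta ^- 2) / h (deg j0) (theta ^- 2) <= C2 / c' / L theta.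
    rewrite ler_pdivrMr ?h0 //; apply: le_trans (hC2 _ r0) _.
    have := hc _ r01; rewrite ln_invsqr // opprK => h2.
    have -> : C2 * (theta ^- 2) `^ nu =
       C2 / c' / L theta * (c' * ((theta ^- 2) `^ nu * L theta)).
      by field; rewrite !gt_eqF.
    by rewrite ler_wpM2l // !mulr_ge0 ?invr_ge0 // ltW.
  have e0 : 0 <= 2 / theta * (C * (C1 / L theta)).
    by rewrite mulr_ge0 ?divr_ge0 ?(ltW t0) // mulr_ge0.
  apply: le_trans (ler_wpM2l e0 (ler_wsqrtr hq)) _.
  rewrite sqrtrM ?divr_ge0 ?(ltW c0) // sqrtrV ?(ltW l0) // invfM.
  by apply: eqW; ring.
Qed.

(** The multiplier [h1 k / h k] cancels the leading coefficient [g] exactly. What remains involves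
    moments of degree [k.+1]: h_(k + 1) is smaller than h_k by a factor [L], and a second factor [L]
    comes from the multiplier or from the weighted moment. *)
Lemma matern_remainder i j : nu = (uphalf (deg i + deg j))%:R ->
  exists2 C : R, 0 <= C & forall theta, 1 <= theta ->
    let k := uphalf (deg i + deg j) in let rho := theta ^- 2 in
    `|Es rho i j - h1 k rho / h k rho * Eg rho i j| <= C * (L theta) ^- 2 * h k rho.
Proof.
move=> nk; set k := uphalf _ in nk *.
have [g [C C0 hC]] := expsum_lead_min D0 (@van i j).
have dk : nu + 1 <= k.+1%:R by rewrite nk natr1.
have dk2 : nu + 1 / 2 <= k.+1%:R by lra.
have d01 : 0 <= (1 / 2 : R) < 1 by rewrite divr_ge0 //=; lra.
have [C1 C10 hC1] := matern_smom_eq nk.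
have [C2 C20 hC2] := matern_tmom_le nu1 dk.
have [C3 C30 hC3] := matern_smom_gt d01 dk2.
have [C4 C40 hC4] := powRN_le_ln (ltr01 : 0 < (1 : R)).
have [c' c0 hc] := matern_tmom_ge_ln nu1 nk.
exists (C * (C3 * C4 + C1) * C2 / c').
  by rewrite divr_ge0 ?(ltW c0) // !mulr_ge0 // addr_ge0 // mulr_ge0.
move=> theta t1 /=; set rho := theta ^- 2.
have t0 : 0 < theta := lt_le_trans ltr01 t1.
have r01 := invsqr_bounds t1; have /andP[r0 r1] := r01.
have l1 := L1 t1; have l0 : 0 < L theta := lt_le_trans ltr01 l1.
have lnr : 1 - ln rho = L theta by rewrite ln_invsqr // opprK.
pose q a := expsum (c i j) D a - g * Num.min 1 a ^+ k.
have mq : measurable_fun setT q.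
  apply: measurable_funB; first exact: measurable_expsum.
  apply: measurable_funM => //; apply: measurable_funX.
  by apply: measurable_minr.
have qE p : 0 <= p -> wmean nu (fun t => expR (p * t) * expsum (c i j) D (rho * T t)) =
    wmean nu (fun t => expR (p * t) * q (rho * T t)) + g * tmom nu (-1) (ln nu) p k rho.
  move=> p0; have npp : 0 < nu + p by rewrite ltr_wpDr.
  have it q' := tmom_integrable (-1) (ln nu) q' npp (ltW r0).
  rewrite /tmom -wmeanZ // -wmeanD; first last.
  - exact: wintegrableZ.
  - apply: wintegrable_dom (wintegrableZ C (it k.+1)).
      apply: measurable_funM; last exact: measurable_comp_mixrate.
      by apply: measurableT_comp => //; exact: measurable_funM.
    move=> t; rewrite normrM (ger0_norm (expR_ge0 _)) mulrCA ler_wpM2l ?expR_ge0 //.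
    by apply: hC; rewrite mulr_ge0 ?(ltW r0) // ltW // mixrate_gt0.
  by congr wmean; apply/funext => t; rewrite /q; ring.
have e1 := qE 1 ler01; have e0 := qE 0 (lexx 0).
rewrite wmean_expR0 in e0; rewrite e1 e0.
have hk0 := h0 k r0.
have alg (a b u v : R) : 0 < v -> a + g * u - u / v * (b + g * v) = a - u / v * b.
  by move=> v0; field; rewrite gt_eqF.
rewrite (alg _ _ _ _ hk0); set A := wmean _ _; set B := wmean _ _.
have bA : `|A| <= C * h1 k.+1 rho by exact: wmean_le_tmom (ltW r0) mq hC.
have bB : `|B| <= C * h k.+1 rho by exact: wmean_le_tmom (ltW r0) mq hC.
have hmu : h1 k rho / h k rho <= C1 / L theta.
  by rewrite ler_pdivrMr // -lnr; exact: hC1.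
have mu0 : 0 <= h1 k rho / h k rho.
  exact: divr_ge0 (tmom_ge0 _ _ _ _ _ (ltW r0)) (ltW hk0).
have hk1 := hC2 rho r0.
have hk1' : 0 <= h k.+1 rho := ltW (h0 _ r0).
have ht : rho `^ (1 / 2) <= C4 / L theta.
  rewrite ler_pdivlMr //; apply: le_trans (hC4 theta t1).
  rewrite /rho powR_invsqr // mul1r mulfV // ler_wpM2l ?powR_ge0 //.
  by rewrite expr2 ler_peMl // ltW.
have hs : h1 k.+1 rho <= C3 * (C4 / L theta) * h k.+1 rho.
  apply: le_trans (hC3 rho r01) _.
  by rewrite ler_wpM2r // ler_wpM2l.
have X0 : 0 <= C * ((C3 * C4 + C1) / L theta).
  by rewrite mulr_ge0 // divr_ge0 ?(ltW l0) // addr_ge0 // mulr_ge0.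
have h2 := hc rho r01; rewrite lnr in h2.
apply: le_trans (ler_normB _ _) _.
apply: (@le_trans _ _ (C * ((C3 * C4 + C1) / L theta) * h k.+1 rho)).
  have -> : C * ((C3 * C4 + C1) / L theta) * h k.+1 rho =
    C * (C3 * (C4 / L theta) * h k.+1 rho) + C1 / L theta * (C * h k.+1 rho) by ring.
  apply: lerD; first by apply: le_trans bA _; rewrite ler_wpM2l.
  by rewrite normrM (ger0_norm mu0); apply: ler_pM.
apply: le_trans (ler_wpM2l X0 hk1) _.
have -> : C * ((C3 * C4 + C1) / L theta) * (C2 * rho `^ nu) =
   C * (C3 * C4 + C1) * C2 / c' * L theta ^- 2 * (c' * (rho `^ nu * L theta)).
  by field; rewrite !gt_eqF.
rewrite ler_wpM2l // mulr_ge0 ?invr_ge0 ?sqr_ge0 // divr_ge0 ?(ltW c0) //.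
by rewrite !mulr_ge0 // addr_ge0 // mulr_ge0.
Qed.

Lemma matern_fisher_const : nu = (deg j0)%:R -> deg j0 = deg i0 ->
  exists2 C : R, 0 <= C & forall theta, 1 <= theta ->
    fisher_le c D deg i0 nu (-1) (ln nu) theta
      (C * (theta^-1 * (L theta * Num.sqrt (L theta))^-1)).
Proof.
move=> nd dj; have dk i : deg i = deg i0.
  by apply/eqP; rewrite eqn_leq hmax -dj hmin.
have uk i j : uphalf (deg i + deg j) = deg i0 by rewrite !dk addnn uphalf_double.
set k := deg i0 in dk uk dj.
have [|[i j]|C C0 hC] := @uniform_bound _ (I * I)%type R (fun theta => 1 <= theta)
  (fun ij theta => `|Es (theta ^- 2) ij.1 ij.2 -
     h1 k (theta ^- 2) / h k (theta ^- 2) * Eg (theta ^- 2) ij.1 ij.2|)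
  (fun _ theta => L theta ^- 2 * h k (theta ^- 2)).
- move=> ij theta t1; have /andP[r0 _] := invsqr_bounds t1.
  by rewrite mulr_ge0 ?(ltW (h0 _ r0)) // invr_ge0 sqr_ge0.
- have [|C C0 hC] := @matern_remainder i j; first by rewrite uk -dj.
  by exists C => // theta t1; have := hC theta t1; rewrite /= uk mulrA.
exists (2 * C); first by rewrite mulr_ge0.
move=> theta t1; have t0 : 0 < theta := lt_le_trans ltr01 t1.
have r01 := invsqr_bounds t1; have /andP[r0 r1] := r01.
have l1 := L1 t1; have l0 : 0 < L theta := lt_le_trans ltr01 l1.
apply: (@fisher_leI _ _ _ c D deg i0 nu _ _ nu0 hmax theta
  (h1 k (theta ^- 2) / h k (theta ^- 2) - nu) (C * L theta ^- 2) _ i0) => //.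
- by rewrite mulr_ge0 // invr_ge0 sqr_ge0.
- move=> i j; rewrite matern_shift // !dk -expr2 sqrtr_sqr (ger0_norm (ltW (h0 _ r0))).
  by rewrite -[leRHS]mulrA; exact: (hC (i, j)).
- rewrite divff ?gt_eqF ?h0 // sqrtr1 mulr1.
  (* The power -2 of [L] is relaxed to -3/2, the rate of the case of distinct degrees, as
     [L >= 1]. *)
  have -> : 2 / theta * (C * L theta ^- 2) = 2 * C * (theta^-1 * L theta ^- 2) by ring.
  rewrite ler_wpM2l ?mulr_ge0 // ler_wpM2l ?invr_ge0 ?(ltW t0) //.
  have sl : 0 < Num.sqrt (L theta) by rewrite sqrtr_gt0.
  rewrite lef_pV2 ?posrE ?exprn_gt0 ?mulr_gt0 // expr2 ler_pM2l //.
  rewrite -[X in _ <= X](sqr_sqrtr (ltW l0)) expr2 ler_peMr ?(ltW sl) //.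
  by rewrite -[leLHS]sqrtr1 ler_wsqrtr.
Qed.

End matern_rates.

(** * An explicit integrable majorant *)

Section rate_integral.
Context {R : realType}.
Let mu := @lebesgue_measure R.

Lemma mulr_sqrt_powR (y : R) : 0 < y -> (y * Num.sqrt y)^-1 = y `^ (- (3 / 2)).
Proof.
move=> y0; rewrite powRN -powR12_sqrt ?(ltW y0) // -[X in X * _](powRr1 (ltW y0)).
by rewrite -powRD_gt0 //; congr (_ `^ _)^-1; field.
Qed.

(* Integrable on ]0, +oo[, through the primitive
   [- A / (1 + theta^(2 e)) - 2 B / sqrt (1 + ln (1 + theta))]. *)
Definition rate (e A B theta : R) : R :=
  A * (2 * e * theta `^ (2 * e - 1) / (1 + theta `^ (2 * e)) ^+ 2) +
  B * ((1 + ln (1 + theta)) `^ (- (3 / 2)) / (1 + theta)).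

Lemma rate_integral_le (e A B : R) : 0 < e -> 0 <= A -> 0 <= B ->
  (\int[mu]_(theta in `]0%R, +oo[) (rate e A B theta)%:E <= (2 * (A + 2 * B))%:E)%E.
Proof.
move=> e0 A0 B0.
pose F theta := - A * (1 + theta `^ (2 * e))^-1 +
  (- 2 * B) * (1 + ln (1 + theta)) `^ (- (1 / 2)).
have l0 (theta : R) : 0 < theta -> 1 <= 1 + ln (1 + theta).
  by move=> t0; rewrite lerDl ln_ge0 // lerDl ltW.
have p0 theta : 0 < 1 + theta `^ (2 * e) :> R by rewrite ltr_pwDl ?powR_ge0.
have dln (theta : R) : 0 < theta ->
    is_derive theta 1 (fun t => 1 + ln (1 + t)) (1 + theta)^-1.
  move=> t0; have t1 : 0 < 1 + 1 * theta by rewrite mul1r addr_gt0.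
  have h := @is_derive1_comp R (@ln R) (fun t => 1 + 1 * t) theta _ _
    (is_derive1_ln t1) (is_derive_affine 1 1 theta).
  have h2 : is_derive theta 1 (cst (1 : R)) (0 : R) := is_derive_cst _ _ _.
  have := is_deriveD h2 h; rewrite add0r mulr1 mul1r.
  by congr is_derive; apply/funext => u; rewrite !fctE mul1r.
have dpw (theta : R) : 0 < theta ->
    is_derive theta 1 (fun t => 1 + t `^ (2 * e)) (2 * e * theta `^ (2 * e - 1)).
  move=> t0; have h2 : is_derive theta 1 (cst (1 : R)) (0 : R) := is_derive_cst _ _ _.
  by have := is_deriveD h2 (is_derive1_powR (2 * e) t0); rewrite add0r.
apply: (integral0y_le (F := F)).
- move=> theta t0; rewrite addr_ge0 // mulr_ge0 //.
    by rewrite !mulr_ge0 ?invr_ge0 ?sqr_ge0 ?powR_ge0 ?(ltW e0).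
  by rewrite divr_ge0 ?powR_ge0 // addr_ge0 // ltW.
- move=> theta t0; have c1 := is_derive_continuous (dpw _ t0).
  have c2 := is_derive_continuous (dln _ t0).
  apply: cvgD; (apply: cvgM; first exact: cvg_cst).
    apply: cvgM; first by apply: cvgM; [exact: cvg_cst|exact: continuous_powR_gt0].
    apply: cvgV; first by rewrite expf_neq0 // gt_eqF.
    by apply: cvgM; exact: c1.
  apply: cvgM.
    have l1 : 0 < 1 + ln (1 + theta) by exact: lt_le_trans (l0 _ t0).
    exact: is_derive_continuous (is_derive_powR_comp _ (dln _ t0) l1).
  apply: cvgV; first by rewrite gt_eqF // addr_gt0.
  by apply: cvgD; [exact: cvg_cst|exact: cvg_id].
- move=> theta t0; have l1 : 0 < 1 + ln (1 + theta) by exact: lt_le_trans (l0 _ t0).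
  have d1 := is_deriveV (f := fun t : R => 1 + t `^ (2 * e)) (lt0r_neq0 (p0 theta)) (dpw _ t0).
  have d2 := is_derive_powR_comp (- (1 / 2)) (dln _ t0) l1.
  apply: (is_derive_eq (is_deriveD (is_deriveZ (- A) d1) (is_deriveZ (- 2 * B) d2))).
  rewrite /rate /GRing.scale /=.
  have -> : - (1 / 2) - 1 = - (3 / 2) :> R by field.
  by field; rewrite !gt_eqF // addr_gt0.
- move=> theta t0; apply: le_trans (ler_normD _ _) _; apply: lerD.
    rewrite normrM normrN (ger0_norm A0) ler_piMr //.
    by rewrite gtr0_norm ?invr_gt0 // invf_le1 // lerDl powR_ge0.
  have B2 : 0 <= 2 * B by rewrite mulr_ge0.
  rewrite normrM mulNr normrN (ger0_norm B2) ler_piMr // ger0_norm ?powR_ge0 //.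
  by apply: powRN_le1; [exact: l0|exact: divr_ge0].
Qed.

(** For [theta <= 1] the squared denominator is at most 4, which is exactly what [2 / e] times
    [2 * e] compensates. *)
Lemma rate_ge_small (e A B theta : R) : 0 < e -> 0 <= A -> 0 <= B -> 0 < theta <= 1 ->
  A * theta `^ (2 * e - 1) <= rate e (2 / e * A) B theta.
Proof.
move=> e0 A0 B0 /andP[t0 t1].
have p1 : theta `^ (2 * e) <= 1.
  rewrite -[leRHS](powRr0 theta); apply: ger_powR; rewrite ?t0 //.
  by rewrite mulr_ge0 // ltW.
have p0 := powR_ge0 theta (2 * e).
have q0 : 0 < (1 + theta `^ (2 * e)) ^+ 2 by rewrite exprn_gt0 // ltr_pwDl.
apply: ler_wpDr.
  rewrite mulr_ge0 // divr_ge0 ?powR_ge0 // addr_ge0 // ltW //.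
have -> : 2 / e * A * (2 * e * theta `^ (2 * e - 1) / (1 + theta `^ (2 * e)) ^+ 2) =
   A * theta `^ (2 * e - 1) * (4 / (1 + theta `^ (2 * e)) ^+ 2).
  by field; rewrite !gt_eqF // ltr_pwDl.
rewrite ler_peMr ?mulr_ge0 ?powR_ge0 // ler_pdivlMr // mul1r.
by nra.
Qed.

(** The 8 is [4 * 2]: [1 + theta <= 2 * theta] costs 2, and [1 + ln (1 + theta) <= 2 * (1 + 2 * ln
    theta)], raised to the power 3/2, costs at most [2 ^+ 2]. *)
Lemma rate_ge_large (e A B theta : R) : 0 < e -> 0 <= A -> 0 <= B -> 1 <= theta ->
  B * (theta^-1 * ((1 + 2 * ln theta) * Num.sqrt (1 + 2 * ln theta))^-1) <=
  rate e A (8 * B) theta.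
Proof.
move=> e0 A0 B0 t1; have t0 : 0 < theta := lt_le_trans ltr01 t1.
have l0 := ln_ge0 t1; have L0 : 0 < 1 + 2 * ln theta by lra.
apply: ler_wpDl.
  by rewrite !mulr_ge0 ?invr_ge0 ?sqr_ge0 ?powR_ge0 // ltW.
have M1 : 0 < 1 + theta by rewrite addr_gt0.
have M0 : 0 < 1 + ln (1 + theta).
  by rewrite ltr_pwDl // ln_ge0 // lerDl ltW.
have ML : 1 + ln (1 + theta) <= 2 * (1 + 2 * ln theta).
  have : ln (1 + theta) <= ln (2 * theta) by rewrite ler_ln ?posrE ?mulr_gt0 //; lra.
  have : ln 2 <= 1 :> R by have := @le_ln1Dx R 1; rewrite -natr1 => h; apply: h; lra.
  by rewrite lnM ?posrE //; lra.
have hM : 4^-1 * (1 + 2 * ln theta) `^ (- (3 / 2)) <= (1 + ln (1 + theta)) `^ (- (3 / 2)).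
  apply: (@le_trans _ _ ((2 * (1 + 2 * ln theta)) `^ (- (3 / 2)))).
    rewrite powRM ?(ltW L0) // ler_wpM2r ?powR_ge0 // powRN lef_pV2 ?posrE ?powR_gt0 //.
    have -> : 4 = (2 : R) `^ 2%:R by rewrite powR_mulrn // expr2; ring.
    by apply: ler_powR; lra.
  rewrite !powRN lef_pV2 ?posrE ?powR_gt0 ?mulr_gt0 //.
  by apply: ge0_ler_powR; rewrite ?nnegrE ?(ltW M0) ?mulr_ge0 ?(ltW L0) // divr_ge0.
have ht : (2 * theta)^-1 <= (1 + theta)^-1.
  by rewrite lef_pV2 ?posrE ?mulr_gt0 //; lra.
rewrite mulr_sqrt_powR //; set p := _ `^ _ in hM *; set q := _ `^ _ in hM *.
have p0 : 0 <= p by exact: powR_ge0.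
have p4 : 0 <= 4^-1 * p by rewrite mulr_ge0.
have t2 : 0 <= (2 * theta)^-1 by rewrite invr_ge0 mulr_ge0 // ltW.
have -> : B * (theta^-1 * p) = 8 * B * (4^-1 * p * (2 * theta)^-1).
  by field; rewrite gt_eqF.
by rewrite ler_wpM2l ?mulr_ge0 //; exact: ler_pM.
Qed.

End rate_integral.

(** * A common rate at infinity for all kernels *)

Section fisher_rate.
Context {R : realType} (I J : finType) (c : I -> I -> J -> R) (D : J -> R).
Context (deg : I -> nat) (i0 j0 : I) (nu sg b : R).
Hypothesis D0 : forall l, 0 <= D l.
Hypothesis nu0 : 0 < nu.
Hypothesis van : forall i j, vanishing (c i j) D (uphalf (deg i + deg j)).
Hypothesis hmax : forall i, (deg i <= deg i0)%N.
Hypothesis hmin : forall i, (deg j0 <= deg i)%N.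

Lemma fisher_le_mono theta (B B' : R) : B <= B' ->
  fisher_le c D deg i0 nu sg b theta B -> fisher_le c D deg i0 nu sg b theta B'.
Proof.
move=> BB' [lam [eta [e0 h1 h2]]]; exists lam, eta; split=> //.
exact: le_trans BB'.
Qed.

Local Notation L theta := (1 + 2 * ln theta).

(** The slowest decay met, chosen as common target; it is integrable at infinity because the
    exponent 3/2 of the logarithm exceeds 1. *)
Definition fisher_log_rate : Prop := exists2 C : R, 0 <= C &
  forall theta, 1 <= theta -> fisher_le c D deg i0 nu sg b theta
    (C * (theta^-1 * (L theta * Num.sqrt (L theta))^-1)).

Lemma fisher_log_rate_powR (d : R) : 0 < d ->
  (exists2 C : R, 0 <= C & forall theta, 1 <= theta ->
    fisher_le c D deg i0 nu sg b theta (C * (theta^-1 * theta `^ (- d)))) ->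
  fisher_log_rate.
Proof.
move=> d0 [C C0 hC]; have [C2 C20 hC2] := powRN_le_ln d0.
exists (C * C2) => [|theta t1]; first by rewrite mulr_ge0.
apply: fisher_le_mono (hC theta t1).
have t0 : 0 < theta := lt_le_trans ltr01 t1.
have l1 : 1 <= L theta by have := ln_ge0 t1; lra.
have l0 : 0 < L theta := lt_le_trans ltr01 l1.
have sl : 0 < Num.sqrt (L theta) by rewrite sqrtr_gt0.
rewrite -[leRHS]mulrA ler_wpM2l // mulrCA ler_wpM2l ?invr_ge0 ?(ltW t0) //.
rewrite ler_pdivlMr ?mulr_gt0 //; apply: le_trans (hC2 theta t1).
rewrite ler_wpM2l ?powR_ge0 // expr2 ler_wpM2l ?(ltW l0) //.
rewrite -[leRHS](sqr_sqrtr (ltW l0)) expr2 ler_peMr ?(ltW sl) //.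
by rewrite -[leLHS]sqrtr1 ler_wsqrtr.
Qed.

(** A finite moment of T of order slightly above the least degree is all that the non-critical cases
    require, whether or not the degrees are equal. *)
Lemma fisher_log_rate_moment (d : R) : 0 < d <= 1 ->
  0 < nu + sg * ((deg j0)%:R + d) -> fisher_log_rate.
Proof.
move=> d01 hd; have /andP[d0 d1] := d01; apply: (fisher_log_rate_powR d0).
have [dj|dj] := eqVneq (deg j0) (deg i0).
  by apply: (fisher_le_const_deg b D0 nu0 van hmax hmin d01 dj); rewrite -dj.
by apply: (fisher_le_gap b D0 nu0 van hmax d01 _ hd); rewrite ltn_neqAle dj hmin.
Qed.

Lemma fisher_log_rate_ge0 : 0 <= sg -> fisher_log_rate.
Proof.
move=> s0; apply: (@fisher_log_rate_moment 1); first by rewrite ltr01 lexx.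
by rewrite ltr_wpDr // mulr_ge0 // addr_ge0.
Qed.

Lemma fisher_log_rate_matern : 1 <= nu -> sg = -1 -> b = ln nu -> fisher_log_rate.
Proof.
move=> nu1 es eb; have [nd|nd] := ltP (deg j0)%:R nu.
  (* Half the room between the least degree and [nu], so that the moment of order [deg j0 + d] is
     finite. *)
  pose d := Num.min 1 ((nu - (deg j0)%:R) / 2).
  have d0 : 0 < d by rewrite lt_min ltr01 divr_gt0 // subr_gt0.
  have d1 : d <= 1 by rewrite ge_min lexx.
  have d2 : d <= (nu - (deg j0)%:R) / 2 by rewrite ge_min lexx orbT.
  apply: (@fisher_log_rate_moment d); first by rewrite d0.
  by rewrite es; lra.
rewrite /fisher_log_rate es eb; move: nd; rewrite le_eqVlt => /predU1P[nd|nd].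
  have [dj|dj] := eqVneq (deg j0) (deg i0).
    exact: (matern_fisher_const D0 nu1 van hmax hmin nd dj).
  by apply: (matern_fisher_gap D0 nu1 van hmax hmin nd); rewrite ltn_neqAle dj hmin.
have [d d0 h] := matern_fisher_gt D0 nu1 van hmax hmin nd.
rewrite -es -eb; apply: (fisher_log_rate_powR d0); rewrite es eb.
exact: h.
Qed.

End fisher_rate.

(** * Propriety for mixtures, and the hyperplane *)

Section propriety.
Context {R : realType}.
Let mu := @lebesgue_measure R.

Lemma integral_cV_ge0 k (f : 'cV[R]_k -> \bar R) : (forall v, (0 <= f v)%E) ->
  (0 <= integral_cV f)%E.
Proof.
elim: k f => [|k IH] f f0 /=; first exact: f0.
by apply: integral_ge0 => t _; exact: IH.
Qed.

Lemma posterior_ge0 n p m (H : 'M[R]_(n, p)) (S : R -> 'M[R]_n) (SW : R -> 'M[R]_m)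
    (y : 'cV[R]_n) theta :
  (0 <= integrated_likelihood H S y theta * (reference_prior SW theta)%:E)%E.
Proof.
apply: mule_ge0; last by rewrite lee_fin sqrtr_ge0.
apply: integral_ge0 => t /=; rewrite in_itv /= andbT => t0.
rewrite mule_ge0 ?lee_fin ?invr_ge0 ?(ltW t0) //.
apply: integral_cV_ge0 => v; rewrite lee_fin.
by rewrite !mulr_ge0 ?powR_ge0 ?expR_ge0.
Qed.

Lemma dim_lker_row n (w : 'rV[R]_n) : w != 0 ->
  \dim (lker (linfun (mulmx w : 'cV[R]_n -> 'M[R]_1))) = (n - 1)%N.
Proof.
move=> w0; set f := linfun _.
have := limg_ker_dim f fullv; rewrite capfv dimvf /dim /= muln1.
suff -> : \dim (f @: fullv) = 1%N.
  by move: (\dim (lker f)) => d h; rewrite -h addnK.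
apply/eqP; rewrite eqn_leq; apply/andP; split.
  by apply: leq_trans (dimvS (subvf _)) _; rewrite dimvf /dim /= mul1n.
rewrite lt0n dimv_eq0; apply: contra w0 => /eqP h.
apply/eqP/rowP => j; rewrite [RHS]mxE.
have : f (delta_mx j 0) \in (f @: fullv)%VS by rewrite memv_img // memvf.
rewrite h memv0 lfunE /= -colE => /eqP /matrixP /(_ 0 0).
by rewrite !mxE.
Qed.

Section mixture.
Context (r n p m : nat) (x : 'I_n -> 'rV[R]_r) (H : 'M[R]_(n, p)) (W : 'M[R]_(n, m)).
Context (nu sg b : R) (K : R -> R).
Hypothesis nu0 : 0 < nu.
Hypothesis sg1 : sg <= 1.
Hypothesis hsg : 0 <= sg \/ [/\ 1 <= nu, sg = -1 & b = ln nu].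
Hypothesis hK : forall tau, 0 <= tau ->
  K tau = (wmean nu (cst 1))^-1 *
    wmean nu (fun t => expR (- (tau ^+ 2 * mixrate sg b t))).
Hypothesis xinj : injective x.
Hypothesis npm : n = (p + m)%N.
Hypothesis m0 : (0 < m)%N.
Hypothesis hH : \rank H = p.
Hypothesis hW : W^T *m W = 1%:M.
Hypothesis hHW : H^T *m W = 0.

Lemma posterior_proper : exists w : 'rV[R]_n, w != 0 /\
  forall y : 'cV[R]_n, w *m y != 0 ->
  (\int[mu]_(theta in `]0%R, +oo[)
     (integrated_likelihood H (corr_mx K x) y theta
      * (reference_prior (proj_mx_fun W (corr_mx K x)) theta)%:E) < +oo)%E.
Proof.
have [U [deg [uU hge hz]]] := adapted_kernel_basis xinj hW.
have i1 : 'I_m := Ordinal m0.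
have [i0 _ max0] := arg_maxnP deg (erefl : xpredT i1).
have [j0 _ min0] := arg_minnP deg (erefl : xpredT i1).
have hmax i : (deg i <= deg i0)%N by exact: max0.
have hmin i : (deg j0 <= deg i)%N by exact: min0.
have van i j : vanishing (pair_coef W U i j) (pair_sqdist x) (uphalf (deg i + deg j)).
  move=> q; rewrite ltnNge leq_uphalf_double -ltnNge => /(hz i j q) h.
  by rewrite -[RHS]h pair_bigA.
have D0 l : 0 <= pair_sqdist x l by exact: sqdist_ge0.
pose Z := wmean nu (cst 1); have Z0 : 0 < Z := wmean1_gt0 nu0.
exists ((col i0 U)^T *m W^T); split.
  apply/eqP => /(congr1 trmx); rewrite trmx_mul !trmxK trmx0 => h.
  have : invmx U *m (W^T *m (W *m col i0 U)) = 0 by rewrite h !mulmx0.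
  rewrite (mulmxA W^T) hW mul1mx colE mulmxA mulVmx // mul1mx => /matrixP /(_ i0 0).
  by rewrite !mxE !eqxx => /eqP; rewrite oner_eq0.
move=> y hy.
have kap0 : ((col i0 U)^T *m (W^T *m y)) 0 0 != 0.
  apply: contraNneq hy; rewrite mulmxA => h; apply/eqP/matrixP => i j.
  by rewrite !ord1 h mxE.
have vani0 : vanishing (pair_coef W U i0 i0) (pair_sqdist x) (deg i0).
  by have := van i0 i0; rewrite addnn uphalf_double.
have [C C0 hC] := posterior_le nu0 hK xinj npm m0 hH hW hHW uU hge vani0 kap0.
have post theta B : 0 < theta ->
    fisher_le (pair_coef W U) (pair_sqdist x) deg i0 nu sg b theta B ->
    (integrated_likelihood H (corr_mx K x) y theta
      * (reference_prior (proj_mx_fun W (corr_mx K x)) theta)%:E <= (C * (Z^-1 * B))%:E)%E.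
  move=> t0 [lam [eta [eta0 h1 h2]]].
  have e0 : 0 <= Z^-1 * eta by rewrite mulr_ge0 // invr_ge0 ltW.
  apply: le_trans (hC theta lam (Z^-1 * eta) t0 e0 _) _.
    move=> i j; rewrite mulmxBr mulmxBl -scalemxAr -scalemxAl.
    have sub_entry (M1 M2 : 'M[R]_m) : (M1 - lam *: M2) i j = M1 i j - lam * M2 i j.
      by rewrite !mxE.
    rewrite sub_entry (deriv_corr_entry x W nu0 hK U i j t0).
    rewrite (proj_corr_entry x W nu0 hK U i j t0).
    have alg (z a u v : R) : z * a * u - lam * (z * v) = z * (a * u - lam * v) by ring.
    have Z1 : 0 < Z^-1 by rewrite invr_gt0.
    by rewrite alg normrM (gtr0_norm Z1) -[leRHS]mulrA ler_pM2l.
  by rewrite lee_fin ler_pM2l // -mulrA ler_pM2l ?invr_gt0.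
(* Small enough for E T^(- e) to be finite for every slope: [sg * e <= e <= nu / 2 < nu]. *)
pose e := Num.min 1 (nu / 2).
have e0 : 0 < e by rewrite lt_min ltr01 divr_gt0.
have e1 : e <= 1 by rewrite ge_min lexx.
have e2 : e <= nu / 2 by rewrite ge_min lexx orbT.
have he : 0 < nu - sg * e.
  have : sg * e <= 1 * e by rewrite ler_pM2r.
  by lra.
have e01 : 0 < e <= 1 by rewrite e0.
have [C1 C10 hC1] := fisher_le_near0 (pair_coef W U) b D0 nu0 hmax e01 he.
have [C2 C20 hC2] : fisher_log_rate (pair_coef W U) (pair_sqdist x) deg i0 nu sg b.
  case: hsg => [s0|[nu1 es eb]].
    by apply: (fisher_log_rate_ge0 b D0 nu0 van hmax (j0 := j0)).
  by apply: (fisher_log_rate_matern D0 nu0 van hmax (j0 := j0)).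
pose A1 := C * (Z^-1 * C1); pose A2 := C * (Z^-1 * C2).
have A10 : 0 <= A1 by rewrite !mulr_ge0 ?invr_ge0 // ltW.
have A20 : 0 <= A2 by rewrite !mulr_ge0 ?invr_ge0 // ltW.
have B10 : 0 <= 2 / e * A1 by rewrite mulr_ge0 // divr_ge0 // ltW.
have B20 : 0 <= 8 * A2 by rewrite mulr_ge0.
apply: le_lt_trans (ltry _).
apply: le_trans (rate_integral_le e0 B10 B20).
apply: le_integral_nonneg => theta; rewrite /= in_itv /= andbT => t0.
  exact: posterior_ge0.
have [t1|/ltW t1] := leP theta 1.
  have t01 : 0 < theta <= 1 by rewrite t0.
  apply: le_trans (post _ _ t0 (hC1 theta t01)) _; rewrite lee_fin.
  have := rate_ge_small e0 A10 B20 t01; apply: le_trans.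
  by rewrite /A1 !mulrA.
apply: le_trans (post _ _ t0 (hC2 theta t1)) _; rewrite lee_fin.
have := rate_ge_large e0 B10 A20 t1; apply: le_trans.
by rewrite /A2 !mulrA.
Qed.

End mixture.

End propriety.

Theorem theorem4p4 (R : realType) (r n p : nat)
    (hr : (1 <= r)%N) (hn : (1 <= n)%N) (hp : (p < n)%N)
    (K : R -> R)
    (hK : (exists2 nu : R, 0 < nu & K = rational_quadratic nu)
          \/ K = squared_exponential
          \/ (exists2 nu : R, 1 <= nu & K = matern nu))
    (x : 'I_n -> 'rV[R]_r) (hx : injective x)
    (H : 'M[R]_(n, p)) (hH : \rank H = p)
    (W : 'M[R]_(n, n - p)) (hW : W^T *m W = 1%:M) (hHW : H^T *m W = 0) :
  exists Hn : {vspace 'cV[R]_n},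
    \dim Hn = (n - 1)%N /\
    forall y : 'cV[R]_n, y \notin Hn ->
      (\int[@lebesgue_measure R]_(theta in `]0%R, +oo[)
         (integrated_likelihood H (corr_mx K x) y theta
          * (reference_prior (proj_mx_fun W (corr_mx K x)) theta)%:E)
       < +oo)%E.
Proof.
have npm : n = (p + (n - p))%N by rewrite subnKC // ltnW.
have m0 : (0 < n - p)%N by rewrite subn_gt0.
suff [w [w0 hw]] : exists w : 'rV[R]_n, w != 0 /\
    forall y : 'cV[R]_n, w *m y != 0 ->
    (\int[@lebesgue_measure R]_(theta in `]0%R, +oo[)
       (integrated_likelihood H (corr_mx K x) y theta
        * (reference_prior (proj_mx_fun W (corr_mx K x)) theta)%:E) < +oo)%E.
  exists (lker (linfun (mulmx w : 'cV[R]_n -> 'M[R]_1))); split.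
    exact: dim_lker_row.
  by move=> y; rewrite memv_ker lfunE /=; exact: hw.
case: hK => [[nu nu0 ->]|[->|[nu nu1 ->]]].
- apply: (@posterior_proper R r n p (n - p) x H W nu 1 0) => //; first by left.
  by move=> tau _; exact: rational_quadratic_mix.
- apply: (@posterior_proper R r n p (n - p) x H W 1 0 0) => //; first by left.
  by move=> tau _; exact: squared_exponential_mix.
- have nu0 : 0 < nu by exact: lt_le_trans nu1.
  apply: (@posterior_proper R r n p (n - p) x H W nu (-1) (ln nu)) => //.
  + by right.
  + by move=> tau; exact: matern_mix.
Qed.
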